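(* Let $p\ge 1$ be an integer, let $a,t\in\mathbb{C}$ with $\operatorname{Re} a>0$ and $|t|<\operatorname{Re} a$. Then $$\sum_{n=1}^{\infty}\frac{\zeta(n+1,a)}{n+p}\,t^{n+p}=\frac{t^p}{p}\bigl(\psi(a)+\gamma\bigr)+\sum_{k=0}^{p-1}\binom{p-1}{k}\,g(k,a-t)\,t^{p-1-k}-g(p-1,a).$$
   Context: For $\operatorname{Re} a>0$, $\zeta(s,a)$ is the Hurwitz zeta function: $\zeta(s,a)=\sum_{n=0}^\infty (n+a)^{-s}$ for $\operatorname{Re} s>1$ (principal powers), extended analytically in $s$ to $\mathbb{C}\setminus\{1\}$; $\zeta'(s,a)=\partial_s\zeta(s,a)$. $\psi=\Gamma'/\Gamma$ is the digamma function and $\gamma=-\psi(1)$ is Euler's constant. For integers $n\ge 0$ and $\operatorname{Re} a>0$, $$g(n,a)=\zeta'(-n,a)+\psi(n+1)\,\zeta(-n,a).$$ The convention $t^0=1$ (also for $t=0$) is used. *)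

(* Defs.v *)
(* Stdlib reals with Coquelicot: [C] is Coquelicot's type of complex numbers. *)
From Stdlib Require Import Reals ClassicalEpsilon.
From Coquelicot Require Import Coquelicot.

Open Scope C_scope.

Definition Cexp (z : C) : C :=
  RtoC (exp (Re z)) * (cos (Im z), sin (Im z)).

(* Principal argument, in (-PI, PI] for z <> 0. *)
Definition Carg (z : C) : R :=
  if Rlt_dec (Im z) 0 then (- acos (Re z / Cmod z))%R
  else acos (Re z / Cmod z)%R.

Definition Clog (z : C) : C := (ln (Cmod z), Carg z).

(* Principal power w^s, meaningful for w <> 0; the infix [^] on [C] is
   Coquelicot's power with a natural exponent. *)
Definition Cpowc (w s : C) : C := Cexp (s * Clog w).

(* Euler's integral; meaningful for Re z > 0, where it converges. *)
Definition CGamma (z : C) : C :=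
  @RInt_gen C_R_CompleteNormedModule
    (fun x : R => Cpowc (RtoC x) (z - 1) * RtoC (exp (- x)))
    (at_right 0) (Rbar_locally p_infty).

(* [C_derive f z] is the complex derivative whenever f is complex
   differentiable at z (Coquelicot's [is_C_derive_unique]). *)
Definition digamma (z : C) : C := C_derive CGamma z / CGamma z.

Definition euler_gamma : C := - digamma 1.

Definition analytic_at (f : C -> C) (z0 : C) : Prop :=
  exists (c : nat -> C) (r : R), (0 < r)%R /\
    forall z : C, (Cmod (z - z0) < r)%R ->
      @is_pseries C_AbsRing C_NormedModule c (z - z0) (f z).

Definition is_hurwitz_continuation (a : C) (f : C -> C) : Prop :=
  (forall s : C, (1 < Re s)%R ->
     @is_series C_AbsRing C_NormedModule
       (fun n : nat => Cpowc (RtoC (INR n) + a) (- s)) (f s)) /\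
  (forall s : C, s <> 1 -> analytic_at f s).

(* For Re a > 0 a continuation exists, and two continuations agree off s = 1
   by the identity theorem; so the choice only affects the values at the pole
   s = 1 and the case Re a <= 0. *)
Definition hurwitz_zeta (s a : C) : C :=
  epsilon (inhabits (fun _ : C => RtoC 0)) (is_hurwitz_continuation a) s.

Definition hurwitz_zeta' (s a : C) : C :=
  C_derive (fun u : C => hurwitz_zeta u a) s.

Definition g (n : nat) (a : C) : C :=
  hurwitz_zeta' (- RtoC (INR n)) a
  + digamma (RtoC (INR n) + 1) * hurwitz_zeta (- RtoC (INR n)) a.

(* Main.v *)
(* Write [w_n = n + a]. Truncated Euler-Maclaurin summation approximates zeta(s,a) by
   [em_approx M s a N = sum_(n<N) w_n^(-s) + sum_(j<=M) (B_j/j!) psi_j(s, w_N)], where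
   [psi_0 = w^(1-s)/(s-1)] and [psi_(j+1)] is the w-derivative of [psi_j]; consecutive
   approximants differ by O(N^(-2)) locally uniformly in [s] once [Re s + M > 1], so by
   Weierstrass' theorem the limit is the analytic continuation and the s-derivatives converge
   too.  The combinations [G_k = d/ds em_approx + psi(k+1) em_approx] at [s = -k] tend to
   g(k,a) and form an Appell sequence exactly, before the limit: [dG_k/da = k G_(k-1)], while
   [dG_0/da] tends to psi(a) + gamma by the asymptotics of the Gamma function.  Hence
   the sum of [C(p-1,k) G_k(a-t) t^(p-1-k)] over k has t-derivative [-t^(p-1) G_0'(a-t)], and expanding the
   resolvents [1/(w_n - t)] contained in [G_0'] to order L gives the L-th partial sum of the
   series with an error of order [(|t|/Re a)^L]. *)
Require Import Defs.
From Stdlib Require Import Reals Lra Lia Wf_nat Factorial ClassicalEpsilon.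
From Coquelicot Require Import Coquelicot.
Open Scope R_scope.

(** The obstacle: g(k,a) contains an s-derivative of a continuation that is only chosen by
    [epsilon], and the identity has to be differentiated in a. Differentiating the limit in a would
    require convergence uniform in a as well as in s. So every a-derivative is taken at fixed N, of
    a finite expression along the segment from a to a - t, where it is an exact identity. Only
    values pass to the limit, and a mean value inequality carries the bound on the derivative over
    to them. The same M serves all k, since the Appell relation is exact only between approximants
    with equally many correction terms. The pole at s = 1 is where the Appell chain ends: the
    derivative of G_0 contains the divergent sum of 1/w_n, balanced by a logarithm of w_N, and this
    is the origin of psi(a) + gamma. The complex analysis avoids contour integrals: Cauchy's
    estimate comes from averages over roots of unity, and the Gamma function from real integrals of
    components and the concentration of a probability density. *)

(** * Limits of complex sequences and finite complex sums *)

Definition clim (u : nat -> C) (l : C) : Prop :=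
  is_lim_seq (fun n => Cmod (u n - l)) 0.

Fixpoint csum (f : nat -> C) (n : nat) : C :=
  match n with O => RtoC 0 | S m => (csum f m + f m)%C end.

Lemma clim_spec u l :
  clim u l <-> forall eps, 0 < eps -> exists N, forall n, (N <= n)%nat -> Cmod (u n - l) < eps.
Proof.
  unfold clim. rewrite <- is_lim_seq_spec. split; intros H.
  - intros eps he. destruct (H (mkposreal eps he)) as [N HN]. exists N. intros n hn.
    specialize (HN n hn). simpl in HN. rewrite Rminus_0_r, Rabs_pos_eq in HN; auto. apply Cmod_ge_0.
  - intros eps. destruct (H eps (cond_pos eps)) as [N HN]. exists N. intros n hn.
    rewrite Rminus_0_r, Rabs_pos_eq; [apply HN; auto|]. apply Cmod_ge_0.
Qed.

Lemma clim_squeeze u l (e : nat -> R) :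
  (forall n, Cmod (u n - l) <= e n) -> is_lim_seq e 0 -> clim u l.
Proof.
  intros H He. apply (is_lim_seq_le_le (fun _ => 0) _ e); auto.
  - intros n; split; [apply Cmod_ge_0 | apply H].
  - apply is_lim_seq_const.
Qed.

Lemma clim_ext u v l : (forall n, u n = v n) -> clim u l -> clim v l.
Proof. intros H. apply is_lim_seq_ext. intros n; now rewrite H. Qed.

Lemma clim_const l : clim (fun _ => l) l.
Proof.
  apply (clim_squeeze _ _ (fun _ => 0)); [|apply is_lim_seq_const].
  intros _. replace (l - l)%C with (RtoC 0) by ring. rewrite Cmod_0; lra.
Qed.

Lemma lim0_scal c (e : nat -> R) : is_lim_seq e 0 -> is_lim_seq (fun n => c * e n) 0.
Proof.
  intros H. apply (is_lim_seq_scal_l _ c) in H. simpl in H.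
  now replace (Finite (c * 0)) with (Finite 0) in H by (f_equal; ring).
Qed.

Lemma lim0_plus (e1 e2 : nat -> R) :
  is_lim_seq e1 0 -> is_lim_seq e2 0 -> is_lim_seq (fun n => e1 n + e2 n) 0.
Proof.
  intros H1 H2. assert (H := is_lim_seq_plus' _ _ _ _ H1 H2). now rewrite Rplus_0_l in H.
Qed.

Lemma clim_plus u v k l : clim u k -> clim v l -> clim (fun n => u n + v n)%C (k + l)%C.
Proof.
  intros Hu Hv. apply (clim_squeeze _ _ (fun n => Cmod (u n - k) + Cmod (v n - l))).
  - intros n. replace (u n + v n - (k + l))%C with ((u n - k) + (v n - l))%C by ring.
    apply Cmod_triangle.
  - now apply lim0_plus.
Qed.

Lemma clim_scal c u l : clim u l -> clim (fun n => c * u n)%C (c * l)%C.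
Proof.
  intros Hu. apply (clim_squeeze _ _ (fun n => Cmod c * Cmod (u n - l))).
  - intros n. replace (c * u n - c * l)%C with (c * (u n - l))%C by ring.
    rewrite Cmod_mult; lra.
  - now apply lim0_scal.
Qed.

Lemma clim_opp u l : clim u l -> clim (fun n => - u n)%C (- l)%C.
Proof.
  intros Hu. replace (- l)%C with ((-1) * l)%C by ring.
  apply (clim_ext (fun n => (-1) * u n)%C); [intros; ring|]. now apply clim_scal.
Qed.

Lemma clim_minus u v k l : clim u k -> clim v l -> clim (fun n => u n - v n)%C (k - l)%C.
Proof. intros Hu Hv. apply clim_plus; auto. now apply clim_opp. Qed.

Lemma clim_bounded u l : clim u l -> exists B, forall n, Cmod (u n) <= B.
Proof.
  intros H. apply clim_spec with (eps := 1) in H; [|lra]. destruct H as [N HN].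
  assert (E : forall m, exists B, forall n, (n < m)%nat -> Cmod (u n) <= B).
  { induction m as [|m [B HB]]; [exists 0; intros; lia|].
    exists (Rmax B (Cmod (u m))). intros n hn. destruct (Nat.eq_dec n m) as [->|].
    - apply Rmax_r.
    - eapply Rle_trans; [apply HB; lia|apply Rmax_l]. }
  destruct (E N) as [B HB]. exists (Rmax B (1 + Cmod l)). intros n.
  destruct (Nat.lt_ge_cases n N) as [h|h].
  - eapply Rle_trans; [apply HB; auto|apply Rmax_l].
  - eapply Rle_trans; [|apply Rmax_r]. replace (u n) with ((u n - l) + l)%C by ring.
    eapply Rle_trans; [apply Cmod_triangle|]. specialize (HN n h). lra.
Qed.

Lemma clim_mult u v k l : clim u k -> clim v l -> clim (fun n => u n * v n)%C (k * l)%C.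
Proof.
  intros Hu Hv. destruct (clim_bounded _ _ Hv) as [B HB].
  apply (clim_squeeze _ _ (fun n => Cmod (u n - k) * B + Cmod k * Cmod (v n - l))).
  - intros n.
    replace (u n * v n - k * l)%C with ((u n - k) * v n + k * (v n - l))%C by ring.
    eapply Rle_trans; [apply Cmod_triangle|]. rewrite !Cmod_mult.
    apply Rplus_le_compat_r. apply Rmult_le_compat_l; [apply Cmod_ge_0|apply HB].
  - apply lim0_plus; [|now apply lim0_scal].
    apply is_lim_seq_ext with (fun n => B * Cmod (u n - k)); [intros; ring|now apply lim0_scal].
Qed.

Lemma clim_incr u l : clim u l -> clim (fun n => u (S n)) l.
Proof. intros H. unfold clim in *. now apply is_lim_seq_incr_1 in H. Qed.

Lemma clim_decr u l : clim (fun n => u (S n)) l -> clim u l.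
Proof. intros H. unfold clim in *. now apply is_lim_seq_incr_1. Qed.

Lemma clim_le u l (K : R) : clim u l -> (forall n, Cmod (u n) <= K) -> Cmod l <= K.
Proof.
  intros H HK. apply le_epsilon. intros eps he.
  apply clim_spec with (eps := eps) in H; auto. destruct H as [N HN].
  specialize (HN N (le_n _)). specialize (HK N).
  replace l with (u N + - (u N - l))%C by ring.
  eapply Rle_trans; [apply Cmod_triangle|]. rewrite Cmod_opp. lra.
Qed.

Lemma clim_unique u k l : clim u k -> clim u l -> k = l.
Proof.
  intros Hk Hl. apply Ceq_minus. apply Cmod_eq_0. apply Rle_antisym; [|apply Cmod_ge_0].
  apply (clim_le (fun n => u n - u n)%C).
  - now apply clim_minus.
  - intros n. replace (u n - u n)%C with (RtoC 0) by ring. rewrite Cmod_0; lra.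
Qed.

(** An interchange of limits, made for [weierstrass]: there the error [u n - l] is itself known only
    as a limit over the number m of summed functions, with a bound uniform in m. *)
Lemma clim_of_approx (u : nat -> C) l (e : nat -> R) (v : nat -> nat -> C) :
  (forall n, clim (v n) (u n - l)%C) -> (forall n m, Cmod (v n m) <= e n) ->
  is_lim_seq e 0 -> clim u l.
Proof.
  intros Hv Hb He. apply (clim_squeeze _ _ e); auto.
  intros n. eapply clim_le; [apply Hv|auto].
Qed.

Lemma csum_ext f g n : (forall k, (k < n)%nat -> f k = g k) -> csum f n = csum g n.
Proof. induction n; simpl; intros H; auto. rewrite IHn, H; auto. Qed.

Lemma csum_plus f g n : csum (fun k => f k + g k)%C n = (csum f n + csum g n)%C.
Proof. induction n; simpl; [ring|]. rewrite IHn; ring. Qed.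

Lemma csum_minus f g n : csum (fun k => f k - g k)%C n = (csum f n - csum g n)%C.
Proof. induction n; simpl; [ring|]. rewrite IHn; ring. Qed.

Lemma csum_scal c f n : csum (fun k => c * f k)%C n = (c * csum f n)%C.
Proof. induction n; simpl; [ring|]. rewrite IHn; ring. Qed.

Lemma csum_0 (f : nat -> C) n : (forall k, (k < n)%nat -> f k = 0) -> csum f n = 0.
Proof. induction n; simpl; intros H; auto. rewrite IHn, H; auto. ring. Qed.

Lemma csum_const c n : csum (fun _ => c) n = (RtoC (INR n) * c)%C.
Proof.
  induction n; [simpl; ring|]. rewrite S_INR, RtoC_plus. simpl csum. rewrite IHn. ring.
Qed.

Lemma csum_swap (f : nat -> nat -> C) n m :
  csum (fun i => csum (f i) m) n = csum (fun j => csum (fun i => f i j) n) m.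
Proof.
  induction n; simpl; [symmetry; now apply csum_0|]. now rewrite IHn, csum_plus.
Qed.

Lemma csum_single (f : nat -> C) n k :
  (k < n)%nat -> (forall i, (i < n)%nat -> i <> k -> f i = 0) -> csum f n = f k.
Proof.
  induction n; intros hk H; [lia|]. simpl.
  destruct (Nat.eq_dec k n) as [->|hn].
  - rewrite csum_0; [ring|]. intros i hi. apply H; lia.
  - rewrite IHn; [|lia|intros i hi; apply H; lia]. rewrite (H n); [ring|lia|lia].
Qed.

Lemma csum_first f n : csum f (S n) = (f O + csum (fun k => f (S k)) n)%C.
Proof.
  induction n; [simpl; ring|].
  change (csum f (S (S n))) with (csum f (S n) + f (S n))%C. rewrite IHn. simpl. ring.
Qed.

Lemma csum_telescope f n : csum (fun k => f (S k) - f k)%C n = (f n - f O)%C.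
Proof. induction n; simpl; [ring|]. rewrite IHn. ring. Qed.

Lemma csum_app f n m : csum f (n + m) = (csum f n + csum (fun k => f (n + k)%nat) m)%C.
Proof.
  induction m; simpl; [rewrite Nat.add_0_r; ring|].
  rewrite Nat.add_succ_r. simpl. rewrite IHm. ring.
Qed.

Lemma clim_csum (u : nat -> nat -> C) l m :
  (forall j, (j < m)%nat -> clim (u j) (l j)) ->
  clim (fun n => csum (fun j => u j n) m) (csum l m).
Proof.
  induction m; simpl; intros H; [apply clim_const|].
  apply clim_plus; auto.
Qed.


(** * Comparison of series *)

Fixpoint rsum (f : nat -> R) (n : nat) : R :=
  match n with O => 0 | S m => rsum f m + f m end.

Lemma csum_le f (g : nat -> R) n :
  (forall k, (k < n)%nat -> Cmod (f k) <= g k) -> Cmod (csum f n) <= rsum g n.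
Proof.
  induction n; intros H; simpl; [rewrite Cmod_0; lra|].
  eapply Rle_trans; [apply Cmod_triangle|]. apply Rplus_le_compat; auto.
Qed.

Lemma rsum_const c n : rsum (fun _ => c) n = INR n * c.
Proof. induction n; [simpl; ring|]. rewrite S_INR; simpl rsum. rewrite IHn. ring. Qed.

Lemma rsum_scal c f n : rsum (fun k => c * f k) n = c * rsum f n.
Proof. induction n; simpl; [ring|]. rewrite IHn; ring. Qed.

Lemma rsum_sum_n f n : rsum f (S n) = sum_n f n.
Proof.
  induction n; [rewrite sum_O; simpl; ring|].
  rewrite sum_Sn, <- IHn. reflexivity.
Qed.

Lemma csum_sum_n (f : nat -> C) n :
  csum f (S n) = @sum_n C_AbelianMonoid f n.
Proof.
  induction n; [rewrite sum_O; simpl; ring|].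
  rewrite sum_Sn, <- IHn. reflexivity.
Qed.

(** The bridge to Coquelicot's series. The index shifts by one because [sum_n] includes its upper
    bound while [csum f n] stops before n. *)
Lemma is_series_clim (f : nat -> C) (l : C) :
  @is_series C_AbsRing C_NormedModule f l <-> clim (csum f) l.
Proof.
  split; intros H.
  - apply clim_decr. apply clim_spec. intros eps he.
    assert (H1 := proj1 (filterlim_locally_ball_norm _ _) H (mkposreal eps he)).
    destruct H1 as [N HN]. exists N. intros n hn. rewrite csum_sum_n.
    apply (HN n hn).
  - apply filterlim_locally_ball_norm. intros eps.
    apply clim_incr in H. apply clim_spec with (eps := pos eps) in H; [|apply cond_pos].
    destruct H as [N HN]. exists N. intros n hn. specialize (HN n hn).
    rewrite csum_sum_n in HN. exact HN.
Qed.

Lemma ex_series_rsum_le M : ex_series M -> (forall n, 0 <= M n) ->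
  forall n, rsum M n <= Series M.
Proof.
  intros H H0 n. apply Rle_trans with (rsum M (S n)); [simpl; specialize (H0 n); lra|].
  rewrite rsum_sum_n. apply Series_correct in H.
  refine (is_lim_seq_incr_compare _ _ H _ n).
  intros m. rewrite sum_Sn. specialize (H0 (S m)). unfold plus; simpl. lra.
Qed.

Lemma Series_tail_lim M : ex_series M -> is_lim_seq (fun N => Series (fun k => M (N + k)%nat)) 0.
Proof.
  intros H. apply is_lim_seq_incr_1.
  apply is_lim_seq_ext with (fun N => Series M - sum_n M N).
  - intros N. rewrite (Series_incr_n M (S N)); [|lia|auto].
    change (Init.Nat.pred (S N)) with N. rewrite sum_n_Reals. ring.
  - replace (Finite 0) with (Finite (Series M - Series M)) by (f_equal; ring).
    apply is_lim_seq_minus'; [apply is_lim_seq_const|]. now apply Series_correct.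
Qed.

(** The M-test with its explicit tail; the tail is what later bounds the remainders of power series
    and the truncation error in [cauchy_estimate]. *)
Lemma csum_dominated f M :
  (forall n, Cmod (f n) <= M n) -> ex_series M ->
  exists l, clim (csum f) l /\
    forall N, Cmod (l - csum f N) <= Series (fun k => M (N + k)%nat).
Proof.
  intros H HM.
  destruct (@ex_series_le C_AbsRing C_CompleteNormedModule f M) as [l Hl]; auto.
  apply is_series_clim in Hl. exists l. split; auto. intros N.
  assert (HMN : ex_series (fun k => M (N + k)%nat)) by now apply ex_series_incr_n.
  apply (clim_le (fun m => csum f (N + m) - csum f N)%C).
  - apply clim_minus; [|apply clim_const].
    apply clim_spec. intros eps he. apply clim_spec with (eps := eps) in Hl; auto.
    destruct Hl as [P HP]. exists P. intros n hn. apply HP. lia.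
  - intros m. rewrite csum_app.
    replace (csum f N + csum (fun k => f (N + k)%nat) m - csum f N)%C
      with (csum (fun k => f (N + k)%nat) m) by ring.
    eapply Rle_trans; [apply csum_le; intros k _; apply H|].
    apply (ex_series_rsum_le (fun k => M (N + k)%nat)); auto.
    intros k. eapply Rle_trans; [apply Cmod_ge_0|apply H].
Qed.

Lemma Cmod_RtoC_nonneg x : 0 <= x -> Cmod (RtoC x) = x.
Proof. intros. rewrite Cmod_R. now apply Rabs_pos_eq. Qed.

(** * Power series *)

Definition has_pseries (f : C -> C) (c : nat -> C) (s0 : C) (r : R) : Prop :=
  forall z, Cmod (z - s0) < r -> clim (csum (fun k => c k * (z - s0) ^ k)%C) (f z).

Lemma has_pseries_coef_bound f c s0 r rho :
  has_pseries f c s0 r -> 0 < rho < r ->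
  exists B, 0 <= B /\ forall k, Cmod (c k) * rho ^ k <= B.
Proof.
  intros H [h0 h1].
  assert (Hz : Cmod (s0 + RtoC rho - s0) < r).
  { replace (s0 + RtoC rho - s0)%C with (RtoC rho) by ring. rewrite Cmod_RtoC_nonneg; lra. }
  apply H in Hz. destruct (clim_bounded _ _ Hz) as [B HB].
  assert (HB0 : 0 <= B) by (eapply Rle_trans; [apply Cmod_ge_0|apply (HB O)]).
  (* Each term is a difference of two consecutive partial sums, both bounded by B. *)
  exists (2 * B). split; [lra|]. intros k.
  replace (Cmod (c k) * rho ^ k) with (Cmod (c k * (s0 + RtoC rho - s0) ^ k)).
  - generalize (HB (S k)) (HB k). cbn [csum].
    set (t := (c k * _)%C). set (S0 := csum _ k). intros h2 h3.
    replace t with ((S0 + t) + - S0)%C by ring.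
    eapply Rle_trans; [apply Cmod_triangle|]. rewrite Cmod_opp. lra.
  - rewrite Cmod_mult, Cmod_pow. replace (s0 + RtoC rho - s0)%C with (RtoC rho) by ring.
    rewrite Cmod_RtoC_nonneg; lra.
Qed.

Lemma ex_series_geom_scal B q : 0 <= q < 1 -> ex_series (fun k => B * q ^ k).
Proof.
  intros h. apply (ex_series_scal_l B (fun k => q ^ k)).
  apply ex_series_geom. rewrite Rabs_pos_eq; lra.
Qed.

(** Abel's lemma: the coefficients are bounded at the intermediate radius (rho + r)/2, which leaves
    a geometric majorant at rho. *)
Lemma has_pseries_abs f c s0 r rho :
  has_pseries f c s0 r -> 0 <= rho < r -> ex_series (fun k => Cmod (c k) * rho ^ k).
Proof.
  intros H [h0 h1].
  destruct (has_pseries_coef_bound f c s0 r ((rho + r) / 2)) as [B [HB0 HB]]; auto; [lra|].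
  set (r1 := (rho + r) / 2) in *. assert (hr : rho < r1) by (unfold r1; lra).
  apply (@ex_series_le R_AbsRing R_CompleteNormedModule) with (fun k => B * (rho / r1) ^ k).
  - intros k. change (norm (Cmod (c k) * rho ^ k)) with (Rabs (Cmod (c k) * rho ^ k)).
    rewrite Rabs_pos_eq; [|apply Rmult_le_pos; [apply Cmod_ge_0|now apply pow_le]].
    replace (rho ^ k) with (r1 ^ k * (rho / r1) ^ k).
    + rewrite <- Rmult_assoc. apply Rmult_le_compat_r; auto.
      apply pow_le. apply Rdiv_le_0_compat; lra.
    + rewrite <- Rpow_mult_distr. f_equal. field. lra.
  - apply ex_series_geom_scal. split; [apply Rdiv_le_0_compat; lra|].
    apply Rlt_div_l; lra.
Qed.

(** Factoring h^n out of the tail leaves a series bounded uniformly on the closed disc. Used with n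
    = 2 for the derivative, with n = k + 1 for the vanishing of coefficients, and with n = 0 as a
    bound of f on a smaller disc. *)
Lemma has_pseries_rem f c s0 r rho n :
  has_pseries f c s0 r -> 0 < rho < r ->
  exists B, 0 <= B /\ forall h, Cmod h <= rho ->
    Cmod (f (s0 + h) - csum (fun k => c k * h ^ k) n)%C <= B * Cmod h ^ n.
Proof.
  intros H hr.
  assert (A : ex_series (fun k => Cmod (c k) * rho ^ k)) by (eapply has_pseries_abs; eauto; lra).
  set (B := Series (fun k => Cmod (c (n + k)%nat) * rho ^ k)).
  assert (A' : ex_series (fun k => Cmod (c (n + k)%nat) * rho ^ k)).
  { apply (ex_series_incr_n _ n) in A.
    apply (ex_series_scal_l (/ rho ^ n)) in A. revert A.
    apply ex_series_ext. intros k.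
    unfold scal; simpl; unfold mult; simpl. rewrite pow_add. field. apply pow_nonzero; lra. }
  assert (HB0 : 0 <= B).
  { eapply Rle_trans; [|apply (ex_series_rsum_le _ A') with (n := O)]; [simpl; lra|].
    intros k. apply Rmult_le_pos; [apply Cmod_ge_0|apply pow_le; lra]. }
  exists B. split; auto. intros h hh.
  assert (Hf : clim (csum (fun k => c k * h ^ k)%C) (f (s0 + h)%C)).
  { specialize (H (s0 + h)%C). replace (s0 + h - s0)%C with h in H by ring. apply H. lra. }
  destruct (csum_dominated (fun k => c (n + k)%nat * h ^ k)%C
    (fun k => Cmod (c (n + k)%nat) * rho ^ k)) as [l [Hl Hb]]; auto.
  { intros k. rewrite Cmod_mult, Cmod_pow. apply Rmult_le_compat_l; [apply Cmod_ge_0|].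
    apply pow_incr. split; [apply Cmod_ge_0|auto]. }
  replace (f (s0 + h)%C - csum (fun k => c k * h ^ k) n)%C with (h ^ n * l)%C.
  - rewrite Cmod_mult, Cmod_pow, Rmult_comm. apply Rmult_le_compat_r; [apply pow_le, Cmod_ge_0|].
    specialize (Hb O). simpl in Hb. replace (l - 0)%C with l in Hb by ring. exact Hb.
  - apply (clim_unique (fun m => h ^ n * csum (fun k => c (n + k)%nat * h ^ k) m)%C).
    + now apply clim_scal.
    + apply (clim_ext (fun m => csum (fun k => c k * h ^ k) (n + m) - csum (fun k => c k * h ^ k) n)%C).
      * intros m. rewrite csum_app.
        rewrite <- csum_scal. rewrite (csum_ext (fun k => h ^ n * (c (n + k)%nat * h ^ k))%C
          (fun k => c (n + k)%nat * h ^ (n + k))%C); [ring|]. intros k _. rewrite Cpow_add_r. ring.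
      * apply clim_minus; [|apply clim_const].
        apply clim_spec. intros eps he. apply clim_spec with (eps := eps) in Hf; auto.
        destruct Hf as [P HP]. exists P. intros m hm. apply HP. lia.
Qed.

Lemma has_pseries_0 f c s0 r : 0 < r -> has_pseries f c s0 r -> f s0 = c O.
Proof.
  intros hr H. specialize (H s0). apply (clim_unique (csum (fun k => c k * (s0 - s0) ^ k)%C)).
  - apply H. replace (s0 - s0)%C with (RtoC 0) by ring. now rewrite Cmod_0.
  - apply clim_decr. apply clim_ext with (fun _ => c O); [|apply clim_const].
    intros n. rewrite csum_first. rewrite csum_0; [simpl; ring|].
    intros k _. simpl. ring.
Qed.

(** * Complex derivatives *)

Definition cderiv (f : C -> C) (z d : C) : Prop := @is_derive C_AbsRing C_NormedModule f z d.

Lemma cderiv_spec f z d :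
  (forall eps, 0 < eps -> exists delta, 0 < delta /\ forall h, Cmod h < delta ->
     Cmod (f (z + h) - f z - h * d)%C <= eps * Cmod h) -> cderiv f z d.
Proof.
  intros H. split; [apply is_linear_scal_l|].
  intros x Hx. apply (@is_filter_lim_locally_unique C_AbsRing (AbsRing_NormedModule C_AbsRing)) in Hx.
  subst x.
  intros eps. destruct (H eps (cond_pos eps)) as [dl [h0 H0]].
  exists (mkposreal dl h0). intros y hy.
  change C in y. specialize (H0 (y - z)%C hy).
  replace (z + (y - z))%C with y in H0 by (change (@eq C y (z + (y - z))%C); ring). exact H0.
Qed.

Lemma cderiv_unique f z d1 d2 : cderiv f z d1 -> cderiv f z d2 -> d1 = d2.
Proof. intros H1 H2. rewrite <- (is_C_derive_unique f z d1); auto. now apply is_C_derive_unique. Qed.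

Lemma has_pseries_cderiv f c s0 r : 0 < r -> has_pseries f c s0 r -> cderiv f s0 (c 1%nat).
Proof.
  intros hr H. destruct (has_pseries_rem f c s0 r (r / 2) 2 H) as [B [HB0 HB]]; [lra|].
  apply cderiv_spec. intros eps he. exists (Rmin (r / 2) (eps / (B + 1))). split.
  - apply Rmin_pos; [lra|]. apply Rdiv_lt_0_compat; lra.
  - intros h hh. assert (h1 := Rmin_l (r / 2) (eps / (B + 1))).
    assert (h2 := Rmin_r (r / 2) (eps / (B + 1))).
    rewrite (has_pseries_0 f c s0 r hr H).
    replace (f (s0 + h) - c O - h * c 1%nat)%C with (f (s0 + h) - csum (fun k => c k * h ^ k) 2)%C
      by (simpl; ring).
    eapply Rle_trans; [apply HB; lra|].
    assert (B * Cmod h <= eps).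
    { assert (Cmod h < eps / (B + 1)) by lra. apply Rlt_div_r in H0; [|lra].
      assert (0 <= Cmod h) by apply Cmod_ge_0. lra. }
    simpl. assert (0 <= Cmod h) by apply Cmod_ge_0. nra.
Qed.

(** * Cauchy estimates and Weierstrass' theorem *)

Definition cis (x : R) : C := (cos x, sin x).

Lemma cis_plus x y : cis (x + y) = (cis x * cis y)%C.
Proof. unfold cis, Cmult; simpl. rewrite cos_plus, sin_plus. f_equal; ring. Qed.

Lemma cis_0 : cis 0 = 1.
Proof. unfold cis. now rewrite cos_0, sin_0. Qed.

Lemma Cmod_cis x : Cmod (cis x) = 1.
Proof.
  unfold Cmod, cis; simpl. rewrite !Rmult_1_r. replace (_ + _) with 1; [apply sqrt_1|].
  assert (H := sin2_cos2 x). unfold Rsqr in H. lra.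
Qed.

Lemma cis_pow x n : (cis x ^ n)%C = cis (INR n * x).
Proof.
  induction n; [simpl; rewrite Rmult_0_l; now rewrite cis_0|].
  rewrite Cpow_S, IHn, <- cis_plus. f_equal. rewrite S_INR. ring.
Qed.

Lemma cis_2PI (n : nat) : cis (INR n * (2 * PI)) = 1.
Proof.
  rewrite <- cis_pow. replace (cis (2 * PI)) with (RtoC 1); [apply Cpow_1_l|].
  unfold cis. now rewrite cos_2PI, sin_2PI.
Qed.

Lemma cis_neq_1 x : 0 < Rabs x < 2 * PI -> cis x <> 1.
Proof.
  intros h E. injection E as E1 E2.
  assert (Ec : cos (Rabs x) = 1).
  { unfold Rabs. destruct (Rcase_abs x); auto. now rewrite cos_neg. }
  assert (hs : 0 < sin (Rabs x / 2)) by (apply sin_gt_0; lra).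
  assert (D := cos_2a_sin (Rabs x / 2)). replace (2 * (Rabs x / 2)) with (Rabs x) in D by field.
  assert (0 < sin (Rabs x / 2) * sin (Rabs x / 2)) by now apply Rmult_lt_0_compat.
  lra.
Qed.

Lemma csum_geom q n : ((q - 1) * csum (fun j => q ^ j) n = q ^ n - 1)%C.
Proof. induction n; simpl; [ring|]. rewrite Cmult_plus_distr_l, IHn. ring. Qed.

(** Discrete orthogonality of characters; it takes the place of the contour integral in
    [cauchy_estimate]. *)
Lemma csum_roots_of_unity (N l k : nat) : (l < N)%nat -> (k < N)%nat ->
  csum (fun j => cis (INR j * (2 * PI * (INR l - INR k) / INR N))) N =
  if Nat.eq_dec l k then RtoC (INR N) else RtoC 0.
Proof.
  intros hl hk. assert (hN : 0 < INR N) by (apply lt_0_INR; lia).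
  destruct (Nat.eq_dec l k) as [->|hlk].
  - rewrite (csum_ext _ (fun _ => RtoC 1)).
    + rewrite csum_const. ring.
    + intros j _. replace (INR j * _) with 0 by (field; lra). apply cis_0.
  - set (x := 2 * PI * (INR l - INR k) / INR N).
    rewrite (csum_ext _ (fun j => cis x ^ j)%C) by (intros; now rewrite cis_pow).
    assert (hP := PI_RGT_0).
    assert (Hx : 0 < Rabs x < 2 * PI).
    { unfold x. replace (2 * PI * (INR l - INR k) / INR N) with (2 * PI / INR N * (INR l - INR k))
        by (field; lra).
      rewrite Rabs_mult, (Rabs_pos_eq (2 * PI / INR N)).
      2: apply Rlt_le, Rdiv_lt_0_compat; lra.
      assert (0 < 2 * PI / INR N) by (apply Rdiv_lt_0_compat; lra).
      assert (0 < Rabs (INR l - INR k)).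
      { apply Rabs_pos_lt. apply not_INR in hlk. lra. }
      assert (Rabs (INR l - INR k) < INR N).
      { apply lt_INR in hl. apply lt_INR in hk. assert (h1 := pos_INR l). assert (h2 := pos_INR k).
        apply Rabs_def1; lra. }
      split; [now apply Rmult_lt_0_compat|].
      apply Rlt_le_trans with (2 * PI / INR N * INR N); [now apply Rmult_lt_compat_l|].
      right. field. lra. }
    assert (G := csum_geom (cis x) N).
    replace (cis x ^ N)%C with (RtoC 1) in G.
    + assert (Hn : (cis x - 1)%C <> 0) by (apply Cminus_eq_contra, cis_neq_1; auto).
      replace (csum (fun j => cis x ^ j)%C N)
        with (/ (cis x - 1) * ((cis x - 1) * csum (fun j => cis x ^ j) N))%C by (field; auto).
      rewrite G. ring.
    + rewrite cis_pow. unfold x.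
      replace (INR N * _) with (INR l * (2 * PI) - INR k * (2 * PI)) by (field; lra).
      assert (E : (cis (INR l * (2 * PI) - INR k * (2 * PI)) * cis (INR k * (2 * PI)))%C = 1).
      { rewrite <- cis_plus. replace (_ - _ + _) with (INR l * (2 * PI)) by ring. apply cis_2PI. }
      rewrite cis_2PI in E. rewrite <- E. ring.
Qed.

(** The average of the partial sum of degree below N over the N points rho * exp(2 pi i j/N),
    twisted by the k-th character, is exactly c_k rho^k. On the circle this partial sum differs from
    f by at most the tail [T N], which disappears as N grows. *)
Lemma cauchy_estimate f c s0 r M k rho :
  has_pseries f c s0 r -> (forall z, Cmod (z - s0) < r -> Cmod (f z) <= M) ->
  0 < rho < r -> Cmod (c k) * rho ^ k <= M.
Proof.
  intros H HM hr.
  assert (A : ex_series (fun k => Cmod (c k) * rho ^ k)) by (eapply has_pseries_abs; eauto; lra).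
  set (T := fun N => Series (fun l => Cmod (c (N + l)%nat) * rho ^ (N + l))).
  assert (HT : is_lim_seq T 0) by apply (Series_tail_lim _ A).
  assert (Q : forall N, (k < N)%nat -> Cmod (c k) * rho ^ k <= M + T N).
  { intros N hN. assert (hN0 : 0 < INR N) by (apply lt_0_INR; lia).
    set (z := fun j => (RtoC rho * cis (INR j * (2 * PI / INR N)))%C).
    assert (Hz : forall j, Cmod (z j) = rho).
    { intros j. unfold z. rewrite Cmod_mult, Cmod_cis, Cmod_RtoC_nonneg; lra. }
    set (P := fun j => csum (fun l => c l * z j ^ l)%C N).
    assert (HP : forall j, Cmod (P j) <= M + T N).
    { intros j. assert (Hf := H (s0 + z j)%C).
      replace (s0 + z j - s0)%C with (z j) in Hf by ring.
      rewrite Hz in Hf. specialize (Hf (proj2 hr)).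
      destruct (csum_dominated (fun l => c l * z j ^ l)%C (fun l => Cmod (c l) * rho ^ l))
        as [l [Hl Hb]]; auto.
      { intros l. rewrite Cmod_mult, Cmod_pow, Hz. lra. }
      assert (l = f (s0 + z j)%C) by (eapply clim_unique; eauto). subst l.
      specialize (Hb N). fold (T N) in Hb. fold (P j) in Hb.
      replace (P j) with (f (s0 + z j) + - (f (s0 + z j) - P j))%C by ring.
      eapply Rle_trans; [apply Cmod_triangle|]. rewrite Cmod_opp.
      apply Rplus_le_compat; auto. apply HM.
      replace (s0 + z j - s0)%C with (z j) by ring. rewrite Hz. lra. }
    assert (E : csum (fun j => P j * cis (- INR j * (2 * PI * INR k / INR N)))%C N =
      (RtoC (INR N) * (c k * RtoC (rho ^ k)))%C).
    { rewrite (csum_ext _ (fun j => csum (fun l => c l * RtoC (rho ^ l) *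
         cis (INR j * (2 * PI * (INR l - INR k) / INR N)))%C N)).
      - rewrite csum_swap. rewrite (csum_single _ N k hN).
        + rewrite csum_scal, csum_roots_of_unity by auto. destruct (Nat.eq_dec k k); [ring|lia].
        + intros l hl hlk. rewrite csum_scal, csum_roots_of_unity by auto.
          destruct (Nat.eq_dec l k); [lia|ring].
      - intros j _. rewrite Cmult_comm. unfold P. rewrite <- csum_scal. apply csum_ext. intros l _.
        unfold z. rewrite Cpow_mult_l, cis_pow, RtoC_pow.
        replace (INR j * (2 * PI * (INR l - INR k) / INR N))
          with (- INR j * (2 * PI * INR k / INR N) + INR l * (INR j * (2 * PI / INR N))) by (field; lra).
        rewrite cis_plus. ring. }
    assert (E2 : Cmod (csum (fun j => P j * cis (- INR j * (2 * PI * INR k / INR N)))%C N)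
      <= INR N * (M + T N)).
    { rewrite <- rsum_const. apply csum_le. intros j _. rewrite Cmod_mult, Cmod_cis, Rmult_1_r. auto. }
    rewrite E, !Cmod_mult, !Cmod_RtoC_nonneg in E2; [|apply pow_le|]; try lra.
    apply Rmult_le_reg_l in E2; auto. }
  apply le_epsilon. intros eps he. apply is_lim_seq_spec in HT.
  destruct (HT (mkposreal eps he)) as [N0 HN0].
  specialize (HN0 (N0 + S k)%nat ltac:(lia)). specialize (Q (N0 + S k)%nat ltac:(lia)).
  simpl in HN0. rewrite Rminus_0_r in HN0. apply Rabs_def2 in HN0. lra.
Qed.

(** Cauchy's estimate gives |c n k| rho^k <= M n, so the coefficients can be summed over n. Their
    convergence is part of the conclusion because the coefficient k = 1 later yields the convergence
    of the s-derivatives. *)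
Theorem weierstrass (F : nat -> C -> C) (c : nat -> nat -> C) (f : C -> C) s0 r rho M :
  (forall n, has_pseries (F n) (c n) s0 r) ->
  (forall n z, Cmod (z - s0) < r -> Cmod (F n z) <= M n) -> ex_series M ->
  (forall z, Cmod (z - s0) < r -> clim (csum (fun n => F n z)) (f z)) ->
  0 < rho < r ->
  exists d, has_pseries f d s0 rho /\ forall k, clim (csum (fun n => c n k)) (d k).
Proof.
  intros HF HM EM Hf hr.
  assert (HM0 : forall n, 0 <= M n).
  { intros n. eapply Rle_trans; [apply Cmod_ge_0|apply (HM n s0)].
    replace (s0 - s0)%C with (RtoC 0) by ring. rewrite Cmod_0; lra. }
  assert (Hc : forall n k, Cmod (c n k) * rho ^ k <= M n).
  { intros n k. eapply cauchy_estimate; eauto. }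
  assert (Hd : forall k, exists d, clim (csum (fun n => c n k)) d).
  { intros k. destruct (csum_dominated (fun n => c n k) (fun n => / rho ^ k * M n)) as [l [Hl _]].
    - intros n. apply Rmult_le_reg_l with (rho ^ k); [apply pow_lt; lra|].
      rewrite <- Rmult_assoc, Rinv_r, Rmult_1_l; [rewrite Rmult_comm; apply Hc|].
      apply pow_nonzero; lra.
    - now apply (ex_series_scal_l (/ rho ^ k) M).
    - now exists l. }
  set (d := fun k => proj1_sig (ClassicalEpsilon.constructive_indefinite_description _ (Hd k))).
  assert (Hdk : forall k, clim (csum (fun n => c n k)) (d k)).
  { intros k. unfold d. now destruct ClassicalEpsilon.constructive_indefinite_description. }
  exists d. split; auto.
  intros z hz. set (h := (z - s0)%C) in *. set (q := Cmod h / rho).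
  assert (hq : 0 <= q < 1).
  { unfold q. split; [apply Rdiv_le_0_compat; [apply Cmod_ge_0|lra]|]. apply Rlt_div_l; lra. }
  assert (hh : Cmod h = rho * q) by (unfold q; field; lra).
  (* [v K N] is the total error of truncating the first N functions at degree K. Its bound is a
     geometric tail summed against M, hence independent of N. *)
  apply clim_of_approx with (e := fun K => Series M / (1 - q) * q ^ K)
    (v := fun K N => csum (fun n => csum (fun k => c n k * h ^ k) K - F n z)%C N).
  - intros K. apply clim_ext with
      (fun N => csum (fun n => csum (fun k => c n k * h ^ k) K) N - csum (fun n => F n z) N)%C.
    { intros N. now rewrite csum_minus. }
    apply clim_minus; [|apply Hf; fold h; lra].
    apply clim_ext with (fun N => csum (fun k => csum (fun n => c n k * h ^ k) N) K)%C.
    { intros N. apply csum_swap. }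
    apply (clim_csum (fun k N => csum (fun n => c n k * h ^ k)%C N)). intros k _.
    apply clim_ext with (fun N => h ^ k * csum (fun n => c n k) N)%C.
    { intros N. rewrite <- csum_scal. apply csum_ext. intros; ring. }
    rewrite Cmult_comm. now apply clim_scal.
  - intros K N.
    apply Rle_trans with (rsum (fun n => q ^ K / (1 - q) * M n) N).
    + apply csum_le. intros n _.
      replace (csum (fun k => c n k * h ^ k) K - F n z)%C
        with (- (F n z - csum (fun k => c n k * h ^ k) K))%C by ring.
      rewrite Cmod_opp.
      destruct (csum_dominated (fun k => c n k * h ^ k)%C (fun k => M n * q ^ k)) as [l [Hl Hb]].
      * intros k. rewrite Cmod_mult, Cmod_pow, hh, Rpow_mult_distr, <- Rmult_assoc.
        apply Rmult_le_compat_r; [apply pow_le; lra|auto].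
      * now apply ex_series_geom_scal.
      * assert (l = F n z) by (eapply clim_unique; [apply Hl|]; apply HF; unfold h in *; lra).
        subst l. eapply Rle_trans; [apply Hb|]. right.
        rewrite (Series_ext _ (fun k => (M n * q ^ K) * q ^ k)) by (intros; rewrite pow_add; ring).
        rewrite Series_scal_l, Series_geom by (rewrite Rabs_pos_eq; lra). field. lra.
    + rewrite rsum_scal.
      assert (0 <= q ^ K / (1 - q)) by (apply Rdiv_le_0_compat; [apply pow_le|]; lra).
      replace (Series M / (1 - q) * q ^ K) with (q ^ K / (1 - q) * Series M) by (field; lra).
      apply Rmult_le_compat_l; auto. now apply ex_series_rsum_le.
  - apply lim0_scal. apply is_lim_seq_geom. rewrite Rabs_pos_eq; lra.
Qed.

(** * Identity theorem *)

(** If all earlier coefficients vanish, the remainder bound at a zero s0 + h of f reads |c_k| |h|^k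
    <= B |h|^(k+1). Zeros with h arbitrarily small force c_k = 0. *)
Lemma has_pseries_zero_coefs f c s0 r :
  0 < r -> has_pseries f c s0 r ->
  (forall delta, 0 < delta -> exists z, 0 < Cmod (z - s0) < delta /\ f z = 0) ->
  forall k, c k = 0.
Proof.
  intros hr H Hz k. induction k as [k IH] using Wf_nat.lt_wf_ind.
  destruct (has_pseries_rem f c s0 r (r / 2) (S k) H) as [B [HB0 HB]]; [lra|].
  apply Cmod_eq_0. apply Rle_antisym; [|apply Cmod_ge_0].
  apply le_epsilon. intros eps he. rewrite Rplus_0_l.
  destruct (Hz (Rmin (r / 2) (eps / (B + 1)))) as [z [[hz1 hz2] hz3]].
  { apply Rmin_pos; [lra|]. apply Rdiv_lt_0_compat; lra. }
  set (h := (z - s0)%C) in *.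
  assert (h1 := Rmin_l (r / 2) (eps / (B + 1))).
  assert (h2 := Rmin_r (r / 2) (eps / (B + 1))).
  specialize (HB h ltac:(lra)). replace (s0 + h)%C with z in HB by (unfold h; ring).
  rewrite hz3 in HB. cbn [csum] in HB. rewrite csum_0 in HB.
  2: intros i hi; rewrite IH by auto; ring.
  replace (0 - (0 + c k * h ^ k))%C with (- (c k * h ^ k))%C in HB by ring.
  rewrite Cmod_opp, Cmod_mult, Cmod_pow in HB. simpl in HB.
  rewrite <- Rmult_assoc in HB. apply Rmult_le_reg_r in HB; [|now apply pow_lt].
  assert (Cmod h < eps / (B + 1)) by lra. apply Rlt_div_r in H0; [|lra]. nra.
Qed.

Lemma has_pseries_minus f g c d s0 r :
  has_pseries f c s0 r -> has_pseries g d s0 r ->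
  has_pseries (fun z => f z - g z)%C (fun k => c k - d k)%C s0 r.
Proof.
  intros Hf Hg z hz. apply clim_ext with
    (fun n => csum (fun k => c k * (z - s0) ^ k)%C n - csum (fun k => d k * (z - s0) ^ k)%C n)%C.
  - intros n. rewrite <- csum_minus. apply csum_ext; intros; ring.
  - apply clim_minus; auto.
Qed.

Lemma pow_n_C (z : C) k : @pow_n C_Ring z k = (z ^ k)%C.
Proof. induction k; [reflexivity|]. cbn [pow_n Cpow]. now rewrite IHk. Qed.

Lemma analytic_at_iff f s0 :
  analytic_at f s0 <-> exists c r, 0 < r /\ has_pseries f c s0 r.
Proof.
  assert (E : forall (c : nat -> C) z n,
    csum (fun k => @scal C_Ring C_ModuleSpace (@pow_n C_Ring z k) (c k)) n =
    csum (fun k => c k * z ^ k)%C n).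
  { intros c z n. apply csum_ext. intros k _. rewrite pow_n_C. apply Cmult_comm. }
  unfold analytic_at, has_pseries, is_pseries.
  split; intros [c [r [hr H]]]; exists c, r; split; auto; intros z hz; specialize (H z hz).
  - apply is_series_clim in H. revert H. apply clim_ext. intros n. apply E.
  - apply is_series_clim. revert H. apply clim_ext. intros n. symmetry. apply E.
Qed.

Definition vanishes_near (f : C -> C) (s : C) : Prop :=
  exists delta, 0 < delta /\ forall z, Cmod (z - s) < delta -> f z = 0.

Lemma analytic_vanishes_near f s :
  analytic_at f s ->
  (forall delta, 0 < delta -> exists z, 0 < Cmod (z - s) < delta /\ f z = 0) ->
  vanishes_near f s.
Proof.
  intros H Hz. apply analytic_at_iff in H. destruct H as [c [r [hr H]]].
  assert (Hc := has_pseries_zero_coefs f c s r hr H Hz).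
  exists r. split; auto. intros z hz. apply (clim_unique (csum (fun k => c k * (z - s) ^ k)%C)).
  - now apply H.
  - apply clim_ext with (fun _ => RtoC 0); [|apply clim_const].
    intros n. symmetry. apply csum_0. intros k _. rewrite Hc. ring.
Qed.

(** Connectedness of [0,1] by a supremum: m is the supremum of the parameters up to which f vanishes
    near every point. The point at m is an accumulation of zeros, so f vanishes near it too, and
    then also slightly beyond m unless m = 1. *)
Theorem identity_segment (f : C -> C) (u v : C) :
  v <> 0 -> (forall x, 0 <= x <= 1 -> analytic_at f (u + RtoC x * v)%C) ->
  vanishes_near f u -> vanishes_near f (u + v)%C.
Proof.
  intros hv Ha H0.
  set (g := fun x => (u + RtoC x * v)%C).
  assert (Hg : forall x y, Cmod (g x - g y)%C = Rabs (x - y) * Cmod v).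
  { intros x y. unfold g. replace (u + x * v - (u + y * v))%C with (RtoC (x - y) * v)%C
      by (rewrite RtoC_minus; ring). rewrite Cmod_mult, Cmod_R. reflexivity. }
  assert (hv0 : 0 < Cmod v) by now apply Cmod_gt_0.
  set (E := fun x => 0 <= x <= 1 /\ forall y, 0 <= y <= x -> vanishes_near f (g y)).
  assert (E0 : E 0).
  { split; [lra|]. intros y hy. replace y with 0 by lra. unfold g.
    replace (u + 0 * v)%C with u by ring. auto. }
  destruct (completeness E) as [m [Hm1 Hm2]].
  { exists 1. intros x [hx _]. lra. }
  { now exists 0. }
  assert (hm0 : 0 <= m) by now apply Hm1.
  assert (hm1 : m <= 1) by (apply Hm2; intros x [hx _]; lra).
  assert (Hbelow : forall y, 0 <= y < m -> vanishes_near f (g y)).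
  { intros y hy. destruct (Classical_Prop.classic (exists x, E x /\ y < x)) as [[x [Ex hx]]|N].
    - apply Ex. lra.
    - exfalso. apply (Rlt_not_le m y); [lra|]. apply Hm2. intros x Ex.
      destruct (Rle_lt_dec x y); auto. exfalso. apply N. now exists x. }
  assert (Hmv : vanishes_near f (g m)).
  { destruct (Req_dec m 0) as [->|hm].
    - apply E0; lra.
    - apply analytic_vanishes_near; [apply Ha; lra|]. intros delta hd.
      (* A parameter below m whose point lies within delta/2 of [g m]. *)
      set (y := Rmax 0 (m - delta / (2 * Cmod v))).
      assert (hdv : 0 < delta / (2 * Cmod v)) by (apply Rdiv_lt_0_compat; lra).
      assert (hy : 0 <= y < m) by (split; [apply Rmax_l|apply Rmax_lub_lt; lra]).
      exists (g y). split.
      + rewrite Hg, Rabs_left by lra. split; [apply Rmult_lt_0_compat; lra|].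
        apply Rle_lt_trans with (delta / (2 * Cmod v) * Cmod v).
        * apply Rmult_le_compat_r; [lra|]. assert (h := Rmax_r 0 (m - delta / (2 * Cmod v))).
          fold y in h. lra.
        * replace (delta / (2 * Cmod v) * Cmod v) with (delta / 2) by (field; lra). lra.
      + destruct (Hbelow y hy) as [d [hd0 Hd]]. apply Hd.
        replace (g y - g y)%C with (RtoC 0) by ring. now rewrite Cmod_0. }
  destruct (Req_dec m 1) as [hm|hm].
  - subst m. unfold g in Hmv. now replace (u + 1 * v)%C with (u + v)%C in Hmv by ring.
  - exfalso. destruct Hmv as [d [hd Hd]].
    (* Up to m + e the points stay within d/2 of [g m], so their discs of radius d/2 remain in the
       disc of radius d where f vanishes. *)
    set (e := Rmin (1 - m) (d / (2 * Cmod v))).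
    assert (hdv : 0 < d / (2 * Cmod v)) by (apply Rdiv_lt_0_compat; lra).
    assert (he : 0 < e) by (apply Rmin_pos; lra).
    apply (Rlt_not_le (m + e) m); [lra|]. apply Hm1. split.
    { assert (h := Rmin_l (1 - m) (d / (2 * Cmod v))). fold e in h. lra. }
    intros y hy. destruct (Rlt_le_dec y m) as [h|h]; [apply Hbelow; lra|].
    exists (d / 2). split; [lra|]. intros z hz. apply Hd.
    replace (z - g m)%C with ((z - g y) + (g y - g m))%C by ring.
    eapply Rle_lt_trans; [apply Cmod_triangle|].
    assert (Cmod (g y - g m)%C <= d / 2); [|lra].
    rewrite Hg, Rabs_pos_eq by lra.
    apply Rle_trans with (d / (2 * Cmod v) * Cmod v); [|right; field; lra].
    apply Rmult_le_compat_r; [lra|]. assert (h' := Rmin_r (1 - m) (d / (2 * Cmod v))).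
    fold e in h'. lra.
Qed.

(** * Complex exponential, logarithm and powers *)

Lemma exp_le_mono x y : x <= y -> exp x <= exp y.
Proof. intros [h| ->]; [left; now apply exp_increasing|lra]. Qed.

Lemma C_eq (z w : C) : Re z = Re w -> Im z = Im w -> z = w.
Proof. destruct z, w; unfold Re, Im; simpl; intros; now subst. Qed.

Lemma Cexp_cis z : Cexp z = (RtoC (exp (Re z)) * cis (Im z))%C.
Proof. reflexivity. Qed.

Lemma Cexp_plus z w : Cexp (z + w) = (Cexp z * Cexp w)%C.
Proof.
  rewrite !Cexp_cis, re_plus, im_plus, exp_plus, cis_plus, RtoC_mult. ring.
Qed.

Lemma Cexp_RtoC x : Cexp (RtoC x) = RtoC (exp x).
Proof. rewrite Cexp_cis, re_RtoC, im_RtoC, cis_0. ring. Qed.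

Lemma Cexp_0 : Cexp 0 = 1.
Proof. now rewrite Cexp_RtoC, exp_0. Qed.

Lemma Cmod_Cexp z : Cmod (Cexp z) = exp (Re z).
Proof.
  rewrite Cexp_cis, Cmod_mult, Cmod_cis, Cmod_RtoC_nonneg, Rmult_1_r; auto.
  apply Rlt_le, exp_pos.
Qed.

Lemma Cexp_neq_0 z : Cexp z <> 0.
Proof. apply Cmod_gt_0. rewrite Cmod_Cexp. apply exp_pos. Qed.

Lemma Cexp_opp z : Cexp (- z) = (/ Cexp z)%C.
Proof.
  assert (H : (Cexp z * Cexp (- z))%C = 1).
  { rewrite <- Cexp_plus. replace (z + - z)%C with (RtoC 0) by ring. apply Cexp_0. }
  replace (Cexp (- z)) with (/ Cexp z * (Cexp z * Cexp (- z)))%C.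
  - rewrite H. ring.
  - field. apply Cexp_neq_0.
Qed.

Lemma Cexp_INR n z : Cexp (RtoC (INR n) * z) = (Cexp z ^ n)%C.
Proof.
  induction n.
  - simpl. replace (0 * z)%C with (RtoC 0) by ring. apply Cexp_0.
  - rewrite S_INR, RtoC_plus, Cmult_plus_distr_r, Cexp_plus, IHn, Cmult_1_l.
    rewrite Cpow_S. ring.
Qed.

Lemma Cmod_sqr z : Cmod z = sqrt (Re z * Re z + Im z * Im z).
Proof. unfold Cmod, Re, Im. simpl. now rewrite !Rmult_1_r. Qed.

Lemma re_pos_neq_0 w : 0 < Re w -> w <> 0.
Proof. intros h ->. simpl in h. lra. Qed.

Lemma re_le_mod w : Re w <= Cmod w.
Proof. eapply Rle_trans; [apply Rle_abs|apply re_le_Cmod]. Qed.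

Lemma im_le_Cmod w : Rabs (Im w) <= Cmod w.
Proof. eapply Rle_trans; [apply Rmax_r|apply Rmax_Cmod]. Qed.

Lemma Cmod_le_re_im w : Cmod w <= Rabs (Re w) + Rabs (Im w).
Proof.
  replace w with (RtoC (Re w) + Ci * RtoC (Im w))%C at 1.
  - eapply Rle_trans; [apply Cmod_triangle|].
    rewrite Cmod_mult, Cmod_Ci, !Cmod_R. lra.
  - apply C_eq; destruct w; unfold Re, Im, Ci; simpl; ring.
Qed.

Lemma Cmod_pos_of_re w : 0 < Re w -> 0 < Cmod w.
Proof. intros. now apply Cmod_gt_0, re_pos_neq_0. Qed.

(** On the right half-plane the case distinction with [acos] becomes one differentiable formula; the
    derivative of [Clog] rests on it. *)
Lemma Carg_atan w : 0 < Re w -> Carg w = atan (Im w / Re w).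
Proof.
  intros h. assert (hm := Cmod_pos_of_re w h).
  set (th := atan (Im w / Re w)). assert (hb := atan_bound (Im w / Re w)). fold th in hb.
  assert (Hc : cos th = Re w / Cmod w).
  { unfold th. rewrite cos_atan, Cmod_sqr.
    replace (Re w * Re w + Im w * Im w) with ((Re w * Re w) * (1 + Rsqr (Im w / Re w)))
      by (unfold Rsqr; field; lra).
    rewrite sqrt_mult, sqrt_square; try lra.
    - field. split; [|lra]. apply Rgt_not_eq, sqrt_lt_R0. assert (H := Rle_0_sqr (Im w / Re w)). lra.
    - nra.
    - assert (H := Rle_0_sqr (Im w / Re w)). lra. }
  unfold Carg. rewrite <- Hc. destruct (Rlt_dec (Im w) 0) as [hi|hi].
  - assert (th < 0).
    { unfold th. rewrite <- atan_0. apply atan_increasing.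
      replace 0 with (0 * / Re w) by ring. apply Rmult_lt_compat_r; auto. now apply Rinv_0_lt_compat. }
    rewrite <- cos_neg, acos_cos; [ring|]. lra.
  - assert (0 <= th).
    { unfold th. rewrite <- atan_0. destruct (Req_dec (Im w) 0) as [->|].
      - right. f_equal. unfold Rdiv; ring.
      - left. apply atan_increasing. apply Rdiv_lt_0_compat; lra. }
    rewrite acos_cos; [reflexivity|]. lra.
Qed.

(** The 2 stands for pi/2, by way of PI <= 4. *)
Lemma Carg_bound w : 0 < Re w -> Rabs (Carg w) <= 2.
Proof.
  intros h. rewrite Carg_atan by auto. assert (H := atan_bound (Im w / Re w)).
  assert (h4 := PI_4). apply Rabs_le. lra.
Qed.

Lemma Cexp_Clog w : 0 < Re w -> Cexp (Clog w) = w.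
Proof.
  intros h. assert (hm := Cmod_pos_of_re w h).
  rewrite Cexp_cis. unfold Clog. simpl. rewrite exp_ln by auto. rewrite Carg_atan by auto.
  assert (Hs : 0 < 1 + Rsqr (Im w / Re w)) by (assert (H := Rle_0_sqr (Im w / Re w)); lra).
  assert (E : Cmod w = Re w * sqrt (1 + Rsqr (Im w / Re w))).
  { rewrite Cmod_sqr.
    replace (Re w * Re w + Im w * Im w) with ((Re w * Re w) * (1 + Rsqr (Im w / Re w)))
      by (unfold Rsqr; field; lra).
    rewrite sqrt_mult, sqrt_square; nra. }
  assert (Hq := sqrt_lt_R0 _ Hs).
  unfold cis. rewrite cos_atan, sin_atan, E. apply C_eq; simpl; field; lra.
Qed.

Lemma Cpowc_plus w s t : Cpowc w (s + t) = (Cpowc w s * Cpowc w t)%C.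
Proof. unfold Cpowc. now rewrite Cmult_plus_distr_r, Cexp_plus. Qed.

Lemma Cpowc_0 w : Cpowc w 0 = 1.
Proof. unfold Cpowc. replace (0 * Clog w)%C with (RtoC 0) by ring. apply Cexp_0. Qed.

Lemma Cpowc_opp w s : Cpowc w (- s) = (/ Cpowc w s)%C.
Proof.
  unfold Cpowc. replace (- s * Clog w)%C with (- (s * Clog w))%C by ring. apply Cexp_opp.
Qed.

Lemma Cpowc_INR w n : 0 < Re w -> Cpowc w (RtoC (INR n)) = (w ^ n)%C.
Proof. intros h. unfold Cpowc. now rewrite Cexp_INR, Cexp_Clog. Qed.

Lemma Cpowc_1 w : 0 < Re w -> Cpowc w 1 = w.
Proof. intros h. unfold Cpowc. rewrite Cmult_1_l. now apply Cexp_Clog. Qed.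

Lemma Cpowc_neq_0 w s : Cpowc w s <> 0.
Proof. apply Cexp_neq_0. Qed.

(** The modulus is exactly |w|^(Re s) exp(- Im s arg w), and |arg w| <= 2. *)
Lemma Cmod_Cpowc_le w s : 0 < Re w ->
  Cmod (Cpowc w s) <= Rpower (Cmod w) (Re s) * exp (2 * Rabs (Im s)).
Proof.
  intros h. unfold Cpowc, Rpower. rewrite Cmod_Cexp, re_mult, <- exp_plus.
  assert (H := Carg_bound w h). unfold Clog; simpl.
  assert (E : - (Im s * Carg w) <= 2 * Rabs (Im s)).
  { eapply Rle_trans; [apply Rle_abs|]. rewrite Rabs_Ropp, Rabs_mult.
    assert (0 <= Rabs (Im s)) by apply Rabs_pos. nra. }
  apply exp_le_mono. lra.
Qed.

(** * Derivatives along real paths *)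

(** All derivatives in a and in w are taken along real paths, component by component, so that mean
    value and Taylor estimates reduce to real ones. Complex derivatives are kept for s and for the
    argument of the Gamma function. *)
Definition pderiv (f : R -> C) (x : R) (d : C) : Prop :=
  is_derive (fun y => Re (f y)) x (Re d) /\ is_derive (fun y => Im (f y)) x (Im d).

Lemma pderiv_eq f x d d' : pderiv f x d -> d = d' -> pderiv f x d'.
Proof. now intros H <-. Qed.

Lemma pderiv_ext f g x d : (forall y, f y = g y) -> pderiv f x d -> pderiv g x d.
Proof.
  intros H [H1 H2]. split; eapply is_derive_ext; eauto; intros t; simpl; now rewrite H.
Qed.

Lemma pderiv_const c x : pderiv (fun _ => c) x 0.
Proof. split; apply (@is_derive_const R_AbsRing R_NormedModule). Qed.

Lemma pderiv_RtoC x : pderiv RtoC x 1.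
Proof.
  split; simpl.
  - apply (@is_derive_id R_AbsRing).
  - apply (@is_derive_const R_AbsRing R_NormedModule).
Qed.

Lemma pderiv_plus f g x d e : pderiv f x d -> pderiv g x e -> pderiv (fun y => f y + g y)%C x (d + e)%C.
Proof.
  intros [H1 H2] [H3 H4].
  split; apply (@is_derive_plus R_AbsRing R_NormedModule); assumption.
Qed.

Lemma pderiv_opp f x d : pderiv f x d -> pderiv (fun y => - f y)%C x (- d)%C.
Proof.
  intros [H1 H2]. split; apply (@is_derive_opp R_AbsRing R_NormedModule); assumption.
Qed.

Lemma pderiv_minus f g x d e : pderiv f x d -> pderiv g x e -> pderiv (fun y => f y - g y)%C x (d - e)%C.
Proof. intros. apply pderiv_plus; auto. now apply pderiv_opp. Qed.

Lemma pderiv_mult f g x d e :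
  pderiv f x d -> pderiv g x e -> pderiv (fun y => f y * g y)%C x (d * g x + f x * e)%C.
Proof.
  intros [H1 H2] [H3 H4]. split.
  - apply is_derive_ext with (fun y => Re (f y) * Re (g y) - Im (f y) * Im (g y)).
    + intros t. now rewrite re_mult.
    + replace (Re (d * g x + f x * e)%C) with
        ((Re d * Re (g x) + Re (f x) * Re e) - (Im d * Im (g x) + Im (f x) * Im e))
        by (rewrite re_plus, !re_mult; ring).
      apply (@is_derive_minus R_AbsRing R_NormedModule);
      apply Derive.is_derive_mult; assumption.
  - apply is_derive_ext with (fun y => Re (f y) * Im (g y) + Im (f y) * Re (g y)).
    + intros t. now rewrite im_mult.
    + replace (Im (d * g x + f x * e)%C) with
        ((Re d * Im (g x) + Re (f x) * Im e) + (Im d * Re (g x) + Im (f x) * Re e))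
        by (rewrite im_plus, !im_mult; ring).
      apply (@is_derive_plus R_AbsRing R_NormedModule);
      apply Derive.is_derive_mult; assumption.
Qed.

Lemma pderiv_scal c f x d : pderiv f x d -> pderiv (fun y => c * f y)%C x (c * d)%C.
Proof.
  intros H. eapply pderiv_eq; [apply pderiv_mult; [apply pderiv_const|apply H]|].
  cbv beta; ring.
Qed.

Lemma pderiv_affine u v x : pderiv (fun y => u + RtoC y * v)%C x v.
Proof.
  eapply pderiv_eq; [apply pderiv_plus; [apply pderiv_const|]|].
  - apply pderiv_mult; [apply pderiv_RtoC|apply pderiv_const].
  - cbv beta; ring.
Qed.

Lemma pderiv_pow f x d n :
  pderiv f x d -> pderiv (fun y => f y ^ n)%C x (RtoC (INR n) * f x ^ (n - 1) * d)%C.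
Proof.
  intros H. induction n.
  - simpl. eapply pderiv_eq; [apply pderiv_const|]. ring.
  - eapply pderiv_eq; [apply (pderiv_mult f (fun y => f y ^ n)%C); eauto|].
    rewrite S_INR, RtoC_plus. replace (S n - 1)%nat with n by lia.
    destruct n; [simpl; ring|]. replace (S n - 1)%nat with n by lia. rewrite Cpow_S. ring.
Qed.

Lemma pderiv_csum (f : nat -> R -> C) d x n :
  (forall k, (k < n)%nat -> pderiv (f k) x (d k)) ->
  pderiv (fun y => csum (fun k => f k y) n) x (csum d n).
Proof.
  induction n; intros H; simpl; [apply pderiv_const|]. apply pderiv_plus; auto.
Qed.

Lemma pderiv_Cexp f x d : pderiv f x d -> pderiv (fun y => Cexp (f y)) x (d * Cexp (f x))%C.
Proof.
  intros [H1 H2].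
  assert (He : is_derive (fun y => exp (Re (f y))) x (Re d * exp (Re (f x)))).
  { apply (@is_derive_comp R_AbsRing R_NormedModule exp); auto. apply is_derive_exp. }
  assert (Hc : is_derive (fun y => cos (Im (f y))) x (Im d * - sin (Im (f x)))).
  { apply (@is_derive_comp R_AbsRing R_NormedModule cos); auto. apply is_derive_cos. }
  assert (Hs : is_derive (fun y => sin (Im (f y))) x (Im d * cos (Im (f x)))).
  { apply (@is_derive_comp R_AbsRing R_NormedModule sin); auto. apply is_derive_sin. }
  split.
  - apply is_derive_ext with (fun y => exp (Re (f y)) * cos (Im (f y))).
    + intros t. unfold Cexp. rewrite re_scal_l. reflexivity.
    + replace (Re (d * Cexp (f x))%C) with
        (Re d * exp (Re (f x)) * cos (Im (f x)) + exp (Re (f x)) * (Im d * - sin (Im (f x))))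
        by (unfold Cexp; rewrite re_mult, re_scal_l, im_scal_l; simpl; ring).
      exact (Derive.is_derive_mult _ _ _ _ _ He Hc).
  - apply is_derive_ext with (fun y => exp (Re (f y)) * sin (Im (f y))).
    + intros t. unfold Cexp. rewrite im_scal_l. reflexivity.
    + replace (Im (d * Cexp (f x))%C) with
        (Re d * exp (Re (f x)) * sin (Im (f x)) + exp (Re (f x)) * (Im d * cos (Im (f x))))
        by (unfold Cexp; rewrite im_mult, re_scal_l, im_scal_l; simpl; ring).
      exact (Derive.is_derive_mult _ _ _ _ _ He Hs).
Qed.

Lemma is_derive_half_ln (u v : R -> R) x du dv :
  is_derive u x du -> is_derive v x dv -> 0 < u x * u x + v x * v x ->
  is_derive (fun y => / 2 * ln (u y * u y + v y * v y)) x
    ((du * u x + dv * v x) / (u x * u x + v x * v x)).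
Proof.
  intros H1 H2 hm. auto_derive.
  - repeat split; auto; try (now exists du); now exists dv.
  - replace (Derive (fun y => u y) x) with du by (symmetry; exact (is_derive_unique _ _ _ H1)).
    replace (Derive (fun y => v y) x) with dv by (symmetry; exact (is_derive_unique _ _ _ H2)).
    field. lra.
Qed.

Lemma is_derive_atan_ratio (u v : R -> R) x du dv :
  is_derive u x du -> is_derive v x dv -> 0 < u x ->
  is_derive (fun y => atan (v y / u y)) x
    ((dv * u x - du * v x) / (u x * u x + v x * v x)).
Proof.
  intros H1 H2 hm. auto_derive.
  - repeat split; auto; try (now exists du); try (now exists dv). lra.
  - replace (Derive (fun y => u y) x) with du by (symmetry; exact (is_derive_unique _ _ _ H1)).
    replace (Derive (fun y => v y) x) with dv by (symmetry; exact (is_derive_unique _ _ _ H2)).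
    field.
    split; [|lra]. nra.
Qed.

Lemma pderiv_Clog f x d :
  0 < Re (f x) -> pderiv f x d -> pderiv (fun y => Clog (f y)) x (d / f x)%C.
Proof.
  intros h [H1 H2].
  assert (Hloc : locally x (fun y => 0 < Re (f y))).
  { assert (Hc : continuous (fun y => Re (f y)) x).
    { apply (@ex_derive_continuous R_AbsRing R_NormedModule). now exists (Re d). }
    apply (Hc (fun r => 0 < r)). now apply open_gt. }
  assert (hn : f x <> 0) by now apply re_pos_neq_0.
  assert (hm : 0 < Re (f x) * Re (f x) + Im (f x) * Im (f x)).
  { assert (0 < Re (f x) * Re (f x)) by now apply Rmult_lt_0_compat.
    assert (h2 := Rle_0_sqr (Im (f x))). unfold Rsqr in h2. lra. }
  assert (Hd1 : Re (d / f x)%C = (Re d * Re (f x) + Im d * Im (f x)) /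
     (Re (f x) * Re (f x) + Im (f x) * Im (f x))).
  { unfold Cdiv. rewrite re_mult. unfold Cinv, Re, Im in *; simpl. field. lra. }
  assert (Hd2 : Im (d / f x)%C = (Im d * Re (f x) - Re d * Im (f x)) /
     (Re (f x) * Re (f x) + Im (f x) * Im (f x))).
  { unfold Cdiv. rewrite im_mult. unfold Cinv, Re, Im in *; simpl. field. lra. }
  split.
  - apply is_derive_ext_loc with (fun y => / 2 * ln (Re (f y) * Re (f y) + Im (f y) * Im (f y))).
    + revert Hloc. apply filter_imp. intros y hy. unfold Clog. simpl.
      rewrite Cmod_sqr. symmetry. rewrite <- Rpower_sqrt.
      * unfold Rpower. rewrite ln_exp. reflexivity.
      * assert (0 < Re (f y) * Re (f y)) by now apply Rmult_lt_0_compat.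
        assert (h2 := Rle_0_sqr (Im (f y))). unfold Rsqr in h2. lra.
    + rewrite Hd1. now apply (is_derive_half_ln (fun y => Re (f y)) (fun y => Im (f y))).
  - apply is_derive_ext_loc with (fun y => atan (Im (f y) / Re (f y))).
    + revert Hloc. apply filter_imp. intros y hy. unfold Clog. simpl. now rewrite Carg_atan.
    + rewrite Hd2. now apply (is_derive_atan_ratio (fun y => Re (f y)) (fun y => Im (f y))).
Qed.

Lemma pderiv_Cpowc f s x d :
  0 < Re (f x) -> pderiv f x d ->
  pderiv (fun y => Cpowc (f y) s) x (s * Cpowc (f x) (s - 1) * d)%C.
Proof.
  intros h H. eapply pderiv_eq.
  - apply (pderiv_Cexp (fun y => s * Clog (f y))%C). apply pderiv_scal. apply pderiv_Clog; eauto.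
  - cbv beta. change (Cexp (s * Clog (f x))) with (Cpowc (f x) s).
    replace s with ((s - 1) + 1)%C at 2 by ring. rewrite Cpowc_plus, Cpowc_1 by auto.
    field. now apply re_pos_neq_0.
Qed.

(** * Mean value inequalities and Taylor's formula *)

Lemma real_nondecreasing f df a b : a <= b ->
  (forall x, a <= x <= b -> is_derive f x (df x)) -> (forall x, a <= x <= b -> 0 <= df x) ->
  f a <= f b.
Proof.
  intros hab Hd Hp.
  destruct (MVT_gen f a b df) as [c [hc Hc]].
  - rewrite Rmin_left, Rmax_right by auto. intros x hx. apply Hd. lra.
  - rewrite Rmin_left, Rmax_right by auto. intros x hx. apply derivable_continuous_pt.
    exists (df x). apply is_derive_Reals. auto.
  - rewrite Rmin_left, Rmax_right in hc by auto. specialize (Hp c hc). nra.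
Qed.

(** Both [G - f] and [G + f] have non-negative derivatives. *)
Lemma increment_le (f df G dG : R -> R) a b : a <= b ->
  (forall x, a <= x <= b -> is_derive f x (df x)) ->
  (forall x, a <= x <= b -> is_derive G x (dG x)) ->
  (forall x, a <= x <= b -> Rabs (df x) <= dG x) -> Rabs (f b - f a) <= G b - G a.
Proof.
  intros hab Hf HG Hb.
  assert (A1 : G a - f a <= G b - f b).
  { apply (real_nondecreasing (fun y => G y - f y) (fun y => dG y - df y)); auto; intros x hx.
    - apply (@is_derive_minus R_AbsRing R_NormedModule); auto.
    - assert (h := Hb x hx). assert (h2 := Rle_abs (df x)). lra. }
  assert (A2 : G a + f a <= G b + f b).
  { apply (real_nondecreasing (fun y => G y + f y) (fun y => dG y + df y)); auto; intros x hx.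
    - apply (@is_derive_plus R_AbsRing R_NormedModule); auto.
    - assert (h := Hb x hx). assert (h2 := Rabs_maj2 (df x)). lra. }
  apply Rabs_le. lra.
Qed.

Lemma is_derive_pow_fact c m y :
  is_derive (fun y => c * y ^ S m / INR (fact (S m))) y (c * y ^ m / INR (fact m)).
Proof.
  assert (Hf := INR_fact_neq_0 m). assert (Hs := not_0_INR (S m) ltac:(lia)).
  apply is_derive_ext with (fun y => (c / INR (fact (S m))) * y ^ S m).
  { intros t. change (c / INR (fact (S m)) * t ^ S m = c * t ^ S m / INR (fact (S m))). unfold Rdiv. ring. }
  replace (c * y ^ m / INR (fact m)) with (c / INR (fact (S m)) * (INR (S m) * y ^ m)).
  - generalize (c / INR (fact (S m))). intros k. apply is_derive_scal.
    replace (INR (S m) * y ^ m) with (INR (S m) * 1 * y ^ Nat.pred (S m)) by (simpl Nat.pred; ring).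
    apply (is_derive_pow (fun t => t)). apply (@is_derive_id R_AbsRing).
  - rewrite fact_simpl, mult_INR. field. auto.
Qed.

(** The derivative of the error is the error of order n for the shifted family [fun i => D (S i)];
    the induction hypothesis bounds it, and [increment_le] integrates this bound from 0. *)
Lemma real_taylor (D : nat -> R -> R) n B x :
  (forall i y, (i < n)%nat -> 0 <= y <= 1 -> is_derive (D i) y (D (S i) y)) ->
  (forall y, 0 <= y <= 1 -> Rabs (D n y) <= B) -> 0 <= x <= 1 ->
  Rabs (D O x - rsum (fun i => D i 0 * x ^ i / INR (fact i)) n) <= B * x ^ n / INR (fact n).
Proof.
  revert D x. induction n; intros D x HD HB hx.
  - simpl. replace (D O x - 0) with (D O x) by ring. replace (B * 1 / 1) with B by field. auto.
  - set (e := fun y => D O y - rsum (fun i => D i 0 * y ^ i / INR (fact i)) (S n)).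
    set (de := fun y => D 1%nat y - rsum (fun i => D (S i) 0 * y ^ i / INR (fact i)) n).
    assert (Hde : forall y, 0 <= y <= 1 -> Rabs (de y) <= B * y ^ n / INR (fact n)).
    { intros y hy. apply (IHn (fun i => D (S i))); auto. intros i z hi. apply HD. lia. }
    assert (Hsum : forall m y, is_derive (fun y => rsum (fun i => D i 0 * y ^ i / INR (fact i)) (S m)) y
      (rsum (fun i => D (S i) 0 * y ^ i / INR (fact i)) m)).
    { intros m y. induction m.
      - simpl. auto_derive; auto.
      - apply (@is_derive_plus R_AbsRing R_NormedModule
          (fun y => rsum (fun i => D i 0 * y ^ i / INR (fact i)) (S m))
          (fun y => D (S m) 0 * y ^ (S m) / INR (fact (S m)))); [exact IHm|].
        apply is_derive_pow_fact. }
    assert (Hed : forall y, 0 <= y <= 1 -> is_derive e y (de y)).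
    { intros y hy. apply (@is_derive_minus R_AbsRing R_NormedModule); [|apply Hsum].
      apply HD; [lia|auto]. }
    assert (HG : forall y, is_derive (fun y => B * y ^ S n / INR (fact (S n))) y (B * y ^ n / INR (fact n))).
    { intros y. apply is_derive_pow_fact. }
    assert (e0 : e 0 = 0).
    { unfold e. clear. assert (H : rsum (fun i => D i 0 * 0 ^ i / INR (fact i)) (S n) = D O 0).
      { induction n; [simpl; field|]. change (rsum (fun i => D i 0 * 0 ^ i / INR (fact i)) (S n) +
          D (S n) 0 * 0 ^ (S n) / INR (fact (S n)) = D O 0). rewrite IHn, pow_i by lia.
        unfold Rdiv. ring. }
      rewrite H. ring. }
    assert (G0 : B * 0 ^ S n / INR (fact (S n)) = 0) by (rewrite pow_i by lia; unfold Rdiv; ring).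
    change (Rabs (e x) <= B * x ^ S n / INR (fact (S n))).
    replace (e x) with (e x - e 0) by (rewrite e0; ring).
    replace (B * x ^ S n / INR (fact (S n))) with
      (B * x ^ S n / INR (fact (S n)) - B * 0 ^ S n / INR (fact (S n))) by (rewrite G0; ring).
    apply (increment_le e de (fun y => B * y ^ S n / INR (fact (S n))) (fun y => B * y ^ n / INR (fact n)));
      [lra|intros y hy; apply Hed; lra|auto|intros y hy; apply Hde; lra].
Qed.

(** The factor 2 is the price of treating real and imaginary parts separately. *)
Lemma complex_taylor (D : nat -> R -> C) n B :
  (forall i y, (i < n)%nat -> 0 <= y <= 1 -> pderiv (D i) y (D (S i) y)) ->
  (forall y, 0 <= y <= 1 -> Cmod (D n y) <= B) ->
  Cmod (D O 1 - csum (fun i => D i 0 * RtoC (/ INR (fact i))) n)%C <= 2 * B / INR (fact n).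
Proof.
  intros HD HB.
  assert (H1 := real_taylor (fun i y => Re (D i y)) n B 1
    (fun i y hi hy => proj1 (HD i y hi hy))
    (fun y hy => Rle_trans _ _ _ (re_le_Cmod _) (HB y hy)) ltac:(lra)).
  assert (H2 := real_taylor (fun i y => Im (D i y)) n B 1
    (fun i y hi hy => proj2 (HD i y hi hy))
    (fun y hy => Rle_trans _ _ _ (im_le_Cmod _) (HB y hy)) ltac:(lra)).
  assert (E : forall m, Re (csum (fun i => D i 0 * RtoC (/ INR (fact i)))%C m) =
      rsum (fun i => Re (D i 0) * 1 ^ i / INR (fact i)) m /\
      Im (csum (fun i => D i 0 * RtoC (/ INR (fact i)))%C m) =
      rsum (fun i => Im (D i 0) * 1 ^ i / INR (fact i)) m).
  { induction m as [|m [IH1 IH2]]; [now split|]. cbn [csum rsum].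
    rewrite re_plus, im_plus, re_scal_r, im_scal_r, pow1, IH1, IH2.
    split; unfold Rdiv; ring. }
  cbv beta in H1, H2. destruct (E n) as [E1 E2]. rewrite <- E1 in H1. rewrite <- E2 in H2.
  rewrite pow1 in H1, H2.
  eapply Rle_trans; [apply Cmod_le_re_im|]. unfold Cminus.
  rewrite re_plus, im_plus, re_opp, im_opp.
  replace (2 * B / INR (fact n)) with (B * 1 / INR (fact n) + B * 1 / INR (fact n))
    by (field; apply INR_fact_neq_0).
  apply Rplus_le_compat; assumption.
Qed.

Lemma pderiv_mvt (f df : R -> C) B :
  (forall y, 0 <= y <= 1 -> pderiv f y (df y)) -> (forall y, 0 <= y <= 1 -> Cmod (df y) <= B) ->
  Cmod (f 1 - f 0)%C <= 2 * B.
Proof.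
  intros Hd HB.
  assert (H := complex_taylor (fun i => match i with O => f | _ => df end) 1 B). cbv beta in H.
  simpl in H. rewrite Rinv_1, Rdiv_1_r, Cmult_1_r, Cplus_0_l in H. apply H; auto.
  intros i y hi. replace i with O by lia. apply Hd.
Qed.

(** Taylor's formula for y -> exp(y w) on [0,1]; [1 + exp (Re w)] bounds exp(y Re w) there for
    either sign of Re w. *)
Lemma Cexp_taylor w n :
  Cmod (Cexp w - csum (fun i => w ^ i * RtoC (/ INR (fact i))) n)%C
    <= 2 * (Cmod w ^ n * (1 + exp (Re w))) / INR (fact n).
Proof.
  assert (H := complex_taylor (fun i y => w ^ i * Cexp (0 + RtoC y * w))%C n
    (Cmod w ^ n * (1 + exp (Re w)))).
  cbv beta in H.
  replace (w ^ 0 * Cexp (0 + 1 * w))%C with (Cexp w) in H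
    by (replace (0 + 1 * w)%C with w by ring; simpl; ring).
  rewrite (csum_ext _ (fun i => w ^ i * RtoC (/ INR (fact i)))%C) in H.
  2:{ intros i _. replace (0 + 0 * w)%C with (RtoC 0) by ring. rewrite Cexp_0. ring. }
  apply H.
  - intros i y _ _. eapply pderiv_eq; [apply pderiv_scal, pderiv_Cexp, pderiv_affine|].
    cbv beta. rewrite Cpow_S. ring.
  - intros y hy. rewrite Cmod_mult, Cmod_pow, Cmod_Cexp.
    apply Rmult_le_compat_l; [apply pow_le, Cmod_ge_0|].
    rewrite re_plus, re_scal_l, re_RtoC, Rplus_0_l. assert (h0 := exp_pos (Re w)).
    destruct (Rle_lt_dec 0 (Re w)).
    + assert (exp (y * Re w) <= exp (Re w)) by (apply exp_le_mono; nra). lra.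
    + assert (H0 : exp (y * Re w) <= exp 0) by (apply exp_le_mono; nra). rewrite exp_0 in H0. lra.
Qed.

Lemma Cexp_pseries (lam s0 : C) r :
  has_pseries (fun s => Cexp (lam * s)) (fun k => Cexp (lam * s0) * (lam ^ k * RtoC (/ INR (fact k))))%C s0 r.
Proof.
  intros z _. set (h := (z - s0)%C). set (w := (lam * h)%C).
  replace (lam * z)%C with (lam * s0 + w)%C by (unfold w, h; ring). rewrite Cexp_plus.
  apply clim_ext with (fun n => Cexp (lam * s0) * csum (fun k => w ^ k * RtoC (/ INR (fact k))) n)%C.
  { intros n. rewrite <- csum_scal. apply csum_ext. intros k _. unfold w. rewrite Cpow_mult_l. ring. }
  apply clim_scal.
  apply (clim_squeeze _ _ (fun n => 2 * (1 + exp (Re w)) * (Cmod w ^ n / INR (fact n)))).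
  - intros n. rewrite <- Cmod_opp, Copp_minus_distr. eapply Rle_trans; [apply Cexp_taylor|].
    right. unfold Rdiv. ring.
  - apply lim0_scal.
    assert (H1 : ex_series (fun n => / INR (fact n) * Cmod w ^ n)).
    { exists (exp (Cmod w)). apply is_pseries_R. apply is_exp_Reals. }
    apply ex_series_lim_0 in H1. revert H1. apply is_lim_seq_ext. intros n. unfold Rdiv. ring.
Qed.

(** * Algebra of power series *)

Definition has_expansion (f : C -> C) (s0 : C) (r : R) : Prop :=
  exists c, has_pseries f c s0 r.

Lemma has_expansion_ext f g s0 r :
  (forall z, Cmod (z - s0) < r -> f z = g z) -> has_expansion f s0 r -> has_expansion g s0 r.
Proof. intros E [c H]. exists c. intros z hz. rewrite <- E by auto. now apply H. Qed.

Lemma has_expansion_weaken f s0 r r' : r' <= r -> has_expansion f s0 r -> has_expansion f s0 r'.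
Proof. intros h [c H]. exists c. intros z hz. apply H. lra. Qed.

Lemma has_expansion_plus f g s0 r :
  has_expansion f s0 r -> has_expansion g s0 r -> has_expansion (fun z => f z + g z)%C s0 r.
Proof.
  intros [c Hf] [d Hg]. exists (fun k => c k + d k)%C. intros z hz.
  apply clim_ext with
    (fun n => csum (fun k => c k * (z - s0) ^ k)%C n + csum (fun k => d k * (z - s0) ^ k)%C n)%C.
  - intros n. rewrite <- csum_plus. apply csum_ext; intros; ring.
  - apply clim_plus; auto.
Qed.

Lemma has_expansion_scal k f s0 r :
  has_expansion f s0 r -> has_expansion (fun z => k * f z)%C s0 r.
Proof.
  intros [c Hf]. exists (fun i => k * c i)%C. intros z hz.
  apply clim_ext with (fun n => k * csum (fun k => c k * (z - s0) ^ k)%C n)%C.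
  - intros n. rewrite <- csum_scal. apply csum_ext; intros; ring.
  - apply clim_scal; auto.
Qed.

Lemma has_expansion_minus f g s0 r :
  has_expansion f s0 r -> has_expansion g s0 r -> has_expansion (fun z => f z - g z)%C s0 r.
Proof.
  intros Hf Hg. apply has_expansion_ext with (fun z => f z + (-1) * g z)%C; [intros; ring|].
  apply has_expansion_plus; auto. now apply has_expansion_scal.
Qed.

Lemma has_expansion_const k s0 r : has_expansion (fun _ => k) s0 r.
Proof.
  apply has_expansion_ext with (fun z => k * Cexp (0 * z))%C.
  - intros z _. replace (0 * z)%C with (RtoC 0) by ring. rewrite Cexp_0. ring.
  - apply has_expansion_scal. eexists. apply Cexp_pseries.
Qed.

Lemma has_expansion_csum (f : nat -> C -> C) s0 r n :
  (forall k, (k < n)%nat -> has_expansion (f k) s0 r) ->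
  has_expansion (fun z => csum (fun k => f k z) n) s0 r.
Proof.
  induction n; intros H; simpl; [apply has_expansion_const|].
  apply has_expansion_plus; auto.
Qed.

Lemma has_pseries_shift f c s0 r :
  has_pseries f c s0 r ->
  has_pseries (fun z => (z - s0) * f z)%C (fun k => match k with O => RtoC 0 | S i => c i end) s0 r.
Proof.
  intros H z hz. apply clim_decr.
  apply clim_ext with (fun n => (z - s0) * csum (fun k => c k * (z - s0) ^ k) n)%C.
  - intros n. rewrite csum_first, <- csum_scal. rewrite Cmult_0_l, Cplus_0_l.
    apply csum_ext. intros k _. rewrite Cpow_S. ring.
  - apply clim_scal. auto.
Qed.

Lemma has_expansion_mul_linear f s0 r s1 :
  has_expansion f s0 r -> has_expansion (fun z => (z - s1) * f z)%C s0 r.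
Proof.
  intros [c H]. apply has_expansion_ext with (fun z => (z - s0) * f z + (s0 - s1) * f z)%C.
  { intros; ring. }
  apply has_expansion_plus.
  - eexists. apply has_pseries_shift. exact H.
  - apply has_expansion_scal. now exists c.
Qed.

Lemma has_expansion_mul_pow f s0 r n :
  has_expansion f s0 r -> has_expansion (fun z => (z - s0) ^ n * f z)%C s0 r.
Proof.
  intros H. induction n.
  - apply has_expansion_ext with f; auto. intros z _. simpl. ring.
  - apply has_expansion_ext with (fun z => (z - s0) * ((z - s0) ^ n * f z))%C.
    + intros. rewrite Cpow_S. ring.
    + now apply has_expansion_mul_linear.
Qed.

Lemma clim_geom q : Cmod q < 1 -> clim (csum (fun k => q ^ k)%C) (/ (1 - q))%C.
Proof.
  intros hq.
  assert (hn : (1 - q)%C <> 0).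
  { intros E. assert (Eq : q = 1) by (rewrite <- (Cplus_0_r q), <- E; ring).
    rewrite Eq, Cmod_1 in hq. lra. }
  apply (clim_squeeze _ _ (fun n => Cmod (/ (1 - q))%C * Cmod q ^ n)).
  - intros n. rewrite <- Cmod_pow, <- Cmod_mult, <- Cmod_opp. right. f_equal.
    replace (csum (fun k => q ^ k)%C n) with (- / (1 - q) * ((q - 1) * csum (fun k => q ^ k) n))%C
      by (field; auto).
    rewrite csum_geom. field; auto.
  - apply lim0_scal. apply is_lim_seq_geom. rewrite Rabs_pos_eq; auto. apply Cmod_ge_0.
Qed.

(** The factor 1/(z - s1) is a geometric series in (z - s0)/(s0 - s1), and the functions (z - s0)^k
    f(z) are summed by [weierstrass]; this replaces a product of two power series. *)
Lemma has_expansion_div_linear f s0 R0 r s1 :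
  has_expansion f s0 R0 -> 0 < r < R0 -> r < Cmod (s0 - s1) ->
  has_expansion (fun z => f z / (z - s1))%C s0 r.
Proof.
  intros [c H] hr h1. set (m := Rmin R0 (Cmod (s0 - s1))).
  assert (hm : r < m) by (apply Rmin_glb_lt; lra).
  assert (hm1 : m <= R0) by apply Rmin_l. assert (hm2 : m <= Cmod (s0 - s1)) by apply Rmin_r.
  (* [weierstrass] loses some radius, so the summation runs on a disc strictly larger than r on
     which the ratio r'/|e| is still below 1. *)
  set (r' := (r + m) / 2). set (e := (s0 - s1)%C) in *.
  assert (he : e <> 0) by (apply Cmod_gt_0; lra).
  destruct (has_pseries_rem f c s0 R0 r' 0 H) as [B [HB0 HB]]; [unfold r'; lra|].
  set (F := fun k z => (RtoC 1 / e * (- / e) ^ k * ((z - s0) ^ k * f z))%C).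
  assert (HF : forall k, exists c, has_pseries (F k) c s0 r').
  { intros k. apply has_expansion_scal. apply has_expansion_mul_pow.
    apply has_expansion_weaken with R0; [unfold r'; lra|now exists c]. }
  set (cc := fun k => proj1_sig (constructive_indefinite_description _ (HF k))).
  destruct (weierstrass F cc (fun z => f z / (z - s1))%C s0 r' r
    (fun k => (B / Cmod e) * (r' / Cmod e) ^ k)) as [d [Hd _]].
  - intros k. unfold cc. now destruct constructive_indefinite_description.
  - intros k z hz. unfold F. rewrite !Cmod_mult, !Cmod_pow, Cmod_div, Cmod_opp, Cmod_inv, Cmod_1; auto.
    assert (Hb := HB (z - s0)%C ltac:(lra)). replace (s0 + (z - s0))%C with z in Hb by ring.
    simpl in Hb. replace (f z - 0)%C with (f z) in Hb by ring. rewrite Rmult_1_r in Hb.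
    assert (h0 : 0 < / Cmod e) by (apply Rinv_0_lt_compat; lra).
    assert (Cmod (z - s0) ^ k <= r' ^ k) by (apply pow_incr; split; [apply Cmod_ge_0|lra]).
    unfold Rdiv. rewrite Rpow_mult_distr, Rmult_1_l.
    replace (B * / Cmod e * (r' ^ k * (/ Cmod e) ^ k)) with
      (/ Cmod e * (/ Cmod e) ^ k * (r' ^ k * B)) by ring.
    apply Rmult_le_compat_l.
    + apply Rmult_le_pos; [lra|]. apply pow_le; lra.
    + apply Rmult_le_compat; auto; [|apply Cmod_ge_0]. apply pow_le, Cmod_ge_0.
  - apply ex_series_geom_scal. split.
    + apply Rdiv_le_0_compat; unfold r'; lra.
    + apply Rlt_div_l; unfold r'; lra.
  - intros z hz. set (q := (- / e * (z - s0))%C).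
    assert (hq : Cmod q < 1).
    { unfold q. rewrite Cmod_mult, Cmod_opp, Cmod_inv by auto. rewrite Rmult_comm.
      apply Rlt_div_l; [lra|]. unfold r' in hz. lra. }
    assert (hz1 : (z - s1)%C <> 0).
    { intros E. assert (E2 : (z - s0)%C = (- e)%C) by (unfold e; rewrite <- (Cplus_0_r (- _)), <- E; ring).
      rewrite E2, Cmod_opp in hz. unfold r' in hz. lra. }
    assert (hz2 : (1 - q)%C = ((z - s1) / e)%C) by (unfold q, e; field; exact he).
    replace (f z / (z - s1))%C with (f z / e * / (1 - q))%C.
    + apply clim_ext with (fun n => f z / e * csum (fun k => q ^ k) n)%C.
      * intros n. rewrite <- csum_scal. apply csum_ext. intros k _. unfold F, q.
        rewrite Cpow_mult_l. field. auto.
      * apply clim_scal. now apply clim_geom.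
    + rewrite hz2. field. auto.
  - unfold r'. lra.
  - now exists d.
Qed.

(** * Euler-Maclaurin summation of the Hurwitz series *)

(** A table whose row n holds the values for j <= n: the Bernoulli recursion refers to all earlier
    values at once, which is not structural in a single index. *)
Fixpoint bseq (n : nat) : nat -> R :=
  match n with
  | O => fun _ => 1
  | S m => fun j => if Nat.leb j m then bseq m j
                    else - rsum (fun i => bseq m i / INR (fact (S (S m) - i))) (S m)
  end.

(* [bern j] is the j-th Bernoulli number divided by j!. *)
Definition bern (j : nat) : R := bseq j j.

Lemma bseq_stable n j : (j <= n)%nat -> bseq n j = bern j.
Proof.
  induction n; intros h; [now replace j with O by lia|].
  destruct (Nat.eq_dec j (S n)) as [->|]; [reflexivity|].
  simpl. rewrite (proj2 (Nat.leb_le j n)) by lia. apply IHn. lia.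
Qed.

Lemma rsum_ext f g n : (forall k, (k < n)%nat -> f k = g k) -> rsum f n = rsum g n.
Proof. induction n; simpl; intros H; auto. rewrite IHn, H; auto. Qed.

(** Coefficient of x^m in the product of the generating series x/(e^x - 1) with (e^x - 1)/x. *)
Lemma bern_relation m :
  rsum (fun j => bern j / INR (fact (S m - j))) (S m) = if Nat.eqb m 0 then 1 else 0.
Proof.
  destruct m.
  - simpl. unfold bern. simpl. field.
  - cbn [Nat.eqb]. change (rsum (fun j => bern j / INR (fact (S (S m) - j))) (S m)
      + bern (S m) / INR (fact (S (S m) - S m)) = 0).
    replace (S (S m) - S m)%nat with 1%nat by lia.
    assert (E : bern (S m) = - rsum (fun j => bern j / INR (fact (S (S m) - j))) (S m)).
    { unfold bern at 1. cbn [bseq]. rewrite (proj2 (Nat.leb_gt (S m) m)) by lia. apply f_equal.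
      apply rsum_ext. intros k hk. now rewrite bseq_stable by lia. }
    rewrite E. simpl fact. simpl INR. field.
Qed.

(** For s <> 1 this is (1-s)(-s)...(2-s-j)/(s-1). The factor s - 1 is cancelled from j = 1 on, so
    these values are polynomials in s, bounded on bounded sets. *)
Fixpoint emq (j : nat) (s : C) : C :=
  match j with
  | O => (/ (s - 1))%C
  | S O => (-1)%C
  | S (S i as k) => (- (s + RtoC (INR i)) * emq k s)%C
  end.

(* For [s <> 1], the j-th derivative of [w^(1-s) / (s-1)] with respect to [w]. *)
Definition emt (j : nat) (s w : C) : C := (emq j s * Cpowc w (1 - s - RtoC (INR j)))%C.

Lemma emq_S j (s : C) : s <> 1 -> emq (S j) s = (emq j s * (1 - s - RtoC (INR j)))%C.
Proof.
  intros hs. destruct j.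
  - simpl. field. now apply Cminus_eq_contra.
  - change (emq (S (S j)) s) with (- (s + RtoC (INR j)) * emq (S j) s)%C.
    rewrite S_INR, RtoC_plus. ring.
Qed.

Lemma emt_1 s w : emt 1 s w = (- Cpowc w (- s))%C.
Proof. unfold emt. simpl. replace (1 - s - 1)%C with (- s)%C by ring. ring. Qed.

Lemma pderiv_emt j (s : C) f x d : s <> 1 -> 0 < Re (f x) -> pderiv f x d ->
  pderiv (fun y => emt j s (f y)) x (emt (S j) s (f x) * d)%C.
Proof.
  intros hs h H. unfold emt. eapply pderiv_eq.
  - apply pderiv_scal. apply pderiv_Cpowc; eauto.
  - rewrite emq_S, S_INR, RtoC_plus by auto.
    replace (1 - s - (INR j + 1))%C with (1 - s - RtoC (INR j) - 1)%C by ring. ring.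
Qed.

(** The increment of [em_approx] from N to N + 1, with w = w_N; the term w^(-s) appears as
    [- emt 1 s w]. *)
Definition em_rem (M : nat) (s w : C) : C :=
  (csum (fun j => RtoC (bern j) * (emt j s (w + 1) - emt j s w)) (S M) - emt 1 s w)%C.

(** After Taylor expansion of the differences, [emt m] carries the coefficient sum_(j<m) b_j/(m-j)!,
    with b_j the value of [bern]. By [bern_relation] it is 1 for m = 1, which cancels [emt 1], and 0
    for the other m <= M + 1. What is left are Taylor remainders, all of total order M + 2. *)
Lemma em_rem_taylor M s w :
  em_rem M s w = csum (fun j => RtoC (bern j) *
    (emt j s (w + 1) - csum (fun i => emt (j + i) s w * RtoC (/ INR (fact i))) (M + 2 - j)))%C (S M).
Proof.
  (* The Taylor coefficient of [emt m] in [emt j (w + 1) - emt j w]. *)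
  set (k := fun j m => if Nat.ltb j m then RtoC (/ INR (fact (m - j))) else RtoC 0).
  assert (E1 : forall j, (j <= M)%nat ->
    csum (fun i => emt (j + i) s w * RtoC (/ INR (fact i)))%C (M + 2 - j) =
    (emt j s w + csum (fun m => emt m s w * k j m) (M + 2))%C).
  { intros j hj. replace (M + 2 - j)%nat with (S (M + 1 - j)) by lia. rewrite csum_first.
    replace (M + 2)%nat with (S j + (M + 1 - j))%nat by lia. rewrite csum_app.
    rewrite (csum_0 (fun m => emt m s w * k j m)%C).
    - rewrite Cplus_0_l. f_equal.
      + rewrite Nat.add_0_r. simpl fact. simpl INR. rewrite Rinv_1. ring.
      + apply csum_ext. intros i _. unfold k. rewrite (proj2 (Nat.ltb_lt j (S j + i))) by lia.
        replace (S j + i - j)%nat with (S i) by lia. now replace (S j + i)%nat with (j + S i)%nat by lia.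
    - intros i hi. unfold k. rewrite (proj2 (Nat.ltb_ge j i)) by lia. ring. }
  assert (E2 : csum (fun m => emt m s w * csum (fun j => RtoC (bern j) * k j m) (S M))%C (M + 2)
     = emt 1 s w).
  { rewrite (csum_single _ (M + 2) 1); [|lia|].
    - assert (E : csum (fun j => RtoC (bern j) * k j 1%nat)%C (S M) = 1).
      { rewrite (csum_single _ (S M) 0); [|lia|].
        - unfold k. simpl. unfold bern. simpl. rewrite Rinv_1. ring.
        - intros i _ hi. unfold k. rewrite (proj2 (Nat.ltb_ge i 1)) by lia. ring. }
      rewrite E. ring.
    - intros m hm h1. destruct m as [|m]; [rewrite csum_0; [ring|]|].
      { intros j _. unfold k. simpl. ring. }
      assert (E : csum (fun j => RtoC (bern j) * k j (S m))%C (S M) = 0).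
      { replace (S M) with (S m + (M - m))%nat by lia. rewrite csum_app.
        rewrite (csum_0 (fun i => _ * k (S m + i)%nat _)%C).
        - assert (R : forall n, (n <= S m)%nat -> csum (fun j => RtoC (bern j) * k j (S m))%C n =
            RtoC (rsum (fun j => bern j / INR (fact (S m - j))) n)).
          { induction n; intros hn; [reflexivity|]. cbn [csum rsum]. rewrite IHn by lia.
            unfold k. rewrite (proj2 (Nat.ltb_lt n (S m))) by lia.
            unfold Rdiv. rewrite RtoC_plus, RtoC_mult. reflexivity. }
          rewrite R by lia. rewrite bern_relation, (proj2 (Nat.eqb_neq m 0)) by lia. ring.
        - intros i _. unfold k. rewrite (proj2 (Nat.ltb_ge (S m + i) (S m))) by lia. ring. }
      rewrite E. ring. }
  unfold em_rem. rewrite <- E2.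
  rewrite (csum_ext (fun m => emt m s w * _)%C
    (fun m => csum (fun j => RtoC (bern j) * (emt m s w * k j m))%C (S M))).
  2:{ intros m _. rewrite <- csum_scal. apply csum_ext. intros; ring. }
  rewrite csum_swap, <- csum_minus. apply csum_ext. intros j hj.
  rewrite csum_scal, (E1 j) by lia. ring.
Qed.

Lemma em_rem_le M (s w : C) B : s <> 1 -> 0 < Re w ->
  (forall y, 0 <= y <= 1 -> Cmod (emt (M + 2) s (w + RtoC y)) <= B) ->
  Cmod (em_rem M s w) <= rsum (fun j => Rabs (bern j)) (S M) * (2 * B).
Proof.
  intros hs hw HB.
  assert (HB0 : 0 <= B) by (eapply Rle_trans; [apply Cmod_ge_0|apply (HB 0); lra]).
  rewrite em_rem_taylor, Rmult_comm, <- rsum_scal. apply csum_le. intros j hj.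
  rewrite Cmod_mult, Cmod_R, Rmult_comm. apply Rmult_le_compat_r; [apply Rabs_pos|].
  assert (H := complex_taylor (fun i y => emt (j + i) s (w + RtoC y * 1)) (M + 2 - j) B).
  cbv beta in H.
  replace (j + 0)%nat with j in H by lia.
  replace (w + 1 * 1)%C with (w + 1)%C in H by ring.
  replace (w + 0 * 1)%C with w in H by ring.
  eapply Rle_trans; [apply H|].
  - intros i y _ hy. replace (j + S i)%nat with (S (j + i)) by lia.
    eapply pderiv_eq; [apply pderiv_emt; auto|].
    + rewrite re_plus, re_scal_l. simpl. lra.
    + apply pderiv_affine.
    + cbv beta; ring.
  - intros y hy. replace (j + (M + 2 - j))%nat with (M + 2)%nat by lia.
    replace (w + y * 1)%C with (w + y)%C by ring. auto.
  - assert (Hf := INR_fact_lt_0 (M + 2 - j)).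
    apply Rle_div_l; auto. assert (1 <= INR (fact (M + 2 - j))).
    { apply (le_INR 1). apply lt_O_fact. }
    nra.
Qed.

Lemma emq_bound j K : 0 <= K -> exists Q, 0 <= Q /\ forall s, Cmod s <= K -> Cmod (emq (S j) s) <= Q.
Proof.
  intros hK. induction j as [|j [Q [HQ0 HQ]]].
  - exists 1. split; [lra|]. intros s _. simpl. rewrite Cmod_R. rewrite Rabs_left; lra.
  - exists ((K + INR j) * Q). split.
    + apply Rmult_le_pos; auto. assert (h := pos_INR j). lra.
    + intros s hs. change (emq (S (S j)) s) with (- (s + RtoC (INR j)) * emq (S j) s)%C.
      rewrite Cmod_mult, Cmod_opp. apply Rmult_le_compat; try apply Cmod_ge_0; auto.
      eapply Rle_trans; [apply Cmod_triangle|]. rewrite (Cmod_RtoC_nonneg (INR j)) by apply pos_INR. lra.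
Qed.

Definition hpt (a : C) (n : nat) : C := (RtoC (INR n) + a)%C.

Lemma hpt_S a n : hpt a (S n) = (hpt a n + 1)%C.
Proof. unfold hpt. rewrite S_INR, RtoC_plus. ring. Qed.

Lemma re_hpt a n : Re (hpt a n) = INR n + Re a.
Proof. unfold hpt. now rewrite re_plus, re_RtoC. Qed.

Lemma re_hpt_pos a n : 0 < Re a -> 0 < Re (hpt a n).
Proof. intros. rewrite re_hpt. assert (h := pos_INR n). lra. Qed.

(** The constant is alpha^(-K): the upper bound on rho makes it uniform, and the lower bound
    extracts the factor (n+1)^(-2). *)
Lemma Rpower_neg_le alpha z n rho K : 0 < alpha <= 1 -> alpha * INR (S n) <= z -> 2 <= rho <= K ->
  Rpower z (- rho) <= exp (- K * ln alpha) / (INR (S n) * INR (S n)).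
Proof.
  intros ha hz hr. assert (hn : 1 <= INR (S n)) by (apply (le_INR 1); lia).
  assert (h0 : 0 < alpha * INR (S n)) by nra.
  assert (Hl : ln alpha + ln (INR (S n)) <= ln z).
  { rewrite <- ln_mult by lra. now apply Rcomplements.ln_le. }
  assert (Hn : 0 <= ln (INR (S n))) by (rewrite <- ln_1; apply Rcomplements.ln_le; lra).
  assert (Ha : ln alpha <= 0) by (rewrite <- ln_1; apply Rcomplements.ln_le; lra).
  unfold Rpower. apply Rle_trans with (exp (- K * ln alpha + - (2 * ln (INR (S n))))).
  - apply exp_le_mono. nra.
  - rewrite exp_plus. right. unfold Rdiv. f_equal. rewrite exp_Ropp. f_equal.
    replace (2 * ln (INR (S n))) with (ln (INR (S n)) + ln (INR (S n))) by ring.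
    rewrite exp_plus, exp_ln by lra. reflexivity.
Qed.

(** The derivative of order M + 2 carries the power w^(-s-M-1), of size n^(-2) once Re s + M >= 1.
    The bound K on |s| controls the polynomial factor, the exponent and exp(2 |Im s|), so B is
    uniform in s. *)
Lemma em_rem_bound a K M : 0 < Re a -> 0 <= K -> exists B, forall s n,
  Cmod s <= K -> s <> 1 -> 1 <= Re s + INR M ->
  Cmod (em_rem M s (hpt a n)) <= B * / (INR (S n) * INR (S n)).
Proof.
  intros ha hK. destruct (emq_bound (S M) K hK) as [Q [HQ0 HQ]].
  set (alpha := Rmin 1 (Re a)).
  assert (hal : 0 < alpha <= 1) by (split; [apply Rmin_pos; lra|apply Rmin_l]).
  assert (hal2 : alpha <= Re a) by apply Rmin_r.
  set (E := exp (- (K + INR M + 1) * ln alpha)).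
  exists (rsum (fun j => Rabs (bern j)) (S M) * (2 * (Q * (E * exp (2 * K))))).
  intros s n hs h1 hM.
  set (D := / (INR (S n) * INR (S n))).
  replace (rsum (fun j => Rabs (bern j)) (S M) * (2 * (Q * (E * exp (2 * K)))) * D)
    with (rsum (fun j => Rabs (bern j)) (S M) * (2 * (Q * (E * D * exp (2 * K))))) by ring.
  apply em_rem_le; auto; [now apply re_hpt_pos|].
  intros y hy. unfold emt. replace (M + 2)%nat with (S (S M)) by lia.
  rewrite Cmod_mult. apply Rmult_le_compat; try apply Cmod_ge_0; auto.
  assert (hre : 0 < Re (hpt a n + RtoC y)%C).
  { rewrite re_plus, re_RtoC. assert (h := re_hpt_pos a n ha). lra. }
  eapply Rle_trans; [apply Cmod_Cpowc_le; auto|].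
  assert (hr := re_le_Cmod s). assert (hi := im_le_Cmod s). assert (hr2 := re_le_mod s).
  apply Rmult_le_compat; try (left; apply exp_pos).
  - replace (Re (1 - s - RtoC (INR (S (S M))))%C) with (- (Re s + INR M + 1)).
    + unfold E, D. apply Rpower_neg_le; auto; [|split; lra].
      eapply Rle_trans; [|apply re_le_mod]. rewrite re_plus, re_hpt, re_RtoC, S_INR.
      assert (h := pos_INR n). nra.
    + unfold Cminus. rewrite !re_plus, !re_opp, !re_RtoC, !S_INR. ring.
  - apply exp_le_mono. 
    replace (Im (1 - s - RtoC (INR (S (S M))))%C) with (- Im s).
    + rewrite Rabs_Ropp. lra.
    + unfold Cminus. rewrite !im_plus, !im_opp, !im_RtoC. ring.
Qed.

(** Majorised by the telescoping series of 2 (1/(n+1) - 1/(n+2)). *)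
Lemma ex_series_inv_sqr B : ex_series (fun n => B * / (INR (S n) * INR (S n))).
Proof.
  apply (ex_series_scal_l B (fun n => / (INR (S n) * INR (S n)))).
  assert (H : ex_series (fun n => 2 * (/ INR (S n) - / INR (S (S n))))).
  { apply (ex_series_scal_l 2 (fun n => / INR (S n) - / INR (S (S n)))). exists 1.
    change (is_lim_seq (sum_n (fun n => / INR (S n) - / INR (S (S n)))) 1).
    apply is_lim_seq_ext with (fun n => 1 - / INR (S (S n))).
    - intros n. rewrite <- rsum_sum_n. induction n; [simpl; field|].
      change (1 - / INR (S (S (S n))) = rsum (fun n => / INR (S n) - / INR (S (S n))) (S n)
        + (/ INR (S (S n)) - / INR (S (S (S n))))). rewrite <- IHn. ring.
    - replace (Finite 1) with (Finite (1 - 0)) by (f_equal; ring).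
      apply is_lim_seq_minus'; [apply is_lim_seq_const|].
      assert (H := is_lim_seq_inv _ _ is_lim_seq_INR ltac:(discriminate)).
      apply (is_lim_seq_incr_n _ 2) in H. revert H. apply is_lim_seq_ext.
      intros n. do 2 f_equal. lia. }
  revert H. apply (@ex_series_le R_AbsRing R_CompleteNormedModule).
  intros n. change (norm (/ (INR (S n) * INR (S n)))) with (Rabs (/ (INR (S n) * INR (S n)))).
  assert (hn : 1 <= INR (S n)) by (apply (le_INR 1); lia).
  rewrite Rabs_pos_eq by (left; apply Rinv_0_lt_compat; nra).
  rewrite (S_INR (S n)).
  replace (2 * (/ INR (S n) - / (INR (S n) + 1))) with (2 / (INR (S n) * (INR (S n) + 1))) by (field; lra).
  apply Rle_div_r; [nra|]. apply Rmult_le_reg_l with (INR (S n) * INR (S n)); [nra|].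
  rewrite <- Rmult_assoc, Rinv_r by nra. nra.
Qed.

(** * The Hurwitz zeta function *)

Lemma is_lim_seq_p_infty_INR_plus c : is_lim_seq (fun n => INR n + c) p_infty.
Proof.
  apply is_lim_seq_plus with (l1 := p_infty) (l2 := c).
  - apply is_lim_seq_INR.
  - apply is_lim_seq_const.
  - reflexivity.
Qed.

Lemma Rpower_neg_lim0 c delta : 0 < delta ->
  is_lim_seq (fun n => Rpower (INR n + c) (- delta)) 0.
Proof.
  intros hd. unfold Rpower.
  apply (is_lim_comp_seq exp (fun n => - delta * ln (INR n + c)) m_infty 0).
  - apply is_lim_exp_m.
  - exists O. intros n _. discriminate.
  - apply is_lim_seq_ext with (fun n => - (delta * ln (INR n + c))); [intros; ring|].
    apply (is_lim_seq_opp _ p_infty).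
    assert (H : is_lim_seq (fun n => ln (INR n + c)) p_infty).
    { apply (is_lim_comp_seq ln (fun n => INR n + c) p_infty p_infty).
      - apply is_lim_ln_p.
      - exists O. intros n _. discriminate.
      - apply is_lim_seq_p_infty_INR_plus. }
    apply (is_lim_seq_scal_l _ delta) in H.
    replace (Rbar_mult delta p_infty) with p_infty in H; auto.
    symmetry. apply is_Rbar_mult_unique. now apply is_Rbar_mult_sym, is_Rbar_mult_p_infty_pos.
Qed.

Lemma Cpowc_hpt_lim0 a s : 0 < Re a -> Re s < 0 -> clim (fun n => Cpowc (hpt a n) s) 0.
Proof.
  intros ha hs.
  apply (clim_squeeze _ _ (fun n => exp (2 * Rabs (Im s)) * Rpower (INR n + Re a) (- - Re s))).
  - intros n. replace (Cpowc (hpt a n) s - 0)%C with (Cpowc (hpt a n) s) by ring.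
    assert (h := re_hpt_pos a n ha).
    eapply Rle_trans; [apply Cmod_Cpowc_le; auto|]. rewrite Rmult_comm.
    apply Rmult_le_compat_l; [left; apply exp_pos|].
    rewrite Ropp_involutive. unfold Rpower. apply exp_le_mono.
    rewrite <- re_hpt. assert (H := Rcomplements.ln_le _ _ h (re_le_mod (hpt a n))). nra.
  - apply lim0_scal. apply Rpower_neg_lim0. lra.
Qed.

Lemma emt_hpt_lim0 a j s : 0 < Re a -> 1 < Re s + INR j -> clim (fun n => emt j s (hpt a n)) 0.
Proof.
  intros ha hs. unfold emt. replace (RtoC 0) with (emq j s * 0)%C by ring.
  apply clim_scal. apply Cpowc_hpt_lim0; auto.
  unfold Cminus. rewrite !re_plus, !re_opp, !re_RtoC. lra.
Qed.

Definition em_approx (M : nat) (s a : C) (N : nat) : C :=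
  (csum (fun n => Cpowc (hpt a n) (- s)) N
   + csum (fun j => RtoC (bern j) * emt j s (hpt a N)) (S M))%C.

Lemma em_approx_sum M s a N :
  em_approx M s a N = (em_approx M s a 0 + csum (fun n => em_rem M s (hpt a n)) N)%C.
Proof.
  rewrite (csum_ext (fun n => em_rem M s (hpt a n))
    (fun n => em_approx M s a (S n) - em_approx M s a n)%C).
  - rewrite csum_telescope. ring.
  - intros n _. unfold em_approx, em_rem. rewrite hpt_S, emt_1.
    rewrite (csum_ext (fun j => _ * (_ - _))%C
      (fun j => RtoC (bern j) * emt j s (hpt a n + 1) - RtoC (bern j) * emt j s (hpt a n))%C)
      by (intros; ring).
    rewrite csum_minus. cbn [csum]. ring.
Qed.

(** M is existential, so that one predicate serves all s. Its choice does not matter: raising M adds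
    terms that tend to 0, which is [em_approx_raise]. *)
Definition zeta_value (a s z : C) : Prop :=
  exists M, 1 < Re s + INR M /\ clim (em_approx M s a) z.

Lemma em_approx_raise a s z M M' : 0 < Re a -> 1 < Re s + INR M -> (M <= M')%nat ->
  clim (em_approx M s a) z -> clim (em_approx M' s a) z.
Proof.
  intros ha hM hle H. induction hle as [|m hle IH]; auto.
  assert (hm : INR M <= INR m) by now apply le_INR.
  apply clim_ext with (fun N => em_approx m s a N + RtoC (bern (S m)) * emt (S m) s (hpt a N))%C.
  { intros N. unfold em_approx. cbn [csum]. ring. }
  replace z with (z + RtoC (bern (S m)) * 0)%C by ring. apply clim_plus; auto.
  apply clim_scal. apply emt_hpt_lim0; auto. rewrite S_INR. lra.
Qed.

Lemma zeta_value_unique a s z1 z2 : 0 < Re a -> zeta_value a s z1 -> zeta_value a s z2 -> z1 = z2.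
Proof.
  intros ha [M1 [h1 H1]] [M2 [h2 H2]].
  apply (clim_unique (em_approx (max M1 M2) s a)).
  - now apply (em_approx_raise a s z1 M1); auto; apply Nat.le_max_l.
  - now apply (em_approx_raise a s z2 M2); auto; apply Nat.le_max_r.
Qed.

Lemma zeta_value_clim a s z M : 0 < Re a -> zeta_value a s z -> 1 < Re s + INR M ->
  (exists z', clim (em_approx M s a) z') -> clim (em_approx M s a) z.
Proof.
  intros ha Hz hM [z' H']. replace z with z'; auto.
  apply (zeta_value_unique a s); auto. now exists M.
Qed.

Lemma em_approx_cv a (s : C) M : 0 < Re a -> s <> 1 -> 1 <= Re s + INR M ->
  exists z, clim (em_approx M s a) z.
Proof.
  intros ha hs hM. destruct (em_rem_bound a (Cmod s) M ha (Cmod_ge_0 s)) as [B HB].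
  destruct (csum_dominated (fun n => em_rem M s (hpt a n))
    (fun n => B * / (INR (S n) * INR (S n)))) as [l [Hl _]].
  - intros n. apply HB; auto. lra.
  - apply ex_series_inv_sqr.
  - exists (em_approx M s a 0 + l)%C.
    apply clim_ext with (fun N => em_approx M s a 0 + csum (fun n => em_rem M s (hpt a n)) N)%C.
    { intros N. symmetry. apply em_approx_sum. }
    apply clim_plus; auto. apply clim_const.
Qed.

Lemma exists_order (x : R) : exists M : nat, x < INR M.
Proof.
  destruct (INR_unbounded x) as [n Hn]. exists n. lra.
Qed.

(** A concrete continuation. It shows that one exists, and [hurwitz_zeta_near] identifies the chosen
    [hurwitz_zeta] with it near real points below 1. *)
Definition zeta_cont (a s : C) : C := epsilon (inhabits (RtoC 0)) (zeta_value a s).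

Lemma zeta_cont_clim a (s : C) M : 0 < Re a -> s <> 1 -> 1 < Re s + INR M ->
  clim (em_approx M s a) (zeta_cont a s).
Proof.
  intros ha hs hM. destruct (em_approx_cv a s M ha hs ltac:(lra)) as [z Hz].
  apply (zeta_value_clim a s); auto; [|now exists z].
  apply (epsilon_spec (inhabits (RtoC 0)) (zeta_value a s)). exists z, M. auto.
Qed.

Lemma Cpowc_expansion w c s0 r : has_expansion (fun s => Cpowc w (c - s)) s0 r.
Proof.
  apply has_expansion_ext with (fun s => Cpowc w c * Cexp (- Clog w * s))%C.
  - intros s _. unfold Cminus. rewrite Cpowc_plus. f_equal. unfold Cpowc. f_equal. ring.
  - apply has_expansion_scal. eexists. apply Cexp_pseries.
Qed.

Lemma emt_expansion j w s0 r : 0 < r < Cmod (s0 - 1) -> has_expansion (fun s => emt j s w) s0 r.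
Proof.
  intros hr.
  (* Division by s - 1 shrinks the disc; the power is entire in s, so it may be expanded on a larger
     one. *)
  assert (E : forall j', has_expansion (fun s => Cpowc w (1 - RtoC (INR j') - s)) s0 (2 * r))
    by (intros; apply Cpowc_expansion).
  destruct j as [|j].
  - apply has_expansion_ext with (fun s => Cpowc w (1 - RtoC (INR 0) - s) / (s - 1))%C.
    + intros s _. unfold emt. simpl emq. unfold Cdiv. rewrite Cmult_comm. f_equal. f_equal. ring.
    + apply has_expansion_div_linear with (2 * r); auto; lra.
  - assert (H : forall k, has_expansion (fun s => emq (S j) s * Cpowc w (1 - RtoC (INR k) - s))%C s0 r).
    { induction j as [|j IH]; intros k.
      - apply has_expansion_ext with (fun s => (-1) * Cpowc w (1 - RtoC (INR k) - s))%C; auto.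
        apply has_expansion_scal. apply has_expansion_weaken with (2 * r); auto; lra.
      - apply has_expansion_ext with (fun s => (-1) * ((s - (- RtoC (INR j))) *
          (emq (S j) s * Cpowc w (1 - RtoC (INR k) - s))))%C.
        + intros s _. change (emq (S (S j)) s) with (- (s + RtoC (INR j)) * emq (S j) s)%C. ring.
        + apply has_expansion_scal. now apply has_expansion_mul_linear. }
    apply has_expansion_ext with (fun s => emq (S j) s * Cpowc w (1 - RtoC (INR (S j)) - s))%C; auto.
    intros s _. unfold emt. do 2 f_equal. ring.
Qed.

Lemma em_rem_expansion M w s0 r : 0 < r < Cmod (s0 - 1) -> has_expansion (fun s => em_rem M s w) s0 r.
Proof.
  intros hr. unfold em_rem. apply has_expansion_minus.
  - apply (has_expansion_csum (fun j s => RtoC (bern j) * (emt j s (w + 1) - emt j s w))%C).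
    intros j _. apply has_expansion_scal. apply has_expansion_minus; now apply emt_expansion.
  - now apply emt_expansion.
Qed.

Lemma em_approx_expansion M a N s0 r : 0 < r < Cmod (s0 - 1) ->
  has_expansion (fun s => em_approx M s a N) s0 r.
Proof.
  intros hr. unfold em_approx. apply has_expansion_plus.
  - apply (has_expansion_csum (fun n s => Cpowc (hpt a n) (- s))). intros n _.
    apply has_expansion_ext with (fun s => Cpowc (hpt a n) (0 - s)).
    + intros; f_equal; ring.
    + apply Cpowc_expansion.
  - apply (has_expansion_csum (fun j s => RtoC (bern j) * emt j s (hpt a N))%C).
    intros j _. apply has_expansion_scal. now apply emt_expansion.
Qed.

Lemma cderiv_minus f g z d e : cderiv f z d -> cderiv g z e -> cderiv (fun s => f s - g s)%C z (d - e)%C.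
Proof. intros H1 H2. exact (@is_derive_minus C_AbsRing C_NormedModule f g z d e H1 H2). Qed.

Lemma cderiv_plus f g z d e : cderiv f z d -> cderiv g z e -> cderiv (fun s => f s + g s)%C z (d + e)%C.
Proof. intros H1 H2. exact (@is_derive_plus C_AbsRing C_NormedModule f g z d e H1 H2). Qed.

Lemma cderiv_ext f g z d : (forall s, f s = g s) -> cderiv f z d -> cderiv g z d.
Proof. intros H. exact (@is_derive_ext C_AbsRing C_NormedModule f g z d H). Qed.

(* [C_NormedModule] and [AbsRing_NormedModule C_AbsRing] carry different balls but
   the same norm. *)
Lemma cderiv_absring f z d :
  cderiv f z d <-> @is_derive C_AbsRing (AbsRing_NormedModule C_AbsRing) f z d.
Proof.
  split; intros [_ H]; split; [apply is_linear_scal_l|exact H|apply is_linear_scal_l|exact H].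
Qed.

Lemma cderiv_id z : cderiv (fun s => s) z 1.
Proof. apply cderiv_absring. apply (@is_derive_id C_AbsRing). Qed.

Lemma cderiv_const c z : cderiv (fun _ => c) z 0.
Proof. apply (@is_derive_const C_AbsRing C_NormedModule). Qed.

Lemma cderiv_mult f g z d e :
  cderiv f z d -> cderiv g z e -> cderiv (fun s => f s * g s)%C z (d * g z + f z * e)%C.
Proof.
  rewrite !cderiv_absring. intros H1 H2.
  exact (@is_derive_mult C_AbsRing f g z d e H1 H2 Cmult_comm).
Qed.

Lemma cderiv_eq f z d d' : cderiv f z d -> d = d' -> cderiv f z d'.
Proof. now intros H <-. Qed.

(** A single use of [weierstrass] on the series of increments [em_rem] gives both the local
    expansion and, through the coefficient of order 1, the convergence of the s-derivatives of the
    approximants. *)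
Theorem zeta_cont_expansion a (s0 : C) M : 0 < Re a -> s0 <> 1 -> 1 < Re s0 + INR M ->
  (exists r, 0 < r /\ has_expansion (zeta_cont a) s0 r) /\
  (forall D, (forall N, cderiv (fun s => em_approx M s a N) s0 (D N)) ->
     exists d, cderiv (zeta_cont a) s0 d /\ clim D d).
Proof.
  intros ha hs hM.
  assert (h1 : 0 < Cmod (s0 - 1)) by now apply Cmod_gt_0, Cminus_eq_contra.
  (* The three entries bound |s| on the disc, keep the pole s = 1 outside, and preserve Re s + M >
     1. *)
  set (r := Rmin 1 (Rmin (Cmod (s0 - 1) / 2) (Re s0 + INR M - 1))).
  assert (r1 : r <= 1) by apply Rmin_l.
  assert (r2 : r <= Cmod (s0 - 1) / 2) by (eapply Rle_trans; [apply Rmin_r|apply Rmin_l]).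
  assert (r3 : r <= Re s0 + INR M - 1) by (eapply Rle_trans; [apply Rmin_r|apply Rmin_r]).
  assert (r0 : 0 < r) by (repeat apply Rmin_pos; lra).
  assert (Hdisc : forall s, Cmod (s - s0) < r -> Cmod s <= Cmod s0 + 1 /\ s <> 1 /\ 1 < Re s + INR M).
  { intros s hsr. split; [|split].
    - replace s with ((s - s0) + s0)%C by ring. eapply Rle_trans; [apply Cmod_triangle|]. lra.
    - intros ->. replace (1 - s0)%C with (- (s0 - 1))%C in hsr by ring. rewrite Cmod_opp in hsr. lra.
    - assert (H := re_le_Cmod (s - s0)). unfold Cminus in H at 1. rewrite re_plus, re_opp in H.
      assert (H2 := Rabs_maj2 (Re s + - Re s0)). lra. }
  destruct (em_rem_bound a (Cmod s0 + 1) M ha ltac:(assert (h := Cmod_ge_0 s0); lra)) as [B HB].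
  assert (HF : forall n, exists c, has_pseries (fun s => em_rem M s (hpt a n)) c s0 r).
  { intros n. apply em_rem_expansion. lra. }
  set (cc := fun n => proj1_sig (constructive_indefinite_description _ (HF n))).
  assert (Hcc : forall n, has_pseries (fun s => em_rem M s (hpt a n)) (cc n) s0 r).
  { intros n. unfold cc. now destruct constructive_indefinite_description. }
  destruct (weierstrass (fun n s => em_rem M s (hpt a n)) cc
    (fun s => zeta_cont a s - em_approx M s a 0)%C s0 r (r / 2)
    (fun n => B * / (INR (S n) * INR (S n)))) as [d [Hd Hdk]]; auto; try lra.
  - intros n z hz. destruct (Hdisc z hz) as [H1 [H2 H3]]. apply HB; auto. lra.
  - apply ex_series_inv_sqr.
  - intros z hz. destruct (Hdisc z hz) as [H1 [H2 H3]].
    apply clim_ext with (fun N => em_approx M z a N - em_approx M z a 0)%C.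
    + intros N. rewrite (em_approx_sum M z a N). ring.
    + apply clim_minus; [|apply clim_const]. now apply zeta_cont_clim.
  - split.
    + exists (r / 2). split; [lra|].
      apply has_expansion_ext with (fun s => (zeta_cont a s - em_approx M s a 0) + em_approx M s a 0)%C.
      { intros; ring. }
      apply has_expansion_plus; [now exists d|]. apply em_approx_expansion. lra.
    + intros D HD. exists (d 1%nat + D O)%C. split.
      * apply cderiv_ext with (fun s => (zeta_cont a s - em_approx M s a 0) + em_approx M s a 0)%C.
        { intros; ring. }
        apply cderiv_plus; [|apply HD]. apply has_pseries_cderiv with (r / 2); auto. lra.
      * apply clim_ext with (fun N => csum (fun n => cc n 1%nat) N + D O)%C.
        -- intros N. rewrite (csum_ext _ (fun n => D (S n) - D n)%C).
           ++ rewrite csum_telescope. ring.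
           (* The increment has two derivatives at s0: its first coefficient, and the difference of
              the given derivatives of consecutive approximants. *)
           ++ intros n _. apply cderiv_unique with (fun s => em_rem M s (hpt a n)) s0.
              ** now apply has_pseries_cderiv with r.
              ** apply cderiv_ext with (fun s => em_approx M s a (S n) - em_approx M s a n)%C.
                 { intros s. rewrite (em_approx_sum M s a (S n)), (em_approx_sum M s a n).
                   cbn [csum]. ring. }
                 now apply cderiv_minus.
        -- apply clim_plus; auto. apply clim_const.
Qed.

Lemma zeta_cont_series a s : 0 < Re a -> 1 < Re s ->
  clim (csum (fun n => Cpowc (hpt a n) (- s))) (zeta_cont a s).
Proof.
  intros ha hs.
  assert (h1 : s <> 1) by (intros ->; simpl in hs; lra).
  assert (H := zeta_cont_clim a s 0 ha h1 ltac:(simpl; lra)).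
  apply clim_ext with (fun N => em_approx 0 s a N - RtoC (bern 0) * emt 0 s (hpt a N))%C.
  - intros N. unfold em_approx. cbn [csum]. ring.
  - replace (zeta_cont a s) with (zeta_cont a s - RtoC (bern 0) * 0)%C by ring.
    apply clim_minus; auto. apply clim_scal. apply emt_hpt_lim0; simpl; lra.
Qed.

Lemma zeta_cont_is_continuation a : 0 < Re a -> is_hurwitz_continuation a (zeta_cont a).
Proof.
  intros ha. split.
  - intros s hs. apply is_series_clim. now apply zeta_cont_series.
  - intros s hs. destruct (exists_order (1 - Re s)) as [M HM].
    destruct (zeta_cont_expansion a s M ha hs ltac:(lra)) as [[r [hr [c H]]] _].
    apply analytic_at_iff. now exists c, r.
Qed.

Lemma hurwitz_zeta_is_continuation a : 0 < Re a ->
  is_hurwitz_continuation a (fun s => hurwitz_zeta s a).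
Proof.
  intros ha. apply (epsilon_spec (inhabits (fun _ : C => RtoC 0)) (is_hurwitz_continuation a)).
  exists (zeta_cont a). now apply zeta_cont_is_continuation.
Qed.

Lemma hurwitz_zeta_series a s : 0 < Re a -> 1 < Re s ->
  clim (csum (fun n => Cpowc (hpt a n) (- s))) (hurwitz_zeta s a).
Proof.
  intros ha hs. apply is_series_clim. now apply hurwitz_zeta_is_continuation.
Qed.

Lemma analytic_at_minus f g s : analytic_at f s -> analytic_at g s -> analytic_at (fun z => f z - g z)%C s.
Proof.
  rewrite !analytic_at_iff. intros [c [r [hr H]]] [d [r' [hr' H']]].
  exists (fun k => c k - d k)%C, (Rmin r r'). split; [now apply Rmin_pos|].
  apply has_pseries_minus; intros z hz; [apply H|apply H'].
  - assert (h := Rmin_l r r'). lra.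
  - assert (h := Rmin_r r r'). lra.
Qed.

(** The identity theorem is run along the segment from 2 + i, inside the half-plane of the series,
    to x. Its imaginary part 1 - y vanishes only at the end point x, so the segment avoids the pole,
    which the real axis does not. *)
Lemma hurwitz_continuation_unique a f1 f2 (x : R) : x < 1 ->
  is_hurwitz_continuation a f1 -> is_hurwitz_continuation a f2 ->
  vanishes_near (fun s => f1 s - f2 s)%C (RtoC x).
Proof.
  intros hx [S1 A1] [S2 A2].
  set (u := (2 + Ci)%C). set (v := (RtoC x - u)%C).
  replace (RtoC x) with (u + v)%C by (unfold v; ring).
  assert (Hseg : forall y, Im (u + RtoC y * v)%C = 1 - y).
  { intros y. unfold v, u, Cminus. rewrite im_plus, im_scal_l, !im_plus, im_opp, im_plus, !im_RtoC. simpl. ring. }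
  apply identity_segment.
  - intros E. assert (h := Hseg 1). rewrite E in h.
    replace (u + 1 * 0)%C with u in h by ring. unfold u in h. simpl in h. lra.
  - intros y hy. assert (hn : (u + RtoC y * v)%C <> 1).
    { intros E. assert (h := Hseg y). rewrite E in h. simpl in h.
      assert (y = 1) by lra. subst y. unfold v in E.
      replace (u + 1 * (RtoC x - u))%C with (RtoC x) in E by ring. apply RtoC_inj in E. lra. }
    apply analytic_at_minus; auto.
  - exists 1. split; [lra|]. intros z hz.
    assert (hre : 1 < Re z).
    { assert (H := re_le_Cmod (z - u)).
      replace (Re (z - u)%C) with (Re z - 2) in H.
      2:{ unfold u, Cminus. rewrite re_plus, re_opp, re_plus, re_RtoC. simpl. ring. }
      assert (H2 := Rabs_maj2 (Re z - 2)). lra. }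
    rewrite (clim_unique (csum (fun n => Cpowc (RtoC (INR n) + a) (- z))) (f1 z) (f2 z)); [ring| |];
      apply is_series_clim; auto.
Qed.

Lemma hurwitz_zeta_near a (x : R) : 0 < Re a -> x < 1 ->
  exists delta, 0 < delta /\ forall z, Cmod (z - RtoC x) < delta -> hurwitz_zeta z a = zeta_cont a z.
Proof.
  intros ha hx.
  destruct (hurwitz_continuation_unique a (fun s => hurwitz_zeta s a) (zeta_cont a) x hx
    (hurwitz_zeta_is_continuation a ha) (zeta_cont_is_continuation a ha)) as [d [hd H]].
  exists d. split; auto. intros z hz. apply Ceq_minus. auto.
Qed.

Lemma hurwitz_zeta_clim a (x : R) M : 0 < Re a -> x < 1 -> 1 < x + INR M ->
  clim (em_approx M (RtoC x) a) (hurwitz_zeta (RtoC x) a).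
Proof.
  intros ha hx hM. destruct (hurwitz_zeta_near a x ha hx) as [d [hd H]]. rewrite H.
  - apply zeta_cont_clim; auto. intros E. apply RtoC_inj in E. lra.
  - replace (RtoC x - RtoC x)%C with (RtoC 0) by ring. now rewrite Cmod_0.
Qed.

(** The derivative of [hurwitz_zeta] is determined by its agreement with [zeta_cont] on a whole
    neighbourhood; this is why uniqueness was phrased with [vanishes_near]. *)
Lemma hurwitz_zeta'_clim a (x : R) M D : 0 < Re a -> x < 1 -> 1 < x + INR M ->
  (forall N, cderiv (fun s => em_approx M s a N) (RtoC x) (D N)) ->
  clim D (hurwitz_zeta' (RtoC x) a).
Proof.
  intros ha hx hM HD.
  destruct (zeta_cont_expansion a (RtoC x) M ha) as [_ H]; auto.
  { intros E. apply RtoC_inj in E. lra. }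
  destruct (H D HD) as [d [Hd Hl]].
  replace (hurwitz_zeta' (RtoC x) a) with d; auto. symmetry.
  apply is_C_derive_unique. destruct (hurwitz_zeta_near a x ha hx) as [dl [hdl Hloc]].
  apply (@is_derive_ext_loc C_AbsRing C_NormedModule (zeta_cont a)); auto.
  exists (mkposreal dl hdl). intros y hy. symmetry. apply Hloc. exact hy.
Qed.

(** * Integrals over the half line *)

Definition rint (f : R -> R) (l : R) : Prop :=
  is_RInt_gen f (at_right 0) (Rbar_locally p_infty) l.

Lemma ball_Rabs (x y eps : R) : ball x eps y -> Rabs (y - x) < eps.
Proof. exact (fun h => h). Qed.

Lemma Rabs_ball (x y eps : R) : Rabs (y - x) < eps -> ball x eps y.
Proof. exact (fun h => h). Qed.

Lemma filter_prod_half_line : filter_prod (at_right 0) (Rbar_locally p_infty)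
  (fun ab => 0 < fst ab <= snd ab).
Proof.
  apply Filter_prod with (fun x => 0 < x < 1) (fun x => 1 < x).
  - exists (mkposreal 1 Rlt_0_1). intros y hy hy0. apply ball_Rabs in hy. simpl in hy. apply Rabs_def2 in hy. lra.
  - exists 1. auto.
  - simpl. intros; lra.
Qed.

Lemma rint_ext f g l : (forall x, 0 < x -> f x = g x) -> rint f l -> rint g l.
Proof.
  intros H. apply is_RInt_gen_ext. generalize filter_prod_half_line. apply filter_imp.
  intros [a b] [h1 h2] x hx. simpl in *. rewrite Rmin_left, Rmax_right in hx by auto. apply H. lra.
Qed.

Lemma rint_unique f k l : rint f k -> rint f l -> k = l.
Proof.
  intros H1 H2.
  assert (E1 := @is_RInt_gen_unique R_CompleteNormedModule _ _ _ _ f k H1).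
  assert (E2 := @is_RInt_gen_unique R_CompleteNormedModule _ _ _ _ f l H2). congruence.
Qed.

Lemma rint_plus f g k l : rint f k -> rint g l -> rint (fun x => f x + g x) (k + l).
Proof. exact (@is_RInt_gen_plus R_NormedModule _ _ _ _ f g k l). Qed.

Lemma rint_minus f g k l : rint f k -> rint g l -> rint (fun x => f x - g x) (k - l).
Proof. exact (@is_RInt_gen_minus R_NormedModule _ _ _ _ f g k l). Qed.

Lemma rint_scal c f l : rint f l -> rint (fun x => c * f x) (c * l).
Proof. exact (@is_RInt_gen_scal R_NormedModule _ _ _ _ f c l). Qed.

Lemma rint_abs_le f g k l : rint f k -> rint g l -> (forall x, 0 < x -> Rabs (f x) <= g x) -> Rabs k <= l.
Proof.
  intros H1 H2 H.
  refine (@RInt_gen_norm R_CompleteNormedModule (at_right 0) (Rbar_locally p_infty) _ _ f g k l _ _ H1 H2).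
  - generalize filter_prod_half_line. apply filter_imp. intros ab [_ h]. exact h.
  - generalize filter_prod_half_line. apply filter_imp. intros [a b] [h1 h2] x hx. simpl in *.
    apply H. lra.
Qed.

Lemma rint_of_primitive F f la lb :
  (forall x, 0 < x -> is_derive F x (f x)) -> (forall x, 0 < x -> continuous f x) ->
  filterlim F (at_right 0) (locally la) -> filterlim F (Rbar_locally p_infty) (locally lb) ->
  rint f (lb - la).
Proof.
  intros HF Hf H0 H1.
  apply rint_ext with (Derive F).
  { intros x hx. apply is_derive_unique. auto. }
  apply is_RInt_gen_Derive; auto.
  - generalize filter_prod_half_line. apply filter_imp. intros [a b] [h1 h2] x hx. simpl in *.
    rewrite Rmin_left, Rmax_right in hx by auto. exists (f x). apply HF. lra.
  - generalize filter_prod_half_line. apply filter_imp. intros [a b] [h1 h2] x hx. simpl in *.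
    rewrite Rmin_left, Rmax_right in hx by auto.
    apply continuous_ext_loc with f.
    + exists (mkposreal x ltac:(lra)). intros y hy. apply ball_Rabs in hy. simpl in hy. apply Rabs_def2 in hy.
      symmetry. apply is_derive_unique. apply HF. lra.
    + apply Hf. lra.
Qed.

(** The increments of the primitive F of f are bounded by those of G, so F inherits the Cauchy
    property from G at 0 and at infinity. *)
Lemma rint_dominated f g G la lb :
  (forall x, 0 < x -> continuous f x) -> (forall x, 0 < x -> Rabs (f x) <= g x) ->
  (forall x, 0 < x -> is_derive G x (g x)) ->
  filterlim G (at_right 0) (locally la) -> filterlim G (Rbar_locally p_infty) (locally lb) ->
  exists l, rint f l.
Proof.
  intros Hf Hg HG H0 H1.
  set (F := fun x => RInt f 1 x).
  assert (HF : forall x, 0 < x -> is_derive F x (f x)).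
  { intros x hx. apply (@is_derive_RInt R_NormedModule) with (a := 1); auto.
    exists (mkposreal x hx). intros y hy. apply ball_Rabs in hy. simpl in hy. apply Rabs_def2 in hy.
    apply (@RInt_correct R_CompleteNormedModule). apply (@ex_RInt_continuous R_CompleteNormedModule).
    intros z hz. apply Hf. assert (0 < Rmin 1 y) by (apply Rmin_pos; lra). lra. }
  assert (Hle : forall u v, 0 < u -> u <= v -> Rabs (F v - F u) <= G v - G u).
  { intros u v hu huv.
    apply (increment_le F f G g); auto; intros x hx; [apply HF|apply HG|apply Hg]; lra. }
  assert (Hle2 : forall u v, 0 < u -> 0 < v -> Rabs (F v - F u) <= Rabs (G v - G u)).
  { intros u v hu hv. destruct (Rle_lt_dec u v) as [h|h].
    - eapply Rle_trans; [now apply Hle|apply Rle_abs].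
    - rewrite (Rabs_minus_sym (F v)), (Rabs_minus_sym (G v)).
      eapply Rle_trans; [apply Hle; lra|apply Rle_abs]. }
  assert (HC : forall Fl : (R -> Prop) -> Prop, ProperFilter Fl -> Fl (fun x => 0 < x) ->
     forall lG, filterlim G Fl (locally lG) -> exists l, filterlim F Fl (locally l)).
  { intros Fl PF Hpos lG HlG.
    apply (proj1 (@filterlim_locally_cauchy R R_CompleteSpace Fl PF F)). intros eps.
    destruct (proj2 (@filterlim_locally_cauchy R R_CompleteSpace Fl PF G) (ex_intro _ lG HlG) eps)
      as [P [HP HP2]].
    exists (fun x => P x /\ 0 < x). split; [now apply filter_and|].
    intros u v [hu1 hu2] [hv1 hv2]. specialize (HP2 u v hu1 hv1).
    eapply Rle_lt_trans; [|exact HP2]. apply Hle2; auto. }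
  destruct (HC (at_right 0) _) with (lG := la) as [l0 Hl0]; auto.
  { exists (mkposreal 1 Rlt_0_1). auto. }
  destruct (HC (Rbar_locally p_infty) _) with (lG := lb) as [l1 Hl1]; auto.
  { exists 0. auto. }
  exists (l1 - l0). apply (rint_of_primitive F); auto.
Qed.

(** Componentwise, so that convergence and domination are real questions; [cint_RInt_gen] returns to
    the integral in the definition of [CGamma]. *)
Definition cint (f : R -> C) (l : C) : Prop :=
  rint (fun x => Re (f x)) (Re l) /\ rint (fun x => Im (f x)) (Im l).

Lemma cint_is_RInt_gen f l : cint f l ->
  @is_RInt_gen C_R_NormedModule f (at_right 0) (Rbar_locally p_infty) l.
Proof.
  intros [H1 H2] P [eps HP].
  assert (K1 := H1 (ball (Re l) eps) (locally_ball _ _)).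
  assert (K2 := H2 (ball (Im l) eps) (locally_ball _ _)).
  unfold filtermapi in *. generalize (filter_and _ _ K1 K2). apply filter_imp.
  intros ab [[y1 [hy1 hb1]] [y2 [hy2 hb2]]].
  exists (y1, y2). split.
  - exact (@is_RInt_fct_extend_pair R_NormedModule R_NormedModule f _ _ y1 y2 hy1 hy2).
  - apply HP. split; assumption.
Qed.

Lemma cint_unique f k l : cint f k -> cint f l -> k = l.
Proof.
  intros [H1 H2] [H3 H4]. apply C_eq; eapply rint_unique; eauto.
Qed.

Lemma cint_RInt_gen f l : cint f l ->
  @RInt_gen C_R_CompleteNormedModule f (at_right 0) (Rbar_locally p_infty) = l.
Proof. intros H. apply is_RInt_gen_unique. now apply cint_is_RInt_gen. Qed.

Lemma cint_ext f g l : (forall x, 0 < x -> f x = g x) -> cint f l -> cint g l.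
Proof.
  intros H [H1 H2]. split; (eapply rint_ext; [|eassumption]); intros x hx; simpl; now rewrite H.
Qed.

Lemma cint_plus f g k l : cint f k -> cint g l -> cint (fun x => f x + g x)%C (k + l)%C.
Proof. intros [H1 H2] [H3 H4]. split; now apply rint_plus. Qed.

Lemma rint_eq f l l' : l = l' -> rint f l -> rint f l'.
Proof. now intros ->. Qed.

Lemma cint_scal c f l : cint f l -> cint (fun x => c * f x)%C (c * l)%C.
Proof.
  intros [H1 H2]. split.
  - apply rint_ext with (fun x => Re c * Re (f x) - Im c * Im (f x)).
    { intros x _. now rewrite re_mult. }
    rewrite re_mult. apply rint_minus; now apply rint_scal.
  - apply rint_ext with (fun x => Re c * Im (f x) + Im c * Re (f x)).
    { intros x _. now rewrite im_mult. }
    rewrite im_mult. apply rint_plus; now apply rint_scal.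
Qed.

Lemma cint_minus f g k l : cint f k -> cint g l -> cint (fun x => f x - g x)%C (k - l)%C.
Proof.
  intros Hf Hg. apply cint_ext with (fun x => f x + (-1) * g x)%C; [intros; ring|].
  replace (k - l)%C with (k + (-1) * l)%C by ring. apply cint_plus; auto. now apply cint_scal.
Qed.

Lemma cint_mod_le f g k l : cint f k -> rint g l -> (forall x, 0 < x -> Cmod (f x) <= g x) ->
  Cmod k <= 2 * l.
Proof.
  intros [H1 H2] Hg H. eapply Rle_trans; [apply Cmod_le_re_im|].
  assert (A1 : Rabs (Re k) <= l).
  { eapply rint_abs_le; eauto. intros x hx. simpl. eapply Rle_trans; [apply re_le_Cmod|auto]. }
  assert (A2 : Rabs (Im k) <= l).
  { eapply rint_abs_le; eauto. intros x hx. simpl. eapply Rle_trans; [apply im_le_Cmod|auto]. }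
  lra.
Qed.

Definition ccont (f : R -> C) : Prop :=
  forall x, 0 < x -> continuous (fun y => Re (f y)) x /\ continuous (fun y => Im (f y)) x.

Lemma pderiv_ccont f : (forall x, 0 < x -> exists d, pderiv f x d) -> ccont f.
Proof.
  intros H x hx. destruct (H x hx) as [d [H1 H2]].
  split; apply (@ex_derive_continuous R_AbsRing R_NormedModule); eexists; eauto.
Qed.

Lemma cint_of_primitive F f :
  (forall x, 0 < x -> pderiv F x (f x)) -> ccont f ->
  (forall eps, 0 < eps -> exists delta, 0 < delta /\ forall x, 0 < x < delta -> Cmod (F x) < eps) ->
  (forall eps, 0 < eps -> exists A, forall x, A < x -> Cmod (F x) < eps) ->
  cint f 0.
Proof.
  intros HF Hf H0 H1.
  assert (Q : forall u v : R -> R, (forall x, 0 < x -> is_derive u x (v x)) ->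
    (forall x, 0 < x -> continuous v x) -> (forall x, Rabs (u x) <= Cmod (F x)) -> rint v 0).
  { intros u v Hu Hv Hb. apply rint_eq with (0 - 0); [ring|].
    apply (rint_of_primitive u); auto.
    - apply filterlim_locally. intros eps. destruct (H0 eps (cond_pos eps)) as [d [hd Hd]].
      exists (mkposreal d hd). intros y hy hy0. apply ball_Rabs in hy. simpl in hy. apply Rabs_def2 in hy.
      apply Rabs_ball.
      rewrite Rminus_0_r. eapply Rle_lt_trans; [apply Hb|]. apply Hd. lra.
    - apply filterlim_locally. intros eps. destruct (H1 eps (cond_pos eps)) as [A HA].
      exists A. intros y hy.
      apply Rabs_ball.
      rewrite Rminus_0_r. eapply Rle_lt_trans; [apply Hb|]. now apply HA. }
  split.
  - apply (Q (fun x => Re (F x))); [intros; now apply HF|intros; now apply Hf|intros; apply re_le_Cmod].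
  - apply (Q (fun x => Im (F x))); [intros; now apply HF|intros; now apply Hf|intros; apply im_le_Cmod].
Qed.

(* The antiderivative [- 1 / (c (1 + x^c))] makes this majorant integrable on (0, oo). *)
Definition bump (c x : R) : R := Rpower x (c - 1) / ((1 + Rpower x c) * (1 + Rpower x c)).

Lemma Rpower_pos x y : 0 < Rpower x y.
Proof. apply exp_pos. Qed.

Lemma is_derive_Rpower x c : 0 < x -> is_derive (fun y => Rpower y c) x (c * Rpower x (c - 1)).
Proof.
  intros hx. apply is_derive_Reals. now apply derivable_pt_lim_power.
Qed.

Lemma filterlim_Rpower_0 c : 0 < c -> filterlim (fun x => Rpower x c) (at_right 0) (locally 0).
Proof.
  intros hc. apply filterlim_locally. intros eps.
  exists (mkposreal _ (Rpower_pos eps (/ c))). intros y hy hy0. apply ball_Rabs in hy. simpl in hy. apply Rabs_def2 in hy.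
  apply Rabs_ball.
  rewrite Rminus_0_r, Rabs_pos_eq by (left; apply Rpower_pos).
  replace (pos eps) with (Rpower (Rpower eps (/ c)) c).
  - apply Rlt_Rpower_l; lra.
  - rewrite Rpower_mult, Rinv_l, Rpower_1; try lra. apply cond_pos.
Qed.

Lemma filterlim_Rpower_infty c : 0 < c ->
  filterlim (fun x => Rpower x c) (Rbar_locally p_infty) (Rbar_locally p_infty).
Proof.
  intros hc P [M HM]. exists (Rpower (Rmax M 1) (/ c)). intros x hx. apply HM.
  apply Rle_lt_trans with (Rmax M 1); [apply Rmax_l|].
  assert (h1 : 0 < Rmax M 1) by (assert (h := Rmax_r M 1); lra).
  replace (Rmax M 1) with (Rpower (Rpower (Rmax M 1) (/ c)) c).
  - apply Rlt_Rpower_l; auto. split; auto. apply Rpower_pos.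
  - rewrite Rpower_mult, Rinv_l, Rpower_1; lra.
Qed.

Lemma bump_primitive c : 0 < c ->
  (forall x, 0 < x -> is_derive (fun y => - / (c * (1 + Rpower y c))) x (bump c x)) /\
  filterlim (fun y => - / (c * (1 + Rpower y c))) (at_right 0) (locally (- / c)) /\
  filterlim (fun y => - / (c * (1 + Rpower y c))) (Rbar_locally p_infty) (locally 0).
Proof.
  intros hc.
  assert (E : forall P : (R -> Prop) -> Prop, ProperFilter P -> forall l m : R,
    filterlim (fun x => Rpower x c) P (locally l) -> continuous (fun z => - / (c * (1 + z))) l ->
    m = - / (c * (1 + l)) ->
    filterlim (fun y => - / (c * (1 + Rpower y c))) P (locally m)).
  { intros P PP l m H Hc ->. exact (filterlim_comp _ _ _ _ _ _ _ _ H Hc). }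
  split; [|split].
  - intros x hx. assert (hp := Rpower_pos x c).
    assert (H := is_derive_Rpower x c hx). set (u := fun y => Rpower y c) in *.
    change (is_derive (fun y => - / (c * (1 + u y))) x (bump c x)).
    auto_derive.
    + split; [now eexists; exact H|]. split; auto.
      apply Rgt_not_eq. apply Rmult_lt_0_compat; unfold u; lra.
    + replace (Derive (fun x => u x) x) with (c * Rpower x (c - 1)) by (symmetry; now apply is_derive_unique).
      unfold bump, u. field. lra.
  - apply (E (at_right 0) _ 0).
    + now apply filterlim_Rpower_0.
    + apply (@ex_derive_continuous R_AbsRing R_NormedModule). auto_derive.
      apply Rgt_not_eq. lra.
    + rewrite Rplus_0_r, Rmult_1_r. reflexivity.
  - apply filterlim_locally. intros eps.
    destruct (filterlim_Rpower_infty c hc (fun y => / (c * eps) < y)) as [A HA].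
    { exists (/ (c * eps)). auto. }
    exists A. intros x hx. specialize (HA x hx).
    apply Rabs_ball.
    rewrite Rminus_0_r, Rabs_Ropp.
    assert (he := cond_pos eps). assert (hp := Rpower_pos x c).
    assert (hce : 0 < c * eps) by now apply Rmult_lt_0_compat.
    rewrite Rabs_pos_eq by (left; apply Rinv_0_lt_compat, Rmult_lt_0_compat; lra).
    assert (HA2 : / (c * eps) < 1 + Rpower x c) by lra.
    apply Rmult_lt_compat_l with (r := c) in HA2; auto.
    replace (c * / (c * eps)) with (/ eps) in HA2 by (field; lra).
    rewrite <- (Rinv_inv eps). apply Rinv_lt_contravar; auto.
    apply Rmult_lt_0_compat; [now apply Rinv_0_lt_compat|]. apply Rmult_lt_0_compat; lra.
Qed.

Lemma is_derive_continuous_pos (f : R -> R) : (forall x, 0 < x -> ex_derive f x) ->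
  forall x, 0 < x -> continuous f x.
Proof. intros H x hx. apply (@ex_derive_continuous R_AbsRing R_NormedModule). now apply H. Qed.

Lemma bump_continuous c x : 0 < x -> continuous (bump c) x.
Proof.
  apply is_derive_continuous_pos. clear x. intros x hx.
  assert (H1 := is_derive_Rpower x c hx). assert (H2 := is_derive_Rpower x (c - 1) hx).
  assert (hp := Rpower_pos x c).
  unfold bump. set (u := fun y => Rpower y c) in *. set (v := fun y => Rpower y (c - 1)) in *.
  change (ex_derive (fun y => v y / ((1 + u y) * (1 + u y))) x).
  auto_derive. repeat split; try (eexists; eassumption).
  apply Rgt_not_eq, Rmult_lt_0_compat; unfold u; lra.
Qed.

Lemma rint_bump c : 0 < c -> rint (bump c) (/ c).
Proof.
  intros hc. destruct (bump_primitive c hc) as [H1 [H2 H3]].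
  apply rint_eq with (0 - - / c); [ring|].
  eapply rint_of_primitive; eauto. intros; now apply bump_continuous.
Qed.

Lemma cint_dominated f c K : 0 < c -> ccont f -> (forall x, 0 < x -> Cmod (f x) <= K * bump c x) ->
  exists l, cint f l.
Proof.
  intros hc Hf Hb. destruct (bump_primitive c hc) as [H1 [H2 H3]].
  assert (Q : forall u : R -> R, (forall x, 0 < x -> continuous u x) ->
    (forall x, 0 < x -> Rabs (u x) <= Cmod (f x)) -> exists l, rint u l).
  { intros u Hu Hub.
    assert (HS : forall (P : (R -> Prop) -> Prop) (h : R -> R) l, filterlim h P (locally l) ->
      filterlim (fun x => K * h x) P (locally (K * l))).
    { intros P h l H. refine (filterlim_comp _ _ _ h (fun z => K * z) _ _ _ H _).
      apply (@ex_derive_continuous R_AbsRing R_NormedModule). auto_derive. auto. }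
    apply (rint_dominated u (fun x => K * bump c x) (fun x => K * (- / (c * (1 + Rpower x c))))
      (K * - / c) (K * 0)); auto.
    - intros x hx. eapply Rle_trans; [apply Hub; auto|auto].
    - intros x hx. apply is_derive_scal. auto. }
  destruct (Q (fun x => Re (f x))) as [l1 Hl1].
  { intros x hx. now apply Hf. }
  { intros x hx. apply re_le_Cmod. }
  destruct (Q (fun x => Im (f x))) as [l2 Hl2].
  { intros x hx. now apply Hf. }
  { intros x hx. apply im_le_Cmod. }
  exists (l1, l2). now split.
Qed.

Lemma cint_dominated_le f c K l : 0 < c -> cint f l -> (forall x, 0 < x -> Cmod (f x) <= K * bump c x) ->
  Cmod l <= 2 * (K * / c).
Proof.
  intros hc Hf Hb. refine (cint_mod_le f (fun x => K * bump c x) l (K * / c) Hf _ Hb).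
  apply rint_scal. now apply rint_bump.
Qed.

Lemma Rpower_exp_bounded e : 0 <= e ->
  exists K, 0 < K /\ forall x, 0 < x -> Rpower x e * exp (- x) <= K.
Proof.
  intros [he| <-].
  - exists (exp (e * ln e)). split; [apply exp_pos|]. intros x hx. unfold Rpower.
    rewrite <- exp_plus. apply exp_le_mono.
    assert (H := exp_ineq1_le (ln (x / e))). rewrite exp_ln in H by now apply Rdiv_lt_0_compat.
    unfold Rdiv in H. rewrite ln_mult, ln_Rinv in H; auto; [|now apply Rinv_0_lt_compat].
    apply Rmult_le_compat_l with (r := e) in H; [|lra].
    replace (e * (x * / e)) with x in H by (field; lra). lra.
  - exists 1. split; [lra|]. intros x hx. unfold Rpower. rewrite Rmult_0_l, exp_0, Rmult_1_l.
    rewrite <- exp_0. apply exp_le_mono. lra.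
Qed.

(** Multiplying out (1 + x^c)^2 leaves terms x^e exp(-x) with e = tau-c+1, tau+1 and tau+c+1. The
    condition on c makes all these exponents non-negative, hence the terms bounded. *)
Lemma Rpower_exp_le_bump tau c : 0 < c <= tau + 1 ->
  exists K, 0 < K /\ forall x, 0 < x -> Rpower x tau * exp (- x) <= K * bump c x.
Proof.
  intros hc.
  destruct (Rpower_exp_bounded (tau - c + 1)) as [K0 [h0 H0]]; [lra|].
  destruct (Rpower_exp_bounded (tau - c + 1 + c)) as [K1 [h1 H1]]; [lra|].
  destruct (Rpower_exp_bounded (tau - c + 1 + c + c)) as [K2 [h2 H2]]; [lra|].
  exists (K0 + 2 * K1 + K2). split; [lra|]. intros x hx.
  specialize (H0 x hx). specialize (H1 x hx). specialize (H2 x hx).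
  do 2 rewrite Rpower_plus in H2. rewrite Rpower_plus in H1.
  assert (hp := Rpower_pos x c). assert (hq := Rpower_pos x (c - 1)).
  unfold bump. set (X := Rpower x c) in *. set (P := Rpower x (tau - c + 1)) in *.
  replace (Rpower x tau) with (P * Rpower x (c - 1)).
  2:{ unfold P. rewrite <- Rpower_plus. f_equal. ring. }
  assert (HX : 0 < (1 + X) * (1 + X)) by (apply Rmult_lt_0_compat; lra).
  replace ((K0 + 2 * K1 + K2) * (Rpower x (c - 1) / ((1 + X) * (1 + X))))
    with (((K0 + 2 * K1 + K2) * Rpower x (c - 1)) / ((1 + X) * (1 + X))) by (field; lra).
  apply (proj1 (Rle_div_r _ _ _ HX)).
  replace (P * Rpower x (c - 1) * exp (- x) * ((1 + X) * (1 + X))) with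
    ((P * exp (- x) + 2 * (P * X * exp (- x)) + P * X * X * exp (- x)) * Rpower x (c - 1)) by ring.
  apply Rmult_le_compat_r; lra.
Qed.

(** * The Gamma function *)

Lemma Clog_RtoC x : 0 < x -> Clog (RtoC x) = RtoC (ln x).
Proof.
  intros hx. unfold Clog. rewrite Carg_atan by (simpl; auto). rewrite im_RtoC, Cmod_RtoC_nonneg by lra.
  unfold Rdiv. rewrite Rmult_0_l, atan_0. reflexivity.
Qed.

Lemma Cmod_Cpowc_real x s : 0 < x -> Cmod (Cpowc (RtoC x) s) = Rpower x (Re s).
Proof.
  intros hx. unfold Cpowc. rewrite Clog_RtoC, Cmod_Cexp, re_scal_r by auto. reflexivity.
Qed.

Lemma pderiv_Cpowc_real s x : 0 < x -> pderiv (fun y => Cpowc (RtoC y) s) x (s * Cpowc (RtoC x) (s - 1))%C.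
Proof.
  intros hx. eapply pderiv_eq; [apply (pderiv_Cpowc RtoC s x 1)|ring]; auto. apply pderiv_RtoC.
Qed.

Lemma pderiv_exp_opp x : pderiv (fun y => RtoC (exp (- y))) x (- RtoC (exp (- x)))%C.
Proof.
  split; simpl.
  - auto_derive; auto. ring.
  - rewrite Ropp_0. apply (@is_derive_const R_AbsRing R_NormedModule).
Qed.

Lemma pderiv_ln x : 0 < x -> pderiv (fun y => RtoC (ln y)) x (RtoC (/ x)).
Proof.
  intros hx. split; simpl.
  - auto_derive; auto. field. lra.
  - apply (@is_derive_const R_AbsRing R_NormedModule).
Qed.

Definition gamma_kernel (z : C) (x : R) : C := (Cpowc (RtoC x) (z - 1) * RtoC (exp (- x)))%C.

Lemma gamma_kernel_deriv z x : 0 < x -> exists d, pderiv (gamma_kernel z) x d.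
Proof.
  intros hx. eexists. apply pderiv_mult; [now apply pderiv_Cpowc_real|apply pderiv_exp_opp].
Qed.

Lemma Cmod_gamma_kernel z x : 0 < x -> Cmod (gamma_kernel z x) = Rpower x (Re z - 1) * exp (- x).
Proof.
  intros hx. unfold gamma_kernel. rewrite Cmod_mult, Cmod_Cpowc_real by auto.
  rewrite Cmod_RtoC_nonneg by (left; apply exp_pos). reflexivity.
Qed.

Lemma CGamma_cint z : 0 < Re z -> cint (gamma_kernel z) (CGamma z).
Proof.
  intros hz. destruct (Rpower_exp_le_bump (Re z - 1) (Re z)) as [K [hK HK]]; [lra|].
  destruct (cint_dominated (gamma_kernel z) (Re z) K) as [l Hl]; auto.
  - apply pderiv_ccont. intros. now apply gamma_kernel_deriv.
  - intros x hx. rewrite Cmod_gamma_kernel; auto.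
  - replace (CGamma z) with l; auto. symmetry. exact (cint_RInt_gen _ _ Hl).
Qed.

(** With y = dl * ln x this dominates the logarithm by x^dl + x^(-dl), at both ends of the half
    line; [sqr_le_exp_sum] does the same for its square. *)
Lemma Rabs_le_exp_sum y : Rabs y <= exp y + exp (- y).
Proof.
  assert (h1 := exp_ineq1_le y). assert (h2 := exp_ineq1_le (- y)).
  assert (h3 := exp_pos y). assert (h4 := exp_pos (- y)).
  apply Rabs_le. lra.
Qed.

Lemma sqr_le_exp_sum y : y * y <= 4 * (exp y + exp (- y)).
Proof.
  assert (H : forall u, 0 <= u -> u * u <= 4 * exp u).
  { intros u hu. assert (h := exp_ineq1_le (u / 2)).
    replace u with (u / 2 + u / 2) at 3 by field. rewrite exp_plus.
    assert ((1 + u / 2) * (1 + u / 2) <= exp (u / 2) * exp (u / 2)) by (apply Rmult_le_compat; lra). nra. }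
  assert (h3 := exp_pos y). assert (h4 := exp_pos (- y)).
  destruct (Rle_lt_dec 0 y).
  - specialize (H y r). lra.
  - specialize (H (- y) ltac:(lra)). lra.
Qed.

Definition log_kernel (z : C) (x : R) : C := (RtoC (ln x) * gamma_kernel z x)%C.

Lemma Rpower_split x a b : Rpower x a * Rpower x b = Rpower x (a + b).
Proof. symmetry. apply Rpower_plus. Qed.

Lemma Rpower_two_sided_le_bump sg dl c : 0 < c <= sg - dl -> 0 <= dl ->
  exists K, 0 < K /\ forall x, 0 < x ->
    (Rpower x dl + Rpower x (- dl)) * (Rpower x (sg - 1) * exp (- x)) <= K * bump c x.
Proof.
  intros hc hdl.
  destruct (Rpower_exp_le_bump (sg - 1 + dl) c) as [K1 [hK1 HK1]]; [lra|].
  destruct (Rpower_exp_le_bump (sg - 1 + - dl) c) as [K2 [hK2 HK2]]; [lra|].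
  exists (K1 + K2). split; [lra|]. intros x hx. specialize (HK1 x hx). specialize (HK2 x hx).
  rewrite <- Rpower_split in HK1, HK2. lra.
Qed.

(** Differentiation under the integral, made quantitative: the error at h is the integral of (x^h -
    1 - h ln x) times the kernel, and the second order Taylor bound of the exponential makes it
    O(|h|^2). *)
Theorem CGamma_deriv z : 0 < Re z -> exists d, cint (log_kernel z) d /\ cderiv CGamma z d.
Proof.
  (* One power x^(dl) or x^(-dl) absorbs x^h and another one ln^2 x; the exponent then drops by at
     most 2 dl = sg/2, which keeps the integrals convergent at 0. *)
  intros hz. set (sg := Re z) in *. set (dl := sg / 4). assert (hdl : 0 < dl) by (unfold dl; lra).
  destruct (Rpower_two_sided_le_bump sg dl (sg / 2)) as [K1 [hK1 HK1]]; [unfold dl; lra|lra|].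
  destruct (Rpower_two_sided_le_bump sg (2 * dl) (sg / 2)) as [K2 [hK2 HK2]]; [unfold dl; lra|lra|].
  assert (hidl : 0 < / dl) by now apply Rinv_0_lt_compat.
  assert (hG : forall x, 0 < Rpower x (sg - 1) * exp (- x)).
  { intros x. apply Rmult_lt_0_compat; [apply Rpower_pos|apply exp_pos]. }
  destruct (cint_dominated (log_kernel z) (sg / 2) (/ dl * K1)) as [d Hd]; [lra| | |].
  { apply pderiv_ccont. intros x hx. destruct (gamma_kernel_deriv z x hx) as [e He].
    eexists. apply pderiv_mult; [now apply pderiv_ln|exact He]. }
  { intros x hx. unfold log_kernel. rewrite Cmod_mult, Cmod_R, Cmod_gamma_kernel by auto. fold sg.
    assert (H := Rabs_le_exp_sum (dl * ln x)). rewrite Rabs_mult, (Rabs_pos_eq dl) in H by lra.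
    replace (- (dl * ln x)) with (- dl * ln x) in H by ring.
    change (dl * Rabs (ln x) <= Rpower x dl + Rpower x (- dl)) in H.
    apply Rmult_le_reg_l with dl; auto.
    replace (dl * (/ dl * K1 * bump (sg / 2) x)) with (K1 * bump (sg / 2) x) by (field; lra).
    eapply Rle_trans; [|apply (HK1 x hx)]. rewrite <- Rmult_assoc.
    apply Rmult_le_compat_r; [left; apply hG|exact H]. }
  exists d. split; auto.
  (* 16 is the product of the 8 in [Hsq] and the 2 in [Hexp]; the outer 2 and / (sg/2) come from
     [cint_dominated_le]. *)
  set (A := 2 * (16 * / (dl * dl) * K2 * / (sg / 2))).
  assert (hdd : 0 < / (dl * dl)) by (apply Rinv_0_lt_compat; now apply Rmult_lt_0_compat).
  assert (hs2 : 0 < / (sg / 2)) by (apply Rinv_0_lt_compat; lra).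
  assert (hA : 0 < A) by (unfold A; repeat apply Rmult_lt_0_compat; lra).
  assert (Hmain : forall h, Cmod h < dl -> Cmod (CGamma (z + h) - CGamma z - h * d)%C <= A * (Cmod h * Cmod h)).
  { intros h hh. assert (hre := re_le_Cmod h). assert (hre2 := Rabs_maj2 (Re h)).
    assert (H1 := CGamma_cint (z + h)%C ltac:(rewrite re_plus; fold sg; unfold dl in *; lra)).
    assert (H2 := CGamma_cint z hz).
    assert (H3 := cint_minus _ _ _ _ (cint_minus _ _ _ _ H1 H2) (cint_scal h _ _ Hd)).
    set (B := Cmod h * Cmod h * (16 * / (dl * dl) * K2)).
    replace (A * (Cmod h * Cmod h)) with (2 * (B * / (sg / 2))) by (unfold A, B; ring).
    refine (cint_dominated_le _ (sg / 2) B _ _ H3 _); [lra|].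
    intros x hx. cbv beta.
    replace (gamma_kernel (z + h) x - gamma_kernel z x - h * log_kernel z x)%C with
      ((Cexp (h * RtoC (ln x)) - 1 - h * RtoC (ln x)) * gamma_kernel z x)%C.
    2:{ unfold log_kernel, gamma_kernel. replace (z + h - 1)%C with ((z - 1) + h)%C by ring.
        rewrite Cpowc_plus. unfold Cpowc at 3. rewrite Clog_RtoC by auto. ring. }
    rewrite Cmod_mult, Cmod_gamma_kernel by auto. fold sg.
    assert (HT := Cexp_taylor (h * RtoC (ln x)) 2).
    replace (Cexp (h * ln x) - csum _ 2)%C with (Cexp (h * ln x) - 1 - h * ln x)%C in HT
      by (simpl; rewrite Rinv_1; ring).
    rewrite Cmod_mult, Cmod_R, re_scal_r in HT.
    replace (INR (fact 2)) with 2 in HT by (simpl; ring).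
    set (L := ln x) in *. set (y := dl * Rabs L).
    assert (hL := Rabs_pos L). assert (hy : 0 <= y) by (unfold y; nra).
    assert (hc := Cmod_ge_0 h).
    assert (Hexp : 1 + exp (Re h * L) <= 2 * exp y).
    { assert (exp (Re h * L) <= exp y).
      { apply exp_le_mono. eapply Rle_trans; [apply Rle_abs|]. rewrite Rabs_mult. unfold y. nra. }
      assert (exp 0 <= exp y) by (apply exp_le_mono; lra). rewrite exp_0 in H0. lra. }
    assert (Hsq : Rabs L * Rabs L <= / (dl * dl) * (8 * exp y)).
    { assert (H := sqr_le_exp_sum y). assert (H' : exp (- y) <= exp y) by (apply exp_le_mono; lra).
      apply Rmult_le_reg_l with (dl * dl); [nra|].
      replace (dl * dl * (/ (dl * dl) * (8 * exp y))) with (8 * exp y) by (field; lra).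
      replace (dl * dl * (Rabs L * Rabs L)) with (y * y) by (unfold y; ring). lra. }
    assert (Hyy : exp y * exp y <= Rpower x (2 * dl) + Rpower x (- (2 * dl))).
    { rewrite <- exp_plus. unfold Rpower. fold L.
      assert (h1 := exp_pos (2 * dl * L)). assert (h2 := exp_pos (- (2 * dl) * L)).
      unfold y. unfold Rabs. destruct (Rcase_abs L).
      - replace (dl * - L + dl * - L) with (- (2 * dl) * L) by ring. lra.
      - replace (dl * L + dl * L) with (2 * dl * L) by ring. lra. }
    assert (hey := exp_pos y). specialize (HK2 x hx). specialize (hG x).
    replace (2 * ((Cmod h * Rabs L) ^ 2 * (1 + exp (Re h * L))) / 2) with
      (Cmod h * Cmod h * (Rabs L * Rabs L * (1 + exp (Re h * L)))) in HT by field.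
    assert (HLe : Rabs L * Rabs L * (1 + exp (Re h * L)) <= 16 * / (dl * dl) * (exp y * exp y)).
    { replace (16 * / (dl * dl) * (exp y * exp y)) with (/ (dl * dl) * (8 * exp y) * (2 * exp y)) by ring.
      apply Rmult_le_compat; auto; [nra|]. assert (h1 := exp_pos (Re h * L)). lra. }
    set (G := Rpower x (sg - 1) * exp (- x)) in *.
    apply Rle_trans with (Cmod h * Cmod h * (16 * / (dl * dl) * (exp y * exp y)) * G).
    - apply Rmult_le_compat_r; [lra|]. eapply Rle_trans; [exact HT|].
      apply Rmult_le_compat_l; [nra|exact HLe].
    - unfold B.
      replace (Cmod h * Cmod h * (16 * / (dl * dl) * (exp y * exp y)) * G) with
        (Cmod h * Cmod h * (16 * / (dl * dl)) * (exp y * exp y * G)) by ring.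
      replace (Cmod h * Cmod h * (16 * / (dl * dl) * K2) * bump (sg / 2) x) with
        (Cmod h * Cmod h * (16 * / (dl * dl)) * (K2 * bump (sg / 2) x)) by ring.
      apply Rmult_le_compat_l; [apply Rmult_le_pos; nra|].
      eapply Rle_trans; [|exact HK2]. apply Rmult_le_compat_r; lra. }
  apply cderiv_spec. intros eps he. exists (Rmin dl (eps / A)). split.
  - apply Rmin_pos; auto. now apply Rdiv_lt_0_compat.
  - intros h hh. assert (h1 := Rmin_l dl (eps / A)). assert (h2 := Rmin_r dl (eps / A)).
    eapply Rle_trans; [apply Hmain; lra|]. rewrite <- Rmult_assoc.
    apply Rmult_le_compat_r; [apply Cmod_ge_0|].
    assert (h3 : Cmod h < eps / A) by lra. apply Rlt_div_r in h3; auto. lra.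
Qed.

(** Integration by parts: the difference of the two integrands is, up to sign, the derivative of x^z
    exp(-x), which vanishes at both ends. *)
Lemma CGamma_succ z : 0 < Re z -> CGamma (z + 1) = (z * CGamma z)%C.
Proof.
  intros hz.
  assert (hz1 : 0 < Re (z + 1)%C) by (rewrite re_plus, re_RtoC; lra).
  apply Ceq_minus.
  apply cint_unique with (fun x => gamma_kernel (z + 1) x - z * gamma_kernel z x)%C.
  - apply cint_minus; [now apply CGamma_cint|]. apply cint_scal. now apply CGamma_cint.
  - replace (RtoC 0) with ((-1) * 0)%C by ring.
    apply cint_ext with (fun x => (-1) * (z * gamma_kernel z x - gamma_kernel (z + 1) x))%C;
      [intros; ring|].
    apply cint_scal.
    apply (cint_of_primitive (fun x => Cpowc (RtoC x) z * RtoC (exp (- x)))%C).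
    + intros x hx. eapply pderiv_eq.
      * apply pderiv_mult; [now apply pderiv_Cpowc_real|apply pderiv_exp_opp].
      * unfold gamma_kernel. replace (z + 1 - 1)%C with z by ring. ring.
    + apply pderiv_ccont. intros x hx.
      destruct (gamma_kernel_deriv z x hx) as [d1 H1].
      destruct (gamma_kernel_deriv (z + 1) x hx) as [d2 H2].
      eexists. apply pderiv_minus; [apply pderiv_scal|]; eassumption.
    + intros eps he. assert (Hl := proj1 (filterlim_locally _ _) (filterlim_Rpower_0 (Re z) hz) (mkposreal eps he)).
      destruct Hl as [d Hd]. exists d. split; [apply cond_pos|]. intros x hx.
      assert (hb : ball 0 d x).
      { apply Rabs_ball. apply Rabs_def1; lra. }
      specialize (Hd x hb ltac:(lra)). apply ball_Rabs in Hd. simpl in Hd. apply Rabs_def2 in Hd.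
      rewrite Cmod_mult, Cmod_Cpowc_real, Cmod_RtoC_nonneg by (try left; try apply exp_pos; lra).
      assert (exp (- x) <= 1) by (rewrite <- exp_0; apply exp_le_mono; lra).
      assert (h2 := exp_pos (- x)). assert (h3 := Rpower_pos x (Re z)). nra.
    + intros eps he. destruct (Rpower_exp_bounded (Re z + 1)) as [K [hK HK]]; [lra|].
      exists (K / eps). intros x hx.
      assert (hKe : 0 < K / eps) by now apply Rdiv_lt_0_compat.
      assert (hx0 : 0 < x) by lra. specialize (HK x hx0).
      rewrite Cmod_mult, Cmod_Cpowc_real, Cmod_RtoC_nonneg by (try left; try apply exp_pos; lra).
      rewrite <- Rpower_split, Rpower_1 in HK by auto. apply Rlt_div_l in hx; auto.
      apply Rmult_lt_reg_r with x; auto. nra.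
Qed.

Lemma CGamma_1 : CGamma 1 = 1.
Proof.
  apply cint_unique with (gamma_kernel 1); [apply CGamma_cint; simpl; lra|].
  assert (E : forall x, gamma_kernel 1 x = RtoC (exp (- x))).
  { intros x. unfold gamma_kernel. replace (1 - 1)%C with (RtoC 0) by ring. rewrite Cpowc_0. ring. }
  apply cint_ext with (fun x => RtoC (exp (- x))); [intros; now rewrite E|].
  split; simpl.
  - apply rint_eq with (0 - -1); [ring|].
    apply (rint_of_primitive (fun x => - exp (- x))).
    + intros x _. auto_derive; auto. ring.
    + apply is_derive_continuous_pos. intros x _. auto_derive. auto.
    + assert (Hc : continuous (fun x => - exp (- x)) 0).
      { apply (@ex_derive_continuous R_AbsRing R_NormedModule). auto_derive. auto. }
      unfold continuous in Hc. rewrite Ropp_0, exp_0 in Hc.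
      intros P HP. destruct (Hc P HP) as [d Hd]. exists d. intros y hy _. now apply Hd.
    + apply filterlim_locally. intros eps. exists (/ eps). intros x hx.
      assert (he := cond_pos eps). assert (hie : 0 < / eps) by now apply Rinv_0_lt_compat.
      apply Rabs_ball.
      rewrite Rminus_0_r, Rabs_Ropp, Rabs_pos_eq by (left; apply exp_pos).
      rewrite exp_Ropp. assert (h := exp_ineq1_le x).
      rewrite <- (Rinv_inv eps). apply Rinv_lt_contravar; [|lra]. apply Rmult_lt_0_compat; lra.
  - apply rint_eq with (0 * 0); [ring|].
    apply rint_ext with (fun x => 0 * bump 1 x); [intros; ring|].
    apply rint_eq with (0 * / 1); [ring|]. apply rint_scal. apply rint_bump. lra.
Qed.

Lemma CGamma_INR m : CGamma (RtoC (INR m) + 1) = RtoC (INR (fact m)).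
Proof.
  induction m.
  - simpl. rewrite Cplus_0_l. apply CGamma_1.
  - rewrite CGamma_succ.
    + rewrite S_INR, RtoC_plus, IHm, fact_simpl, mult_INR, S_INR, RtoC_mult, RtoC_plus. reflexivity.
    + rewrite re_RtoC. apply lt_0_INR. lia.
Qed.

(** * Asymptotics of the Gamma function by concentration of the Gamma density *)

Lemma rint_moment m : rint (fun x => x ^ m * exp (- x)) (INR (fact m)).
Proof.
  assert (H : cint (gamma_kernel (RtoC (INR m) + 1)) (RtoC (INR (fact m)))).
  { rewrite <- CGamma_INR. apply CGamma_cint. rewrite re_plus, !re_RtoC. assert (h := pos_INR m). lra. }
  destruct H as [H _]. rewrite re_RtoC in H. revert H. apply rint_ext. intros x hx.
  unfold gamma_kernel. replace (INR m + 1 - 1)%C with (RtoC (INR m)) by ring.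
  rewrite Cpowc_INR, <- RtoC_pow, <- RtoC_mult, re_RtoC; auto.
Qed.

Lemma re_plus_INR_pos z n : 0 < Re z -> 0 < Re (z + RtoC (INR n))%C.
Proof. intros hz. rewrite re_plus, re_RtoC. assert (h := pos_INR n). lra. Qed.

(** The density of the Gamma distribution of shape n + 1. Its mean and variance are both n + 1, so
    x/(n+1) concentrates at 1. *)
Definition gdens (n : nat) (x : R) : R := x ^ n * exp (- x) / INR (fact n).

Lemma gdens_pos n x : 0 < x -> 0 < gdens n x.
Proof.
  intros hx. unfold gdens. apply Rdiv_lt_0_compat; [|apply INR_fact_lt_0].
  apply Rmult_lt_0_compat; [now apply pow_lt|apply exp_pos].
Qed.

Lemma rint_gdens_pow n j : rint (fun x => (x / INR (S n)) ^ j * gdens n x)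
  (INR (fact (n + j)) / (INR (fact n) * INR (S n) ^ j)).
Proof.
  assert (hf := INR_fact_neq_0 n). assert (hs : INR (S n) <> 0) by (apply not_0_INR; lia).
  apply rint_ext with (fun x => / (INR (fact n) * INR (S n) ^ j) * (x ^ (n + j) * exp (- x))).
  - intros x _. unfold gdens, Rdiv. rewrite Rpow_mult_distr, pow_inv, pow_add. field.
    split; auto. now apply pow_nonzero.
  - apply rint_eq with (/ (INR (fact n) * INR (S n) ^ j) * INR (fact (n + j))).
    + field. split; auto. now apply pow_nonzero.
    + apply rint_scal, rint_moment.
Qed.

Lemma rint_gdens_variance n : rint (fun x => (x / INR (S n) - 1) ^ 2 * gdens n x) (/ INR (S n)).
Proof.
  assert (H0 := rint_gdens_pow n 0). assert (H1 := rint_gdens_pow n 1). assert (H2 := rint_gdens_pow n 2).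
  assert (H := rint_plus _ _ _ _ (rint_minus _ _ _ _ H2 (rint_scal 2 _ _ H1)) H0).
  assert (hf := INR_fact_neq_0 n). assert (hs : INR (S n) <> 0) by (apply not_0_INR; lia).
  eapply rint_ext; [|eapply rint_eq; [|exact H]].
  - intros x _. simpl. ring.
  - replace (n + 2)%nat with (S (S n)) by lia. replace (n + 1)%nat with (S n) by lia.
    rewrite Nat.add_0_r, !fact_simpl, !mult_INR, (S_INR (S n)). field. auto.
Qed.

(** Makes the moments of [rint_gdens_pow] bounded uniformly in n: each of the j factors n + i with i
    <= j is at most (1 + j)(n + 1). *)
Lemma fact_add_le n j : INR (fact (n + j)) / (INR (fact n) * INR (S n) ^ j) <= (1 + INR j) ^ j.
Proof.
  assert (hf := INR_fact_lt_0 n). assert (hs : 1 <= INR (S n)) by (apply (le_INR 1); lia).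
  assert (A : INR (fact (n + j)) <= INR (fact n) * (INR (S n) + INR j) ^ j).
  { induction j.
    - rewrite Nat.add_0_r. simpl. lra.
    - replace (n + S j)%nat with (S (n + j)) by lia. rewrite fact_simpl, mult_INR.
      replace (INR (S (n + j))) with (INR (S n) + INR j) by (rewrite !S_INR, plus_INR; ring).
      assert (hj := pos_INR j). rewrite (S_INR j).
      apply Rle_trans with ((INR (S n) + INR j) * (INR (fact n) * (INR (S n) + INR j) ^ j)).
      + apply Rmult_le_compat_l; lra.
      + replace ((INR (S n) + INR j) * (INR (fact n) * (INR (S n) + INR j) ^ j))
          with (INR (fact n) * (INR (S n) + INR j) ^ (S j)) by (simpl; ring).
        apply Rmult_le_compat_l; [lra|]. apply pow_incr. lra. }
  assert (hp : 0 < INR (S n) ^ j) by (apply pow_lt; lra).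
  apply Rle_div_l; [apply Rmult_lt_0_compat; lra|].
  eapply Rle_trans; [exact A|].
  replace ((1 + INR j) ^ j * (INR (fact n) * INR (S n) ^ j)) with
    (INR (fact n) * ((1 + INR j) * INR (S n)) ^ j) by (rewrite Rpow_mult_distr; ring).
  apply Rmult_le_compat_l; [lra|]. apply pow_incr. assert (hj := pos_INR j). nra.
Qed.

(** The index is raised by 2 so that dividing by x^2 still leaves an ordinary moment; hence the
    condition [2 <= n] in [CGamma_asymptotics]. *)
Lemma rint_gdens_inv_sqr n : rint (fun x => / (x / INR (S (S (S n)))) ^ 2 * gdens (S (S n)) x)
  (INR (S (S (S n))) ^ 2 / (INR (S (S n)) * INR (S n))).
Proof.
  set (N := INR (S (S (S n)))). assert (hN : N <> 0) by (apply not_0_INR; lia).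
  assert (h1 : INR (S n) <> 0) by (apply not_0_INR; lia).
  assert (h2 : INR (S (S n)) <> 0) by (apply not_0_INR; lia).
  assert (hf := INR_fact_neq_0 n).
  apply rint_ext with (fun x => N ^ 2 / INR (fact (S (S n))) * (x ^ n * exp (- x))).
  - intros x hx. unfold gdens. rewrite !fact_simpl, !mult_INR. simpl (x ^ S (S n)). field.
    repeat split; auto; lra.
  - eapply rint_eq; [|apply rint_scal, rint_moment].
    rewrite !fact_simpl, !mult_INR. field. auto.
Qed.

(** From exp y >= 1 + y at y = ln u and y = - ln u, that is, 1 - 1/u <= ln u <= u - 1. *)
Lemma Rabs_ln_le u : 0 < u -> Rabs (ln u) <= Rabs (u - 1) * (1 + / u).
Proof.
  intros hu. assert (hi : 0 < / u) by now apply Rinv_0_lt_compat.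
  assert (h1 := exp_ineq1_le (ln u)). rewrite exp_ln in h1 by auto.
  assert (h2 := exp_ineq1_le (- ln u)). rewrite exp_Ropp, exp_ln in h2 by auto.
  assert (hA := Rabs_pos (u - 1)).
  destruct (Rle_lt_dec 1 u) as [h|h].
  - assert (0 <= ln u) by (rewrite <- ln_1; apply Rcomplements.ln_le; lra).
    rewrite (Rabs_pos_eq (ln u)), (Rabs_pos_eq (u - 1)) by lra. nra.
  - assert (ln u < 0) by (rewrite <- ln_1; apply ln_increasing; lra).
    rewrite (Rabs_left (ln u)), (Rabs_left (u - 1)) by lra.
    replace (- (u - 1) * (1 + / u)) with ((1 - u) + (/ u - 1)) by (field; lra). lra.
Qed.

Lemma Rpower_le_pow sg k u : 0 < u -> 0 <= sg <= INR k -> Rpower u sg <= 1 + u ^ k.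
Proof.
  intros hu h. rewrite <- (Rpower_pow k u hu). unfold Rpower.
  assert (h1 := exp_pos (INR k * ln u)).
  destruct (Rle_lt_dec 0 (ln u)).
  - assert (exp (sg * ln u) <= exp (INR k * ln u)) by (apply exp_le_mono; nra). lra.
  - assert (exp (sg * ln u) <= exp 0) by (apply exp_le_mono; nra). rewrite exp_0 in H. lra.
Qed.

(** The factor 1 + 1/u comes from [Rabs_ln_le], and 2 + u^(k+1) dominates 1 + u^(Re z) when Re z <=
    k + 1. *)
Definition gweight (k : nat) (u : R) : R := (1 + / u) * (2 + u ^ S k).

(* AM-GM.  The variable [u = x / N] has variance [1 / N] under [gdens], so that
   [lam = sqrt N] will bound the mean of the left-hand side by O(N^(-1/2)). *)
Lemma gweight_sqr k u lam : 0 < u -> 0 < lam ->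
  Rabs (u - 1) * gweight k u <=
  lam * (u - 1) ^ 2 + / lam * (20 * u ^ 0 + 8 * u ^ (2 * S k) + 16 * / u ^ 2).
Proof.
  intros hu hl. assert (hil : 0 < / lam) by now apply Rinv_0_lt_compat.
  set (W := gweight k u).
  assert (HW : W * W <= 20 * u ^ 0 + 8 * u ^ (2 * S k) + 16 * / u ^ 2).
  { unfold W, gweight. replace (2 * S k)%nat with (S k + S k)%nat by lia.
    set (i := / u). assert (hi : 0 < i) by now apply Rinv_0_lt_compat.
    replace (/ u ^ 2) with (i * i) by (unfold i; field; lra).
    rewrite pow_add, pow_O. set (P := u ^ S k).
    assert (hP : P = u * u ^ k) by reflexivity.
    assert (hk : 0 < u ^ k) by now apply pow_lt.
    assert (hiP : i * P = u ^ k) by (rewrite hP; unfold i; field; lra).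
    assert (hkP : u ^ k * u ^ k <= 1 + P * P).
    { destruct (Rle_lt_dec 1 u) as [h|h].
      - assert (u ^ k <= P) by (rewrite hP; nra). nra.
      - assert (u ^ k <= 1) by (rewrite <- (pow1 k); apply pow_incr; lra).
        assert (0 <= P * P) by apply Rle_0_sqr. nra. }
    assert (A1 : (1 + i) * (1 + i) <= 2 + 2 * (i * i)) by (assert (h := Rle_0_sqr (1 - i)); unfold Rsqr in h; lra).
    assert (A2 : (2 + P) * (2 + P) <= 8 + 2 * (P * P)) by (assert (h := Rle_0_sqr (2 - P)); unfold Rsqr in h; lra).
    assert (hPp : 0 < P) by (rewrite hP; now apply Rmult_lt_0_compat).
    assert (A3 : (1 + i) * (1 + i) * ((2 + P) * (2 + P)) <= (2 + 2 * (i * i)) * (8 + 2 * (P * P))).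
    { apply Rmult_le_compat; auto; apply Rlt_le; repeat apply Rmult_lt_0_compat; lra. }
    replace ((2 + 2 * (i * i)) * (8 + 2 * (P * P))) with
      (16 + 4 * (P * P) + 16 * (i * i) + 4 * ((i * P) * (i * P))) in A3 by ring.
    rewrite hiP in A3. lra. }
  set (T := 20 * u ^ 0 + 8 * u ^ (2 * S k) + 16 * / u ^ 2) in *.
  set (a := Rabs (u - 1)).
  assert (Ha : a * a = (u - 1) ^ 2) by (unfold a; rewrite <- Rabs_mult, Rabs_pos_eq; [ring|apply Rle_0_sqr]).
  rewrite <- Ha.
  apply Rle_trans with (lam * (a * a) + / lam * (W * W)).
  - apply Rmult_le_reg_l with lam; auto.
    replace (lam * (lam * (a * a) + / lam * (W * W))) with (lam * a * (lam * a) + W * W) by (field; lra).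
    assert (h := Rle_0_sqr (lam * a - W)). unfold Rsqr in h.
    assert (h2 := Rle_0_sqr (lam * a + W)). unfold Rsqr in h2. lra.
  - apply Rplus_le_compat_l. apply Rmult_le_compat_l; lra.
Qed.

Lemma Cpowc_weight z k u : 0 < Re z <= INR (S k) -> 0 < u ->
  Cmod (Cpowc (RtoC u) z - 1)%C <= (2 * Cmod z + 1) * (Rabs (u - 1) * gweight k u) /\
  Cmod (RtoC (ln u) * Cpowc (RtoC u) z)%C <= (2 * Cmod z + 1) * (Rabs (u - 1) * gweight k u).
Proof.
  intros hz hu. assert (Hl := Rabs_ln_le u hu). assert (hc := Cmod_ge_0 z).
  assert (Hp := Rpower_le_pow (Re z) (S k) u hu ltac:(lra)).
  assert (hi : 0 < / u) by now apply Rinv_0_lt_compat.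
  assert (hP : 0 < u ^ S k) by now apply pow_lt.
  assert (hA := Rabs_pos (u - 1)). assert (hln := Rabs_pos (ln u)).
  assert (HW : Rabs (ln u) * (2 + u ^ S k) <= Rabs (u - 1) * gweight k u).
  { unfold gweight. rewrite <- Rmult_assoc. apply Rmult_le_compat_r; lra. }
  assert (HW0 : 0 <= Rabs (ln u) * (2 + u ^ S k)) by (apply Rmult_le_pos; lra).
  split.
  - unfold Cpowc. rewrite Clog_RtoC by auto.
    assert (HT := Cexp_taylor (z * RtoC (ln u)) 1).
    replace (csum _ 1) with (RtoC 1) in HT by (simpl; rewrite Rinv_1; ring).
    rewrite Cmod_mult, Cmod_R, re_scal_r, pow_1 in HT. simpl (INR (fact 1)) in HT. rewrite Rdiv_1_r in HT.
    eapply Rle_trans; [exact HT|].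
    change (exp (Re z * ln u)) with (Rpower u (Re z)).
    apply Rle_trans with (2 * Cmod z * (Rabs (ln u) * (2 + u ^ S k))).
    + replace (2 * (Cmod z * Rabs (ln u) * (1 + Rpower u (Re z)))) with
        (2 * Cmod z * (Rabs (ln u) * (1 + Rpower u (Re z)))) by ring.
      apply Rmult_le_compat_l; [lra|]. apply Rmult_le_compat_l; lra.
    + apply Rmult_le_compat; lra.
  - rewrite Cmod_mult, Cmod_R, Cmod_Cpowc_real by auto.
    apply Rle_trans with (1 * (Rabs (ln u) * (2 + u ^ S k))).
    + rewrite Rmult_1_l. apply Rmult_le_compat_l; lra.
    + apply Rmult_le_compat; lra.
Qed.

Lemma Cpowc_div_real x N z : 0 < x -> 0 < N ->
  Cpowc (RtoC (x / N)) z = (Cpowc (RtoC x) z / Cpowc (RtoC N) z)%C.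
Proof.
  intros hx hN. assert (hi : 0 < / N) by now apply Rinv_0_lt_compat.
  unfold Cdiv. rewrite <- Cpowc_opp. unfold Cpowc.
  rewrite !Clog_RtoC by (try apply Rdiv_lt_0_compat; auto).
  unfold Rdiv. rewrite ln_mult, ln_Rinv by auto. rewrite RtoC_plus, RtoC_opp, <- Cexp_plus.
  f_equal. ring.
Qed.

Lemma gamma_kernel_gdens z n x : 0 < x ->
  gamma_kernel (z + RtoC (INR (S n))) x =
  (Cpowc (RtoC x) z * RtoC (gdens n x) * RtoC (INR (fact n)))%C.
Proof.
  intros hx. unfold gamma_kernel, gdens.
  replace (z + RtoC (INR (S n)) - 1)%C with (z + RtoC (INR n))%C by (rewrite S_INR, RtoC_plus; ring).
  rewrite Cpowc_plus, Cpowc_INR by auto.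
  rewrite <- (Cmult_assoc _ (RtoC (_ / _))), <- RtoC_mult.
  replace (x ^ n * exp (- x) / INR (fact n) * INR (fact n)) with (x ^ n * exp (- x))
    by (field; apply INR_fact_neq_0).
  rewrite RtoC_mult, RtoC_pow. ring.
Qed.

(** The leading term of Gamma(z + n + 1). *)
Definition gscale (z : C) (n : nat) : C :=
  (RtoC (INR (fact n)) * Cpowc (RtoC (INR (S n))) z)%C.

Lemma gscale_neq_0 z n : gscale z n <> 0.
Proof.
  apply Cmult_neq_0; [|apply Cpowc_neq_0]. intros E. apply RtoC_inj in E. now apply INR_fact_neq_0 in E.
Qed.

(** Put N = n + 1 and u = x/N. The two quantities are the means of u^z - 1 and of ln u * u^z under
    [gdens n]. Both integrands are at most a constant times |u - 1| [gweight], whose mean is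
    O(N^(-1/2)). The first estimate says that the Gamma function has leading term [gscale], the
    second that Gamma'(z+N) is close to ln N * Gamma(z+N). *)
Lemma CGamma_asymptotics z : 0 < Re z -> exists K, forall n d, (2 <= n)%nat ->
  cint (log_kernel (z + RtoC (INR (S n)))) d ->
  Cmod (CGamma (z + RtoC (INR (S n))) / gscale z n - 1)%C <= K * Rpower (INR (S n)) (- / 2) /\
  Cmod ((d - RtoC (ln (INR (S n))) * CGamma (z + RtoC (INR (S n)))) / gscale z n)%C
     <= K * Rpower (INR (S n)) (- / 2).
Proof.
  intros hz. destruct (exists_order (Re z)) as [k hk].
  (* Bounds for the three means in [gweight_sqr]; the 9 bounds N^2/((N-1)(N-2)) for N >= 3. *)
  set (J := 20 + 8 * (1 + INR (2 * S k)) ^ (2 * S k) + 16 * 9).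
  exists (2 * ((2 * Cmod z + 1) * (1 + J))).
  intros n d hn Hd. destruct n as [|[|n]]; try lia. clear hn.
  set (m := S (S n)) in *. set (N := INR (S m)).
  assert (hN : 0 < N) by (apply lt_0_INR; lia).
  set (lam := Rpower N (/ 2)). assert (hlam : 0 < lam) by apply Rpower_pos.
  assert (hlam2 : / lam = Rpower N (- / 2)) by (unfold lam; now rewrite Rpower_Ropp).
  assert (hlam3 : lam * / N = Rpower N (- / 2)).
  { unfold lam. rewrite <- (Rpower_1 N hN) at 2. rewrite <- Rpower_Ropp, Rpower_split. f_equal. field. }
  assert (hz1 := re_plus_INR_pos z (S m) hz).
  assert (HG := CGamma_cint _ hz1).
  assert (hsc := gscale_neq_0 z m).
  assert (hkk : 0 < Re z <= INR (S k)) by (rewrite S_INR; lra).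
  set (w := fun x => (2 * Cmod z + 1) * (lam * ((x / N - 1) ^ 2 * gdens m x) + / lam *
    (20 * ((x / N) ^ 0 * gdens m x) + 8 * ((x / N) ^ (2 * S k) * gdens m x) + 16 * (/ (x / N) ^ 2 * gdens m x)))).
  set (I := (2 * Cmod z + 1) * (lam * / N + / lam *
    (20 * (INR (fact (m + 0)) / (INR (fact m) * N ^ 0)) +
     8 * (INR (fact (m + 2 * S k)) / (INR (fact m) * N ^ (2 * S k))) +
     16 * (N ^ 2 / (INR (S (S n)) * INR (S n)))))).
  assert (HI : rint w I).
  { apply rint_scal. apply rint_plus; [apply rint_scal, rint_gdens_variance|].
    apply rint_scal. apply rint_plus; [apply rint_plus|]; apply rint_scal.
    - exact (rint_gdens_pow m 0).
    - exact (rint_gdens_pow m (2 * S k)).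
    - exact (rint_gdens_inv_sqr n). }
  assert (hc := Cmod_ge_0 z).
  assert (HIle : I <= (2 * Cmod z + 1) * (1 + J) * Rpower N (- / 2)).
  { unfold I. rewrite hlam3, hlam2, Rmult_assoc. apply Rmult_le_compat_l; [lra|].
    assert (hr := Rpower_pos N (- / 2)).
    replace ((1 + J) * Rpower N (- / 2)) with (Rpower N (- / 2) + Rpower N (- / 2) * J) by ring.
    apply Rplus_le_compat_l. apply Rmult_le_compat_l; [lra|].
    assert (hj := fact_add_le m (2 * S k)). fold N in hj.
    assert (h0 : INR (fact (m + 0)) / (INR (fact m) * N ^ 0) = 1).
    { rewrite Nat.add_0_r. simpl pow. field. apply INR_fact_neq_0. }
    assert (h1 : N ^ 2 / (INR (S (S n)) * INR (S n)) <= 9).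
    { assert (hn := pos_INR n). unfold N, m. rewrite !S_INR.
      apply Rle_div_l; [apply Rmult_lt_0_compat; lra|]. nra. }
    rewrite h0. unfold J. lra. }
  assert (Hw : forall x, 0 < x -> (2 * Cmod z + 1) * (Rabs (x / N - 1) * gweight k (x / N)) * gdens m x <= w x).
  { intros x hx. unfold w. rewrite Rmult_assoc. apply Rmult_le_compat_l; [lra|].
    assert (hu : 0 < x / N) by now apply Rdiv_lt_0_compat.
    assert (H := gweight_sqr k (x / N) lam hu hlam).
    assert (hg := gdens_pos m x hx).
    replace (lam * ((x / N - 1) ^ 2 * gdens m x) + / lam *
      (20 * ((x / N) ^ 0 * gdens m x) + 8 * ((x / N) ^ (2 * S k) * gdens m x) + 16 * (/ (x / N) ^ 2 * gdens m x)))
      with ((lam * (x / N - 1) ^ 2 + / lam *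
        (20 * (x / N) ^ 0 + 8 * (x / N) ^ (2 * S k) + 16 * / (x / N) ^ 2)) * gdens m x) by ring.
    apply Rmult_le_compat_r; lra. }
  assert (hNz : forall x, 0 < x -> Cpowc (RtoC x) z = (Cpowc (RtoC (x / N)) z * Cpowc (RtoC N) z)%C).
  { intros x hx. rewrite Cpowc_div_real by auto. field. apply Cpowc_neq_0. }
  assert (hfm : RtoC (INR (fact m)) <> 0).
  { intros E. apply RtoC_inj in E. now apply INR_fact_neq_0 in E. }
  assert (hpN := Cpowc_neq_0 (RtoC N) z).
  split.
  - apply Rle_trans with (2 * I); [|lra].
    refine (cint_mod_le (fun x => (Cpowc (RtoC (x / N)) z - 1) * RtoC (gdens m x))%C w _ _ _ HI _).
    + assert (H1 : cint (fun x => RtoC (gdens m x)) 1).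
      { assert (H := rint_gdens_pow m 0). rewrite Nat.add_0_r in H. split.
        - change (rint (fun x => gdens m x) 1).
          eapply rint_eq; [|eapply rint_ext; [|exact H]].
          + rewrite pow_O. field. apply INR_fact_neq_0.
          + intros x _. cbv beta. rewrite pow_O. ring.
        - change (rint (fun x => 0) 0). apply rint_eq with (0 * / 1); [ring|].
          apply rint_ext with (fun x => 0 * bump 1 x); [intros; ring|].
          apply rint_scal. apply rint_bump. lra. }
      apply cint_ext with (fun x => / gscale z m * gamma_kernel (z + RtoC (INR (S m))) x - RtoC (gdens m x))%C.
      * intros x hx. rewrite gamma_kernel_gdens, (hNz x hx) by auto. unfold gscale. fold N. field. auto.
      * apply cint_minus; auto. unfold Cdiv. rewrite Cmult_comm. now apply cint_scal.
    + intros x hx. rewrite Cmod_mult, (Cmod_RtoC_nonneg (gdens m x)) by (left; now apply gdens_pos).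
      eapply Rle_trans; [|apply Hw; auto]. apply Rmult_le_compat_r; [left; now apply gdens_pos|].
      apply Cpowc_weight; auto. now apply Rdiv_lt_0_compat.
  - apply Rle_trans with (2 * I); [|lra].
    refine (cint_mod_le (fun x => (RtoC (ln (x / N)) * Cpowc (RtoC (x / N)) z) * RtoC (gdens m x))%C w _ _ _ HI _).
    + apply cint_ext with (fun x => / gscale z m * (log_kernel (z + RtoC (INR (S m))) x
         - RtoC (ln N) * gamma_kernel (z + RtoC (INR (S m))) x))%C.
      * intros x hx. unfold log_kernel. rewrite gamma_kernel_gdens, (hNz x hx) by auto.
        assert (hi : 0 < / N) by now apply Rinv_0_lt_compat.
        unfold Rdiv at 3. rewrite ln_mult, ln_Rinv, RtoC_plus, RtoC_opp by auto.
        unfold gscale. fold N. field. auto.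
      * unfold Cdiv. rewrite Cmult_comm. apply cint_scal. apply cint_minus; auto. now apply cint_scal.
    + intros x hx. rewrite Cmod_mult, (Cmod_RtoC_nonneg (gdens m x)) by (left; now apply gdens_pos).
      eapply Rle_trans; [|apply Hw; auto]. apply Rmult_le_compat_r; [left; now apply gdens_pos|].
      apply Cpowc_weight; auto. now apply Rdiv_lt_0_compat.
Qed.

(** * The digamma function *)

Lemma cderiv_CGamma z : 0 < Re z -> cderiv CGamma z (C_derive CGamma z) /\
  cint (log_kernel z) (C_derive CGamma z).
Proof.
  intros hz. destruct (CGamma_deriv z hz) as [d [H1 H2]].
  assert (E : C_derive CGamma z = d) by now apply is_C_derive_unique. now rewrite E.
Qed.

Lemma CGamma'_succ z : 0 < Re z ->
  C_derive CGamma (z + 1) = (CGamma z + z * C_derive CGamma z)%C.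
Proof.
  intros hz. assert (hz1 : 0 < Re (z + 1)%C) by (rewrite re_plus, re_RtoC; lra).
  destruct (cderiv_CGamma z hz) as [H1 _]. destruct (cderiv_CGamma _ hz1) as [H2 _].
  apply cderiv_unique with (fun s => CGamma (s + 1)) z.
  - assert (Hs := @is_derive_plus C_AbsRing (AbsRing_NormedModule C_AbsRing)
      (fun s => s) (fun _ => RtoC 1) z _ _ (@is_derive_id C_AbsRing z)
      (@is_derive_const C_AbsRing (AbsRing_NormedModule C_AbsRing) (RtoC 1) z)).
    assert (H := @is_derive_comp C_AbsRing C_NormedModule CGamma (fun s : C => (s + 1)%C) z _ _ H2 Hs).
    unfold cderiv. replace (C_derive CGamma (z + 1)) with
      (@scal C_Ring C_ModuleSpace (RtoC 1 + RtoC 0)%C (C_derive CGamma (z + 1))); [exact H|].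
    change ((RtoC 1 + RtoC 0) * C_derive CGamma (z + 1) = C_derive CGamma (z + 1))%C. ring.
  - apply (@is_derive_ext_loc C_AbsRing C_NormedModule (fun s => s * CGamma s)%C).
    + exists (mkposreal (Re z) hz). intros y hy. symmetry. apply CGamma_succ.
      assert (h : Cmod (y - z)%C < Re z) by exact hy.
      assert (h2 := re_le_Cmod (y - z)). unfold Cminus in h2 at 1. rewrite re_plus, re_opp in h2.
      assert (h3 := Rabs_maj2 (Re y + - Re z)). lra.
    + eapply cderiv_eq; [apply (cderiv_mult (fun s => s) CGamma); [apply cderiv_id|exact H1]|]. ring.
Qed.

(** A zero at z would propagate to all z + n by the functional equation, whereas the quotient by
    [gscale] tends to 1. *)
Lemma CGamma_neq_0 z : 0 < Re z -> CGamma z <> 0.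
Proof.
  intros hz E.
  assert (Z : forall n, CGamma (z + RtoC (INR n)) = 0).
  { induction n.
    - simpl. now rewrite Cplus_0_r.
    - rewrite S_INR, RtoC_plus, Cplus_assoc, CGamma_succ, IHn; [ring|].
      now apply re_plus_INR_pos. }
  destruct (CGamma_asymptotics z hz) as [K HK].
  assert (HL : is_lim_seq (fun n => K * Rpower (INR n + 0) (- / 2)) 0).
  { apply lim0_scal. apply Rpower_neg_lim0. lra. }
  apply is_lim_seq_spec in HL. destruct (HL (mkposreal 1 Rlt_0_1)) as [n0 Hn0].
  set (n := (n0 + 2)%nat). specialize (Hn0 (S n) ltac:(unfold n; lia)). simpl pos in Hn0.
  rewrite Rminus_0_r, Rplus_0_r in Hn0.
  assert (hn := re_plus_INR_pos z (S n) hz).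
  destruct (HK n _ ltac:(unfold n; lia) (proj2 (cderiv_CGamma _ hn))) as [H _].
  rewrite Z in H. replace (0 / gscale z n - 1)%C with (- (1))%C in H by (field; apply gscale_neq_0).
  rewrite Cmod_opp, Cmod_1 in H. apply Rabs_def2 in Hn0. lra.
Qed.

Lemma digamma_succ z : 0 < Re z -> digamma (z + 1) = (digamma z + / z)%C.
Proof.
  intros hz. unfold digamma. rewrite CGamma'_succ, CGamma_succ by auto.
  assert (h1 := CGamma_neq_0 z hz). assert (h2 := re_pos_neq_0 z hz). field. auto.
Qed.

Lemma digamma_hpt z n : 0 < Re z -> digamma (hpt z n) = (digamma z + csum (fun k => / hpt z k) n)%C.
Proof.
  intros hz. induction n.
  - unfold hpt. simpl. rewrite Cplus_0_l. ring.
  - rewrite hpt_S, digamma_succ, IHn by now apply re_hpt_pos. simpl. ring.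
Qed.

(** By the recurrence, psi(z+N) is psi(z) plus the finite sum of 1/(z+k); and psi(z+N) - ln N is the
    quotient of the two expressions in [CGamma_asymptotics], which tend to 0 and 1. *)
Theorem digamma_limit z : 0 < Re z ->
  clim (fun n => RtoC (ln (INR (S n))) - csum (fun k => / hpt z k) (S n))%C (digamma z).
Proof.
  intros hz. destruct (CGamma_asymptotics z hz) as [K HK].
  assert (HL : is_lim_seq (fun n => K * Rpower (INR (S n) + 0) (- / 2)) 0).
  { apply lim0_scal. apply (is_lim_seq_incr_1 (fun n => Rpower (INR n + 0) (- / 2))).
    apply Rpower_neg_lim0. lra. }
  assert (HA := HL). apply is_lim_seq_spec in HA.
  destruct (HA (mkposreal (/ 2) ltac:(lra))) as [n0 Hn0]. simpl pos in Hn0.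
  apply clim_spec. intros eps he. apply is_lim_seq_spec in HL.
  destruct (HL (mkposreal (eps / 2) ltac:(lra))) as [n1 Hn1]. simpl pos in Hn1.
  exists (n0 + n1 + 2)%nat. intros n hn.
  assert (hre := re_plus_INR_pos z (S n) hz).
  destruct (HK n _ ltac:(lia) (proj2 (cderiv_CGamma _ hre))) as [H1 H2].
  specialize (Hn0 n ltac:(lia)). specialize (Hn1 n ltac:(lia)).
  rewrite Rminus_0_r, Rplus_0_r in Hn0, Hn1. apply Rabs_def2 in Hn0. apply Rabs_def2 in Hn1.
  set (G := CGamma (z + RtoC (INR (S n)))) in *. set (G' := C_derive CGamma (z + RtoC (INR (S n)))) in *.
  assert (hG : G <> 0) by now apply CGamma_neq_0.
  assert (hs := gscale_neq_0 z n).
  (* The denominator is within 1/2 of 1, so the numerator only needs to be below eps/2. *)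
  assert (Ha : / 2 <= Cmod (G / gscale z n)%C).
  { assert (h := Cmod_triangle (G / gscale z n) (- (G / gscale z n - 1))).
    replace (G / gscale z n + - (G / gscale z n - 1))%C with (RtoC 1) in h by ring.
    rewrite Cmod_1, Cmod_opp in h. lra. }
  replace (RtoC (ln (INR (S n))) - csum (fun k => / hpt z k) (S n) - digamma z)%C with
    (- (((G' - RtoC (ln (INR (S n))) * G) / gscale z n) / (G / gscale z n)))%C.
  - rewrite Cmod_opp, Cmod_div.
    + apply Rlt_div_l; [lra|]. nra.
    + intros E. rewrite E, Cmod_0 in Ha. lra.
  - assert (E := digamma_hpt z (S n) hz). unfold hpt in E at 1. unfold digamma in E at 1.
    rewrite (Cplus_comm (RtoC (INR (S n))) z) in E. fold G G' in E.
    replace (csum (fun k => / hpt z k)%C (S n)) with (G' / G - digamma z)%C by (rewrite E; ring).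
    field. auto.
Qed.

(** * The approximants of zeta' and their Appell property *)

(** The s-derivative of [emq], by the product rule; [demt] is that of [emt]. *)
Fixpoint demq (j : nat) (s : C) : C :=
  match j with
  | O => (- / ((s - 1) * (s - 1)))%C
  | S O => 0
  | S (S i as k) => (- emq k s - (s + RtoC (INR i)) * demq k s)%C
  end.

Definition demt (j : nat) (s w : C) : C :=
  ((demq j s - emq j s * Clog w) * Cpowc w (1 - s - RtoC (INR j)))%C.

Lemma cderiv_Cpowc w c s : cderiv (fun s => Cpowc w (c - s)) s (- Clog w * Cpowc w (c - s))%C.
Proof.
  assert (H := Cexp_pseries (- Clog w) s 1).
  apply has_pseries_cderiv in H; [|lra].
  apply cderiv_ext with (fun s => Cpowc w c * Cexp (- Clog w * s))%C.
  { intros z. unfold Cminus. rewrite Cpowc_plus. f_equal. unfold Cpowc. f_equal. ring. }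
  eapply cderiv_eq; [apply cderiv_mult; [apply cderiv_const|exact H]|]. cbv beta.
  simpl fact. simpl INR. rewrite Rinv_1. simpl Cpow. unfold Cminus. rewrite Cpowc_plus.
  replace (Cpowc w (- s)) with (Cexp (- Clog w * s)) by (unfold Cpowc; f_equal; ring). ring.
Qed.

Lemma cderiv_inv_linear (s : C) : s <> 1 ->
  cderiv (fun z => / (z - 1))%C s (- / ((s - 1) * (s - 1)))%C.
Proof.
  intros hs. assert (hn := Cminus_eq_contra _ _ hs). assert (h0 : 0 < Cmod (s - 1)) by now apply Cmod_gt_0.
  apply cderiv_spec. intros eps he.
  set (m := Cmod (s - 1)) in *.
  (* The error equals h^2 / ((s+h-1)(s-1)^2), which is at most 2 |h|^2 / m^3 when |h| <= m/2. *)
  exists (Rmin (m / 2) (eps * (m * m * m) / 2)). split.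
  { apply Rmin_pos; [lra|]. assert (0 < m * m * m) by (repeat apply Rmult_lt_0_compat; auto).
    assert (0 < eps * (m * m * m)) by now apply Rmult_lt_0_compat. lra. }
  intros h hh. assert (h1 := Rmin_l (m / 2) (eps * (m * m * m) / 2)).
  assert (h2 := Rmin_r (m / 2) (eps * (m * m * m) / 2)).
  assert (hm : m / 2 <= Cmod (s + h - 1)).
  { assert (ht := Cmod_triangle (s + h - 1) (- h)).
    replace (s + h - 1 + - h)%C with (s - 1)%C in ht by ring. fold m in ht. rewrite Cmod_opp in ht. lra. }
  assert (hn2 : (s + h - 1)%C <> 0) by (apply Cmod_gt_0; lra).
  replace (/ (s + h - 1) - / (s - 1) - h * - / ((s - 1) * (s - 1)))%C
    with (h * (h / ((s + h - 1) * ((s - 1) * (s - 1)))))%C by (field; auto).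
  rewrite Cmod_mult, Rmult_comm. apply Rmult_le_compat_r; [apply Cmod_ge_0|].
  rewrite Cmod_div, !Cmod_mult by (repeat apply Cmult_neq_0; auto). fold m.
  assert (hmm : 0 < m * m) by now apply Rmult_lt_0_compat.
  apply (proj2 (Rle_div_l _ _ _ (Rmult_lt_0_compat _ _ (Rlt_le_trans _ _ _ (Rdiv_lt_0_compat _ _ h0 Rlt_0_2) hm) hmm))).
  apply Rle_trans with (eps * (m / 2 * (m * m))); [lra|].
  apply Rmult_le_compat_l; [lra|]. apply Rmult_le_compat_r; lra.
Qed.

Lemma cderiv_emq j (s : C) : s <> 1 -> cderiv (emq j) s (demq j s).
Proof.
  intros hs. destruct j as [|j]; [now apply cderiv_inv_linear|].
  induction j as [|j IH]; [apply (cderiv_const (-1)%C)|].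
  apply (cderiv_ext (fun s => (0 - s - RtoC (INR j)) * emq (S j) s)%C).
  { intros z. change (emq (S (S j)) z) with (- (z + RtoC (INR j)) * emq (S j) z)%C. ring. }
  eapply cderiv_eq.
  - apply cderiv_mult; [|exact IH]. apply cderiv_minus; [|apply cderiv_const].
    apply cderiv_minus; [apply cderiv_const|apply cderiv_id].
  - cbv beta. change (demq (S (S j)) s) with (- emq (S j) s - (s + RtoC (INR j)) * demq (S j) s)%C. ring.
Qed.

Lemma cderiv_emt j (s w : C) : s <> 1 -> cderiv (fun s => emt j s w) s (demt j s w).
Proof.
  intros hs. apply cderiv_ext with (fun s => emq j s * Cpowc w (1 - RtoC (INR j) - s))%C.
  { intros z. unfold emt. do 2 f_equal. ring. }
  eapply cderiv_eq; [apply cderiv_mult; [now apply cderiv_emq|apply cderiv_Cpowc]|].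
  cbv beta. unfold demt. replace (1 - s - RtoC (INR j))%C with (1 - RtoC (INR j) - s)%C by ring. ring.
Qed.

Definition em_dapprox (M : nat) (s a : C) (N : nat) : C :=
  (csum (fun n => - Clog (hpt a n) * Cpowc (hpt a n) (- s)) N
   + csum (fun j => RtoC (bern j) * demt j s (hpt a N)) (S M))%C.

Lemma cderiv_csum (f : nat -> C -> C) d z n :
  (forall k, (k < n)%nat -> cderiv (f k) z (d k)) ->
  cderiv (fun s => csum (fun k => f k s) n) z (csum d n).
Proof.
  induction n; intros H; simpl; [apply cderiv_const|]. apply cderiv_plus; auto.
Qed.

Lemma cderiv_em_approx M (s a : C) N : s <> 1 ->
  cderiv (fun s => em_approx M s a N) s (em_dapprox M s a N).
Proof.
  intros hs. unfold em_approx, em_dapprox. apply cderiv_plus.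
  - apply (cderiv_csum (fun n s => Cpowc (hpt a n) (- s))). intros n _.
    apply cderiv_ext with (fun s => Cpowc (hpt a n) (0 - s)); [intros; f_equal; ring|].
    eapply cderiv_eq; [apply cderiv_Cpowc|]. do 2 f_equal. ring.
  - apply (cderiv_csum (fun j s => RtoC (bern j) * emt j s (hpt a N))%C). intros j _.
    eapply cderiv_eq; [apply cderiv_mult; [apply cderiv_const|now apply cderiv_emt]|].
    cbv beta. ring.
Qed.

Lemma demq_S j (s : C) : s <> 1 -> demq (S j) s = (demq j s * (1 - s - RtoC (INR j)) - emq j s)%C.
Proof.
  intros hs. assert (hn := Cminus_eq_contra _ _ hs). destruct j.
  - simpl. field. auto.
  - change (demq (S (S j)) s) with (- emq (S j) s - (s + RtoC (INR j)) * demq (S j) s)%C.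
    rewrite S_INR, RtoC_plus. ring.
Qed.

Lemma pderiv_demt j (s : C) f x d : s <> 1 -> 0 < Re (f x) -> pderiv f x d ->
  pderiv (fun y => demt j s (f y)) x (demt (S j) s (f x) * d)%C.
Proof.
  intros hs h H. unfold demt. eapply pderiv_eq.
  - apply pderiv_mult.
    + apply pderiv_minus; [apply pderiv_const|]. apply pderiv_scal. apply pderiv_Clog; eauto.
    + apply pderiv_Cpowc; eauto.
  - cbv beta. rewrite demq_S, emq_S, S_INR, RtoC_plus by auto.
    replace (Cpowc (f x) (1 - s - RtoC (INR j))) with
      (Cpowc (f x) (1 - s - RtoC (INR j) - 1) * f x)%C.
    + replace (1 - s - (INR j + 1))%C with (1 - s - RtoC (INR j) - 1)%C by ring.
      field. now apply re_pos_neq_0.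
    + rewrite <- (Cpowc_1 (f x) h) at 2. rewrite <- Cpowc_plus. f_equal. ring.
Qed.

(** The correction terms obey the rule d/da zeta(s,a) = -s zeta(s+1,a) one by one; at s = 0 it fails
    because [emq 0 (s + 1)] is 1/s. *)
Lemma emq_shift j (s : C) : s <> 0 -> emq (S j) s = (- s * emq j (s + 1))%C.
Proof.
  intros hs. destruct j as [|j].
  { simpl. replace (s + 1 - 1)%C with s by ring. field. auto. }
  induction j as [|j IH].
  - simpl. ring.
  - change (emq (S (S (S j))) s) with (- (s + RtoC (INR (S j))) * emq (S (S j)) s)%C.
    change (emq (S (S j)) (s + 1)) with (- (s + 1 + RtoC (INR j)) * emq (S j) (s + 1))%C.
    rewrite IH, S_INR, RtoC_plus. ring.
Qed.

Lemma demq_shift j (s : C) : s <> 0 -> demq (S j) s = (- emq j (s + 1) - s * demq j (s + 1))%C.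
Proof.
  intros hs. destruct j as [|j].
  - simpl. replace (s + 1 - 1)%C with s by ring. field. auto.
  - induction j as [|j IH].
    + simpl. ring.
    + change (demq (S (S (S j))) s) with
        (- emq (S (S j)) s - (s + RtoC (INR (S j))) * demq (S (S j)) s)%C.
      change (demq (S (S j)) (s + 1)) with
        (- emq (S j) (s + 1) - (s + 1 + RtoC (INR j)) * demq (S j) (s + 1))%C.
      rewrite IH, emq_shift by auto.
      change (emq (S (S j)) (s + 1)) with (- (s + 1 + RtoC (INR j)) * emq (S j) (s + 1))%C.
      rewrite S_INR, RtoC_plus. ring.
Qed.

Lemma emt_shift j (s w : C) : s <> 0 -> emt (S j) s w = (- s * emt j (s + 1) w)%C.
Proof.
  intros hs. unfold emt. rewrite emq_shift, S_INR, RtoC_plus by auto.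
  replace (1 - s - (INR j + 1))%C with (1 - (s + 1) - RtoC (INR j))%C by ring. ring.
Qed.

Lemma demt_shift j (s w : C) : s <> 0 ->
  demt (S j) s w = (- emt j (s + 1) w - s * demt j (s + 1) w)%C.
Proof.
  intros hs. unfold demt, emt. rewrite demq_shift, emq_shift, S_INR, RtoC_plus by auto.
  replace (1 - s - (INR j + 1))%C with (1 - (s + 1) - RtoC (INR j))%C by ring. ring.
Qed.

Lemma pderiv_hpt A y d n : pderiv A y d -> pderiv (fun x => hpt (A x) n) y d.
Proof.
  intros H. eapply pderiv_eq; [apply pderiv_plus; [apply pderiv_const|exact H]|]. ring.
Qed.

Lemma pderiv_em_approx M (s : C) A y d N : s <> 1 -> 0 < Re (A y) -> pderiv A y d ->
  pderiv (fun x => em_approx M s (A x) N) y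
    ((csum (fun n => - s * Cpowc (hpt (A y) n) (- (s + 1))) N
      + csum (fun j => RtoC (bern j) * emt (S j) s (hpt (A y) N)) (S M)) * d)%C.
Proof.
  intros hs h H. unfold em_approx. eapply pderiv_eq.
  - apply pderiv_plus.
    + apply (pderiv_csum (fun n x => Cpowc (hpt (A x) n) (- s))). intros n _.
      apply pderiv_Cpowc; [now apply re_hpt_pos|apply pderiv_hpt; exact H].
    + apply (pderiv_csum (fun j x => RtoC (bern j) * emt j s (hpt (A x) N))%C). intros j _.
      apply pderiv_scal. apply pderiv_emt; auto; [now apply re_hpt_pos|apply pderiv_hpt; exact H].
  - rewrite Cmult_plus_distr_r, !(Cmult_comm (csum _ _) d), <- !csum_scal. f_equal; apply csum_ext; intros.
    + replace (- s - 1)%C with (- (s + 1))%C by ring. ring.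
    + ring.
Qed.

Lemma pderiv_em_dapprox M (s : C) A y d N : s <> 1 -> 0 < Re (A y) -> pderiv A y d ->
  pderiv (fun x => em_dapprox M s (A x) N) y
    ((csum (fun n => - Cpowc (hpt (A y) n) (- (s + 1))
                     - s * (- Clog (hpt (A y) n) * Cpowc (hpt (A y) n) (- (s + 1)))) N
      + csum (fun j => RtoC (bern j) * demt (S j) s (hpt (A y) N)) (S M)) * d)%C.
Proof.
  intros hs h H. unfold em_dapprox. eapply pderiv_eq.
  - apply pderiv_plus.
    + apply (pderiv_csum (fun n x => - Clog (hpt (A x) n) * Cpowc (hpt (A x) n) (- s))%C). intros n _.
      apply pderiv_mult.
      * apply pderiv_opp. apply pderiv_Clog; [now apply re_hpt_pos|apply pderiv_hpt; exact H].
      * apply pderiv_Cpowc; [now apply re_hpt_pos|apply pderiv_hpt; exact H].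
    + apply (pderiv_csum (fun j x => RtoC (bern j) * demt j s (hpt (A x) N))%C). intros j _.
      apply pderiv_scal. apply pderiv_demt; auto; [now apply re_hpt_pos|apply pderiv_hpt; exact H].
  - rewrite Cmult_plus_distr_r, !(Cmult_comm (csum _ _) d), <- !csum_scal. f_equal; apply csum_ext; intros.
    + assert (hp := re_hpt_pos (A y) k h).
      replace (Cpowc (hpt (A y) k) (- s)) with (Cpowc (hpt (A y) k) (- (s + 1)) * hpt (A y) k)%C.
      * replace (- s - 1)%C with (- (s + 1))%C by ring. field. now apply re_pos_neq_0.
      * rewrite <- (Cpowc_1 (hpt (A y) k) hp) at 2. rewrite <- Cpowc_plus. f_equal. ring.
    + ring.
Qed.

Definition znat (k : nat) : C := (- RtoC (INR k))%C.

Lemma znat_S k : (znat (S k) + 1)%C = znat k.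
Proof. unfold znat. rewrite S_INR, RtoC_plus. ring. Qed.

Lemma znat_neq_1 k : znat k <> 1.
Proof.
  unfold znat. rewrite <- RtoC_opp. intros E. apply RtoC_inj in E. assert (h := pos_INR k). lra.
Qed.

Lemma znat_S_neq_0 k : znat (S k) <> 0.
Proof.
  unfold znat. rewrite <- RtoC_opp. intros E. apply RtoC_inj in E. rewrite S_INR in E.
  assert (h := pos_INR k). lra.
Qed.

Lemma digamma_INR_S k : digamma (RtoC (INR (S k)) + 1) = (digamma (RtoC (INR k) + 1) + / RtoC (INR (S k)))%C.
Proof.
  rewrite digamma_succ by (rewrite re_RtoC; apply lt_0_INR; lia).
  now rewrite S_INR, RtoC_plus at 1.
Qed.

Definition gapprox (M k N : nat) (a : C) : C :=
  (em_dapprox M (znat k) a N + digamma (RtoC (INR k) + 1) * em_approx M (znat k) a N)%C.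

(** Write Z for the approximant at -k. Differentiating -s zeta(s+1,a) in s at s = -(k+1) gives (k+1)
    Z' - Z, and the digamma term gives (k+1) psi(k+2) Z. As psi(k+2) = psi(k+1) + 1/(k+1), the stray
    -Z is absorbed: this is the purpose of the digamma factor in g. *)
Lemma pderiv_gapprox_S M k N A y d : 0 < Re (A y) -> pderiv A y d ->
  pderiv (fun x => gapprox M (S k) N (A x)) y (RtoC (INR (S k)) * gapprox M k N (A y) * d)%C.
Proof.
  intros h H. unfold gapprox. assert (h1 := znat_neq_1 (S k)). assert (h0 := znat_S_neq_0 k).
  eapply pderiv_eq.
  - apply pderiv_plus; [apply pderiv_em_dapprox; eauto|].
    apply pderiv_scal. apply pderiv_em_approx; eauto.
  - rewrite znat_S. rewrite csum_minus, !csum_scal.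
    rewrite (csum_ext (fun n => - Cpowc (hpt (A y) n) (- znat k))%C
      (fun n => (-1) * Cpowc (hpt (A y) n) (- znat k))%C) by (intros; ring).
    rewrite (csum_ext (fun j => RtoC (bern j) * demt (S j) (znat (S k)) (hpt (A y) N))%C
      (fun j => (-1) * (RtoC (bern j) * emt j (znat k) (hpt (A y) N))
         - znat (S k) * (RtoC (bern j) * demt j (znat k) (hpt (A y) N)))%C).
    2:{ intros j _. rewrite demt_shift, znat_S by auto. ring. }
    rewrite (csum_ext (fun j => RtoC (bern j) * emt (S j) (znat (S k)) (hpt (A y) N))%C
      (fun j => - znat (S k) * (RtoC (bern j) * emt j (znat k) (hpt (A y) N)))%C).
    2:{ intros j _. rewrite emt_shift, znat_S by auto. ring. }
    rewrite csum_minus, !csum_scal, digamma_INR_S. unfold em_dapprox, em_approx.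
    replace (znat (S k)) with (- RtoC (INR (S k)))%C by reflexivity.
    assert (hk : RtoC (INR (S k)) <> 0).
    { intros E. apply RtoC_inj in E. now apply not_0_INR in E. }
    set (S1 := csum _ N). set (S2 := csum _ N). set (S3 := csum _ (S M)). set (S4 := csum _ (S M)).
    field. exact hk.
Qed.

(** The truncated asymptotic expansion of psi(w): ln w - 1/(2w) - 1/(12 w^2) - ... *)
Definition em_log (M : nat) (w : C) : C := csum (fun j => RtoC (bern j) * demt (S j) 0 w)%C (S M).

Definition chi (M N : nat) (a : C) : C :=
  (em_log M (hpt a N) - csum (fun n => / hpt a n) N + euler_gamma)%C.

Lemma emq_SS_0 j : emq (S (S j)) 0 = 0.
Proof.
  induction j as [|j IH]; [simpl; ring|].
  change (emq (S (S (S j))) 0) with (- (0 + RtoC (INR (S j))) * emq (S (S j)) 0)%C. rewrite IH. ring.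
Qed.

Lemma demt_1_0 w : demt 1 0 w = Clog w.
Proof.
  unfold demt. replace (1 - 0 - RtoC (INR 1))%C with (RtoC 0) by (simpl; ring).
  rewrite Cpowc_0. simpl. ring.
Qed.

Lemma demt_SS_0 j w : demt (S (S j)) 0 w = (demq (S (S j)) 0 * Cpowc w (- RtoC (INR (S j))))%C.
Proof.
  unfold demt. rewrite emq_SS_0, (S_INR (S j)), RtoC_plus.
  replace (1 - 0 - (INR (S j) + 1))%C with (- RtoC (INR (S j)))%C by ring. ring.
Qed.

(** The shift rule breaks down at s = 0, so the derivative is computed directly. That of the
    approximant itself is the constant -1 (only j = 0 survives), and multiplied by psi(1) it yields
    Euler's constant. *)
Lemma pderiv_gapprox_0 M N A y d : 0 < Re (A y) -> pderiv A y d ->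
  pderiv (fun x => gapprox M 0 N (A x)) y (chi M N (A y) * d)%C.
Proof.
  intros h H. unfold gapprox. assert (E0 : znat 0 = 0) by (unfold znat; simpl; ring).
  rewrite E0. assert (h1 : RtoC 0 <> 1) by (intros E; apply RtoC_inj in E; lra).
  eapply pderiv_eq.
  - apply pderiv_plus; [apply pderiv_em_dapprox; eauto|].
    apply pderiv_scal. apply pderiv_em_approx; eauto.
  - assert (E1 : csum (fun j => RtoC (bern j) * emt (S j) 0 (hpt (A y) N))%C (S M) = (-1)%C).
    { rewrite (csum_single _ (S M) 0); [|lia|].
      - rewrite emt_1. replace (- 0)%C with (RtoC 0) by ring. rewrite Cpowc_0.
        unfold bern. simpl. ring.
      - intros j _ hj. destruct j; [lia|]. unfold emt. rewrite emq_SS_0. ring. }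
    rewrite E1. fold (em_log M (hpt (A y) N)).
    rewrite (csum_ext (fun n => - Cpowc (hpt (A y) n) (- (0 + 1)) - _)%C (fun n => (-1) * / hpt (A y) n)%C).
    2:{ intros n _. replace (- (0 + 1))%C with (- (1))%C by ring.
        rewrite Cpowc_opp, Cpowc_1 by now apply re_hpt_pos. ring. }
    rewrite (csum_0 (fun n => - 0 * _)%C) by (intros; ring).
    rewrite csum_scal. unfold chi, euler_gamma. simpl (INR 0).
    replace (0 + 1)%C with (RtoC 1) by ring. ring.
Qed.

Lemma clim_gapprox M k a : 0 < Re a -> 1 + INR k < INR M -> clim (fun N => gapprox M k N a) (g k a).
Proof.
  intros ha hM. unfold gapprox, g. assert (hk := pos_INR k).
  assert (E : znat k = RtoC (- INR k)) by (unfold znat; now rewrite RtoC_opp).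
  fold (znat k). rewrite E. apply clim_plus.
  - apply (hurwitz_zeta'_clim a (- INR k) M); auto; try lra.
    intros N. apply cderiv_em_approx. rewrite <- E. apply znat_neq_1.
  - apply clim_scal. apply hurwitz_zeta_clim; auto; lra.
Qed.

(** Beyond the sequence of [digamma_limit] there remain Clog(N + a) - ln N, which is O(|a|/N) by the
    mean value inequality from N to N + a, and negative powers of w_N. *)
Lemma clim_chi M a : 0 < Re a -> clim (fun N => chi M N a) (digamma a + euler_gamma)%C.
Proof.
  intros ha. unfold chi. apply clim_plus; [|apply clim_const].
  apply clim_decr.
  apply clim_ext with (fun N => (RtoC (ln (INR (S N))) - csum (fun n => / hpt a n) (S N)) +
    ((Clog (hpt a (S N)) - RtoC (ln (INR (S N)))) +
     csum (fun j => RtoC (bern (S j)) * demt (S (S j)) 0 (hpt a (S N))) M))%C.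
  { intros N. unfold em_log. rewrite (csum_first (fun j => RtoC (bern j) * _)%C), demt_1_0.
    replace (bern 0) with 1 by reflexivity. ring. }
  replace (digamma a) with (digamma a + (0 + csum (fun j => RtoC (bern (S j)) * (demq (S (S j)) 0 * 0)) M))%C.
  2:{ rewrite csum_0 by (intros; ring). ring. }
  apply clim_plus; [now apply digamma_limit|]. apply clim_plus.
  - apply (clim_squeeze _ _ (fun N => 2 * Cmod a * / INR (S N))).
    + intros N. assert (hN : 0 < INR (S N)) by (apply lt_0_INR; lia).
      replace (Clog (hpt a (S N)) - RtoC (ln (INR (S N))) - 0)%C with
        (Clog (RtoC (INR (S N)) + RtoC 1 * a) - Clog (RtoC (INR (S N)) + RtoC 0 * a))%C.
      * assert (hre : forall y, 0 <= y <= 1 -> 0 < Re (RtoC (INR (S N)) + RtoC y * a)%C).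
        { intros y hy. rewrite re_plus, re_scal_l, re_RtoC. nra. }
        rewrite Rmult_assoc.
        apply (pderiv_mvt (fun y => Clog (RtoC (INR (S N)) + RtoC y * a))
          (fun y => a / (RtoC (INR (S N)) + RtoC y * a))%C).
        -- intros y hy. apply pderiv_Clog; [now apply hre|apply pderiv_affine].
        -- intros y hy. rewrite Cmod_div by (apply re_pos_neq_0; auto).
           apply Rmult_le_compat_l; [apply Cmod_ge_0|]. apply Rinv_le_contravar; auto.
           eapply Rle_trans; [|apply re_le_mod]. rewrite re_plus, re_scal_l, re_RtoC. nra.
      * replace (RtoC (INR (S N)) + 0 * a)%C with (RtoC (INR (S N))) by ring.
        rewrite (Clog_RtoC (INR (S N))) by auto.
        replace (RtoC (INR (S N)) + 1 * a)%C with (hpt a (S N)) by (unfold hpt; ring). ring.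
    + apply lim0_scal. assert (H := is_lim_seq_inv _ _ is_lim_seq_INR ltac:(discriminate)).
      exact (proj1 (is_lim_seq_incr_1 _ _) H).
  - apply (clim_csum (fun j N => RtoC (bern (S j)) * demt (S (S j)) 0 (hpt a (S N)))%C). intros j _.
    apply clim_scal. apply clim_ext with
      (fun N => demq (S (S j)) 0 * Cpowc (hpt a (S N)) (- RtoC (INR (S j))))%C.
    + intros N. now rewrite demt_SS_0.
    + apply clim_scal. apply (clim_incr (fun N => Cpowc (hpt a N) (- RtoC (INR (S j))))).
      apply Cpowc_hpt_lim0; auto. rewrite re_opp, re_RtoC. assert (h : 0 < INR (S j)) by (apply lt_0_INR; lia). lra.
Qed.

(** * Appell sums *)

Lemma binomial_succ q k : (k < q)%nat ->
  Binomial.C q (S k) * INR (S k) = Binomial.C q k * INR (q - k).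
Proof.
  intros h. unfold Binomial.C. replace (q - k)%nat with (S (q - S k)) by lia.
  rewrite (fact_simpl k), (fact_simpl (q - S k)), !mult_INR.
  assert (h1 := INR_fact_neq_0 k). assert (h2 := INR_fact_neq_0 (q - S k)).
  assert (h3 : INR (S k) <> 0) by (apply not_0_INR; lia).
  assert (h4 : INR (S (q - S k)) <> 0) by (apply not_0_INR; lia).
  field. auto.
Qed.

Lemma binomial_0 q : Binomial.C q 0 = 1.
Proof. unfold Binomial.C. rewrite Nat.sub_0_r. simpl. field. apply INR_fact_neq_0. Qed.

Lemma binomial_diag q : Binomial.C q q = 1.
Proof. unfold Binomial.C. rewrite Nat.sub_diag. simpl. field. apply INR_fact_neq_0. Qed.

(** By C(q,k+1) (k+1) = C(q,k) (q-k), the derivative of the k-th summand is [U (S k) - U k], apart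
    from the contribution of G_0' at k = 0. The sum telescopes, both end values of U vanish, and
    that contribution remains. *)
Lemma pderiv_appell_sum (G : nat -> R -> C) (c t : C) y q :
  (forall k, pderiv (G (S k)) y (RtoC (INR (S k)) * G k y * (- t))%C) ->
  pderiv (G O) y (c * (- t))%C ->
  pderiv (fun x => csum (fun k => RtoC (Binomial.C q k) * G k x * (RtoC x * t) ^ (q - k)) (S q))%C y
    (- t * (RtoC y * t) ^ q * c)%C.
Proof.
  intros HS H0. set (tau := (RtoC y * t)%C).
  set (U := fun k => match k with O => RtoC 0 | S i =>
    (RtoC (Binomial.C q i) * G i y * (RtoC (INR (q - i)) * tau ^ (q - i - 1) * t))%C end).
  assert (Ht : pderiv (fun x => RtoC x * t)%C y t).
  { apply pderiv_ext with (fun x => 0 + RtoC x * t)%C; [intros; ring|apply pderiv_affine]. }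
  set (dG := fun k => match k with O => (c * (- t))%C | S i => (RtoC (INR (S i)) * G i y * (- t))%C end).
  eapply pderiv_eq.
  - apply (pderiv_csum (fun k x => RtoC (Binomial.C q k) * G k x * (RtoC x * t) ^ (q - k))%C
      (fun k => (RtoC (Binomial.C q k) * dG k) * (RtoC y * t) ^ (q - k) + RtoC (Binomial.C q k) * G k y *
        (RtoC (INR (q - k)) * (RtoC y * t) ^ (q - k - 1) * t))%C). intros k _.
    apply (pderiv_mult (fun x => RtoC (Binomial.C q k) * G k x)%C (fun x => (RtoC x * t) ^ (q - k))%C).
    + apply pderiv_scal. destruct k; [exact H0|apply HS].
    + apply (pderiv_pow (fun x => RtoC x * t)%C). exact Ht.
  - cbv beta. fold tau.
    rewrite (csum_ext _ (fun k => (if Nat.eqb k 0 then - t * tau ^ q * c else 0) + (U (S k) - U k))%C).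
    + rewrite csum_plus, csum_telescope. rewrite (csum_single _ (S q) 0); [|lia|].
      * cbn [Nat.eqb U]. rewrite Nat.sub_diag. simpl INR. ring.
      * intros i _ hi. now rewrite (proj2 (Nat.eqb_neq i 0)).
    + intros k hk. destruct k as [|k].
      * cbn [Nat.eqb U dG]. rewrite binomial_0, Nat.sub_0_r. ring.
      * cbn [Nat.eqb]. cbn [U dG]. assert (hb := binomial_succ q k ltac:(lia)).
        replace (q - k - 1)%nat with (q - S k)%nat by lia.
        assert (hb' : (RtoC (Binomial.C q (S k)) * RtoC (INR (S k)) = RtoC (Binomial.C q k) * RtoC (INR (q - k)))%C).
        { rewrite <- !RtoC_mult. now f_equal. }
        replace (RtoC (Binomial.C q (S k)) * (RtoC (INR (S k)) * G k y * - t))%C with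
          (- t * G k y * (RtoC (Binomial.C q (S k)) * RtoC (INR (S k))))%C by ring.
        rewrite hb'. ring.
Qed.

(** The sum starts at w^(-2). The term 1/w, whose sum over w = w_n diverges, is separated; the term
    with psi(a) + gamma stands in its place in the theorem. *)
Lemma geom_resolvent (w tau : C) L : w <> 0 -> (w - tau)%C <> 0 ->
  csum (fun m => (/ w) ^ S (S m) * tau ^ S m)%C L =
  (/ (w - tau) - / w - (tau / w) ^ S L / (w - tau))%C.
Proof.
  intros h1 h2. induction L as [|L IH].
  - simpl. field. auto.
  - cbn [csum]. rewrite IH.
    assert (E : ((/ w) ^ S (S L) * tau ^ S L)%C = (/ w * (tau / w) ^ S L)%C).
    { rewrite (Cpow_S (/ w) (S L)). unfold Cdiv. rewrite Cpow_mult_l. ring. }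
    rewrite E, (Cpow_S (tau / w) (S L)). field. auto.
Qed.

Lemma clim_le_eventually u l (e : nat -> R) K :
  clim u l -> (forall n, Cmod (u n) <= e n + K) -> is_lim_seq e 0 -> Cmod l <= K.
Proof.
  intros Hu Hb He. apply le_epsilon. intros eps heps.
  apply clim_spec with (eps := eps / 2) in Hu; [|lra]. destruct Hu as [n0 Hn0].
  apply is_lim_seq_spec in He. destruct (He (mkposreal (eps / 2) ltac:(lra))) as [n1 Hn1].
  specialize (Hn0 (n0 + n1)%nat ltac:(lia)). specialize (Hn1 (n0 + n1)%nat ltac:(lia)).
  specialize (Hb (n0 + n1)%nat). simpl in Hn1. rewrite Rminus_0_r in Hn1. apply Rabs_def2 in Hn1.
  set (v := u (n0 + n1)%nat) in *. replace l with (v + - (v - l))%C by ring.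
  eapply Rle_trans; [apply Cmod_triangle|]. rewrite Cmod_opp. lra.
Qed.

Lemma lim0_rsum (u : nat -> nat -> R) m :
  (forall j, is_lim_seq (u j) 0) -> is_lim_seq (fun n => rsum (fun j => u j n) m) 0.
Proof.
  intros H. induction m; simpl; [apply is_lim_seq_const|]. now apply lim0_plus.
Qed.

(** * Integration along the segment from a to a - t *)

Definition ray (a t : C) (y : R) : C := (a + RtoC y * (- t))%C.

Lemma re_ray_ge a t y : 0 <= y <= 1 -> Re a - Cmod t <= Re (ray a t y).
Proof.
  intros hy. unfold ray. rewrite re_plus, re_scal_l, re_opp.
  assert (h := re_le_mod t). assert (h0 := Cmod_ge_0 t). nra.
Qed.

(** Each logarithm grows like ln N, but the w-derivative of [em_log] consists of powers w^(-1),
    w^(-2), ..., which tend to 0 uniformly on the segment since Re w_N >= N + Re a - |t| there. *)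
Lemma em_log_variation a t M : Cmod t < Re a -> exists e, is_lim_seq e 0 /\ forall N y, 0 <= y <= 1 ->
  Cmod (em_log M (hpt (ray a t y) N) - em_log M (hpt a N))%C <= e N.
Proof.
  intros ht. set (beta := Re a - Cmod t).
  exists (fun N => 2 * rsum (fun j => Cmod (RtoC (bern j) * demq (S (S j)) 0) * Cmod t
    * Rpower (INR N + beta) (- INR (S j))) (S M)). split.
  - apply lim0_scal. apply (lim0_rsum (fun j N => Cmod (RtoC (bern j) * demq (S (S j)) 0) * Cmod t
      * Rpower (INR N + beta) (- INR (S j)))).
    intros j. apply lim0_scal. apply Rpower_neg_lim0. apply lt_0_INR. lia.
  - intros N y hy. replace (hpt a N) with (hpt (ray a t (y * 0)) N)
      by (unfold hpt, ray; rewrite Rmult_0_r; ring).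
    replace (hpt (ray a t y) N) with (hpt (ray a t (y * 1)) N) by (now rewrite Rmult_1_r).
    assert (hyy : forall x, 0 <= x <= 1 -> 0 <= y * x <= 1) by (intros; nra).
    assert (hre : forall x, 0 <= x <= 1 -> INR N + beta <= Re (hpt (ray a t (y * x)) N)).
    { intros x hx. rewrite re_hpt. assert (h := re_ray_ge a t (y * x) (hyy x hx)). unfold beta. lra. }
    assert (hb : 0 < INR N + beta) by (unfold beta; assert (h := pos_INR N); lra).
    apply (pderiv_mvt (fun x => em_log M (hpt (ray a t (y * x)) N))
      (fun x => csum (fun j => RtoC (bern j) * (demt (S (S j)) 0 (hpt (ray a t (y * x)) N) * (RtoC y * - t)))%C (S M))).
    + intros x hx. unfold em_log.
      apply (pderiv_csum (fun j x => RtoC (bern j) * demt (S j) 0 (hpt (ray a t (y * x)) N))%C). intros j _.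
      apply pderiv_scal. apply (pderiv_demt (S j) 0 (fun x => hpt (ray a t (y * x)) N)).
      * intros E. apply RtoC_inj in E. lra.
      * specialize (hre x hx). lra.
      * apply pderiv_hpt. apply pderiv_ext with (fun x => a + RtoC x * (RtoC y * - t))%C.
        { intros x'. unfold ray. rewrite RtoC_mult. ring. }
        apply pderiv_affine.
    + intros x hx. apply csum_le. intros j _. specialize (hre x hx).
      rewrite demt_SS_0.
      replace (RtoC (bern j) * (demq (S (S j)) 0 * Cpowc (hpt (ray a t (y * x)) N) (- INR (S j)) * (y * - t)))%C
        with (RtoC (bern j) * demq (S (S j)) 0 * (RtoC y * - t) * Cpowc (hpt (ray a t (y * x)) N) (- RtoC (INR (S j))))%C
        by ring.
      rewrite Cmod_mult. apply Rmult_le_compat; try apply Cmod_ge_0.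
      * rewrite Cmod_mult. apply Rmult_le_compat_l; [apply Cmod_ge_0|].
        rewrite Cmod_mult, Cmod_opp, Cmod_RtoC_nonneg by lra. assert (h := Cmod_ge_0 t). nra.
      * eapply Rle_trans; [apply Cmod_Cpowc_le; lra|].
        rewrite re_opp, im_opp, re_RtoC, im_RtoC, Ropp_0, Rabs_R0, Rmult_0_r, exp_0, Rmult_1_r.
        unfold Rpower. apply exp_le_mono.
        assert (hl : ln (INR N + beta) <= ln (Cmod (hpt (ray a t (y * x)) N))).
        { apply Rcomplements.ln_le; auto. eapply Rle_trans; [exact hre|apply re_le_mod]. }
        assert (hj := pos_INR (S j)). nra.
Qed.

(** Of the L + 1 factors tau/w_n, one joins 1/(w_n - tau) to give a summable O(n^(-2)); the other L
    are each at most |t|/Re a. Hence the bound is uniform in N and y. *)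
Lemma resolvent_tail_bound a t : Cmod t < Re a -> exists B, 0 <= B /\ forall L N y, 0 <= y <= 1 ->
  Cmod (csum (fun n => (RtoC y * t / hpt a n) ^ S L / (hpt a n - RtoC y * t))%C N)
    <= B * (Cmod t / Re a) ^ L.
Proof.
  intros ht. set (beta := Re a - Cmod t). set (alpha := Rmin 1 beta).
  assert (hb : 0 < beta) by (unfold beta; lra).
  assert (hal : 0 < alpha) by (apply Rmin_pos; lra).
  assert (hal1 : alpha <= 1) by apply Rmin_l. assert (hal2 : alpha <= beta) by apply Rmin_r.
  assert (hc := Cmod_ge_0 t).
  assert (hia : 0 < / alpha) by now apply Rinv_0_lt_compat.
  set (c := Cmod t * (/ alpha * / alpha)).
  assert (hc0 : 0 <= c) by (apply Rmult_le_pos; [lra|apply Rmult_le_pos; lra]).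
  assert (hterm : forall n, 0 <= c * / (INR (S n) * INR (S n))).
  { intros n. assert (hn : 0 < INR (S n)) by (apply lt_0_INR; lia).
    apply Rmult_le_pos; auto. left. apply Rinv_0_lt_compat. now apply Rmult_lt_0_compat. }
  exists (Series (fun n => c * / (INR (S n) * INR (S n)))). split.
  { exact (ex_series_rsum_le _ (ex_series_inv_sqr c) hterm O). }
  intros L N y hy. set (r := Cmod t / Re a).
  assert (hr : 0 <= r) by (apply Rdiv_le_0_compat; lra).
  apply Rle_trans with (rsum (fun n => r ^ L * (c * / (INR (S n) * INR (S n)))) N).
  - apply csum_le. intros n _.
    assert (hn := pos_INR n). assert (hw : INR n + Re a <= Cmod (hpt a n)).
    { rewrite <- re_hpt. apply re_le_mod. }
    assert (htau : Cmod (RtoC y * t)%C <= Cmod t).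
    { rewrite Cmod_mult, Cmod_RtoC_nonneg by lra. nra. }
    assert (hw2 : INR n + beta <= Cmod (hpt a n - RtoC y * t)%C).
    { eapply Rle_trans; [|apply re_le_mod]. unfold Cminus. rewrite re_plus, re_opp, re_hpt.
      assert (h := re_le_mod (RtoC y * t)). unfold beta. lra. }
    assert (hw0 : hpt a n <> 0) by (apply Cmod_gt_0; lra).
    assert (hw1 : (hpt a n - RtoC y * t)%C <> 0) by (apply Cmod_gt_0; lra).
    rewrite Cmod_div, Cmod_pow, Cmod_div by auto.
    assert (hS : alpha * INR (S n) <= INR n + beta) by (rewrite S_INR; nra).
    assert (hSn : 0 < INR (S n)) by (apply lt_0_INR; lia).
    assert (haS : 0 < alpha * INR (S n)) by now apply Rmult_lt_0_compat.
    assert (hi : / Cmod (hpt a n - RtoC y * t) <= / alpha * / INR (S n)).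
    { rewrite <- Rinv_mult. apply Rinv_le_contravar; lra. }
    assert (hi2 : / Cmod (hpt a n) <= / alpha * / INR (S n)).
    { rewrite <- Rinv_mult. apply Rinv_le_contravar; unfold beta in *; lra. }
    assert (hi3 : / Cmod (hpt a n) <= / Re a) by (apply Rinv_le_contravar; lra).
    assert (hp1 : 0 < / Cmod (hpt a n)) by (apply Rinv_0_lt_compat; lra).
    assert (hp2 : 0 < / Cmod (hpt a n - RtoC y * t)) by (apply Rinv_0_lt_compat; lra).
    assert (ht0 := Cmod_ge_0 (RtoC y * t)).
    assert (hq : 0 <= Cmod (RtoC y * t) / Cmod (hpt a n)) by (apply Rmult_le_pos; lra).
    set (X := Cmod (RtoC y * t) / Cmod (hpt a n)) in *. set (D := Cmod (hpt a n - RtoC y * t)) in *.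
    replace (X ^ S L / D) with (X ^ L * (X * / D)) by (simpl; unfold Rdiv; ring).
    apply Rmult_le_compat.
    + now apply pow_le.
    + apply Rmult_le_pos; lra.
    + apply pow_incr. split; auto. unfold X, r, Rdiv. apply Rmult_le_compat; lra.
    + unfold c, X. rewrite Rinv_mult. unfold Rdiv.
      replace (Cmod t * (/ alpha * / alpha) * (/ INR (S n) * / INR (S n))) with
        (Cmod t * (/ alpha * / INR (S n)) * (/ alpha * / INR (S n))) by ring.
      apply Rmult_le_compat; [apply Rmult_le_pos; lra|lra|apply Rmult_le_compat; lra|lra].
  - rewrite rsum_scal, Rmult_comm. apply Rmult_le_compat_r; [now apply pow_le|].
    now apply ex_series_rsum_le; [apply ex_series_inv_sqr|].
Qed.

Lemma hpt_ray a t y n : hpt (ray a t y) n = (hpt a n - RtoC y * t)%C.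
Proof. unfold hpt, ray. ring. Qed.

Lemma hurwitz_zeta_INR a m : 0 < Re a ->
  clim (csum (fun n => (/ hpt a n) ^ S (S m))%C) (hurwitz_zeta (RtoC (INR (S m)) + 1) a).
Proof.
  intros ha. assert (hre : 1 < Re (RtoC (INR (S m)) + 1)%C).
  { rewrite re_plus, !re_RtoC. assert (0 < INR (S m)) by (apply lt_0_INR; lia). lra. }
  generalize (hurwitz_zeta_series a _ ha hre). apply clim_ext. intros N. apply csum_ext. intros n _.
  assert (h := re_hpt_pos a n ha).
  rewrite <- RtoC_plus, <- S_INR, Cpowc_opp, Cpowc_INR, Cpow_inv by (auto; now apply re_pos_neq_0).
  reflexivity.
Qed.

Lemma RtoC_INR_neq_0 n : RtoC (INR (S n)) <> 0.
Proof. intros E. apply RtoC_inj in E. now apply not_0_INR in E. Qed.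

(** With t replaced by y t, the two sides at level N are P and Q, and the claim concerns the limit
    of E N 1 - E N 0 for E = P - Q. In dE/dy everything cancels except the variation of [em_log],
    which vanishes as N grows, and the resolvent tail, which is O((|t|/Re a)^L). *)
Theorem hurwitz_expansion_error (a t : C) (q : nat) : 0 < Re a -> Cmod t < Re a ->
  exists B, forall L,
  Cmod (csum (fun k => RtoC (Binomial.C q k) * g k (a - t) * t ^ (q - k)) (S q) - g q a
     - (csum (fun m => hurwitz_zeta (RtoC (INR (S m)) + 1) a * (t ^ (S m + S q) / RtoC (INR (S m + S q)))) L
        - t ^ S q / RtoC (INR (S q)) * (digamma a + euler_gamma)))%C <= B * (Cmod t / Re a) ^ L.
Proof.
  intros ha ht. destruct (resolvent_tail_bound a t ht) as [B [hB HB]].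
  (* One M, large enough for [clim_gapprox] at every k <= q. *)
  set (M := S (S (S q))). destruct (em_log_variation a t M ht) as [e [He Hev]].
  exists (2 * (Cmod t * Cmod t ^ q * B)). intros L.
  set (Sg := fun N m => csum (fun n => (/ hpt a n) ^ S (S m))%C N).
  set (P := fun N y => csum (fun k => RtoC (Binomial.C q k) * gapprox M k N (ray a t y) * (RtoC y * t) ^ (q - k))%C (S q)).
  (* Here [chi] is frozen at a, whereas the derivative of P brings in [chi] at the moving point;
     their difference is what [geom_resolvent] expands. *)
  set (Q := fun N y => (csum (fun m => Sg N m * ((RtoC y * t) ^ (S m + S q) * / RtoC (INR (S m + S q)))) L
    - (/ RtoC (INR (S q)) * chi M N a) * (RtoC y * t) ^ S q)%C).
  set (E := fun N y => (P N y - Q N y)%C).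
  assert (hM : forall k, (k <= q)%nat -> 1 + INR k < INR M).
  { intros k hk. apply le_INR in hk. unfold M. rewrite !S_INR. lra. }
  apply (clim_le_eventually (fun N => E N 1 - E N 0)%C _ (fun N => 2 * (Cmod t * Cmod t ^ q) * e N)).
  - apply clim_ext with (fun N => (csum (fun k => RtoC (Binomial.C q k) * gapprox M k N (a - t) * t ^ (q - k)) (S q)
      - gapprox M q N a) - (csum (fun m => Sg N m * (t ^ (S m + S q) / RtoC (INR (S m + S q)))) L
        - t ^ S q / RtoC (INR (S q)) * chi M N a))%C.
    + intros N. unfold E, P, Q.
      replace (ray a t 1) with (a - t)%C by (unfold ray; ring).
      replace (ray a t 0) with a by (unfold ray; ring).
      replace (1 * t)%C with t by ring. replace (0 * t)%C with (RtoC 0) by ring.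
      (* At y = 0 only k = q survives, with 0^0 = 1; it produces the term -g(p-1,a), and Q
         vanishes. *)
      rewrite (csum_single (fun k => _ * gapprox M k N a * _)%C (S q) q); [|lia|].
      * rewrite (csum_0 (fun m => Sg N m * (0 ^ (S m + S q) * _))%C).
        -- rewrite Nat.sub_diag, binomial_diag. rewrite (Cpow_S 0 q). cbn [Cpow]. unfold Cdiv. ring.
        -- intros m _. cbn [Nat.add]. rewrite Cpow_S. ring.
      * intros k hk hkq. replace (q - k)%nat with (S (q - k - 1)) by lia. rewrite Cpow_S. ring.
    + apply clim_minus; apply clim_minus.
      * apply (clim_csum (fun k N => RtoC (Binomial.C q k) * gapprox M k N (a - t) * t ^ (q - k))%C).
        intros k hk. rewrite (Cmult_comm _ (t ^ (q - k))).
        apply clim_ext with (fun N => t ^ (q - k) * (RtoC (Binomial.C q k) * gapprox M k N (a - t)))%C.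
        { intros; ring. }
        apply clim_scal. apply clim_scal. apply clim_gapprox; [|apply hM; lia].
        unfold Cminus. rewrite re_plus, re_opp. assert (h := re_le_mod t). lra.
      * apply clim_gapprox; auto.
      * apply (clim_csum (fun m N => Sg N m * (t ^ (S m + S q) / RtoC (INR (S m + S q))))%C).
        intros m _. apply clim_mult; [now apply hurwitz_zeta_INR|apply clim_const].
      * apply clim_scal. now apply clim_chi.
  - intros N.
    apply Rle_trans with (2 * (Cmod t * Cmod t ^ q * (e N + B * (Cmod t / Re a) ^ L))); [|right; ring].
    apply (pderiv_mvt (E N) (fun y => (- t * (RtoC y * t) ^ q *
      ((em_log M (hpt (ray a t y) N) - em_log M (hpt a N))
       - csum (fun n => (RtoC y * t / hpt a n) ^ S L / (hpt a n - RtoC y * t)) N))%C)).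
    + intros y hy. assert (hre := re_ray_ge a t y hy).
      assert (hray : 0 < Re (ray a t y)) by lra.
      assert (Ht : pderiv (fun x => RtoC x * t)%C y t).
      { apply pderiv_ext with (fun x => 0 + RtoC x * t)%C; [intros; ring|apply pderiv_affine]. }
      assert (Hr : pderiv (ray a t) y (- t)) by apply pderiv_affine.
      unfold E. eapply pderiv_eq.
      * apply pderiv_minus.
        -- apply (pderiv_appell_sum (fun k x => gapprox M k N (ray a t x)) (chi M N (ray a t y))).
           ++ intros k. now apply pderiv_gapprox_S.
           ++ now apply pderiv_gapprox_0.
        -- unfold Q. apply pderiv_minus.
           ++ apply (pderiv_csum (fun m x => Sg N m * ((RtoC x * t) ^ (S m + S q) * / RtoC (INR (S m + S q))))%C
                (fun m => Sg N m * (RtoC y * t) ^ (S m + q) * t)%C).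
              intros m _. eapply pderiv_eq.
              ** apply pderiv_scal. apply pderiv_mult; [|apply pderiv_const].
                 apply (pderiv_pow (fun x => RtoC x * t)%C). exact Ht.
              ** cbv beta. replace (S m + S q - 1)%nat with (S m + q)%nat by lia.
                 cbn [Nat.add]. assert (h := RtoC_INR_neq_0 (m + S q)). field. exact h.
           ++ apply pderiv_scal. apply (pderiv_pow (fun x => RtoC x * t)%C). exact Ht.
      * cbv beta. set (tau := (RtoC y * t)%C).
        replace (S q - 1)%nat with q by lia.
        (* Exchanging the finite sums over m and n turns the differentiated partial sum of the
           series into resolvents at the points w_n. *)
        assert (EQ : csum (fun m => Sg N m * tau ^ (S m + q) * t)%C L =
          (t * tau ^ q * (csum (fun n => / (hpt a n - tau)) N - csum (fun n => / hpt a n) N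
             - csum (fun n => (tau / hpt a n) ^ S L / (hpt a n - tau)) N))%C).
        { rewrite <- !csum_minus.
          rewrite (csum_ext (fun n => / (hpt a n - tau) - / hpt a n - _)%C
            (fun n => csum (fun m => (/ hpt a n) ^ S (S m) * tau ^ S m)%C L)).
          - rewrite csum_swap, <- csum_scal. apply csum_ext. intros m _.
            rewrite Cpow_add_r. unfold Sg.
            rewrite (csum_ext (fun i => (/ hpt a i) ^ S (S m) * tau ^ S m)%C
              (fun i => tau ^ S m * (/ hpt a i) ^ S (S m))%C) by (intros; ring).
            rewrite csum_scal. ring.
          - intros n _. symmetry. apply geom_resolvent.
            + now apply re_pos_neq_0, re_hpt_pos.
            + unfold tau. rewrite <- hpt_ray. now apply re_pos_neq_0, re_hpt_pos. }
        rewrite EQ. unfold chi.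
        rewrite (csum_ext (fun n => / hpt (ray a t y) n)%C (fun n => / (hpt a n - tau))%C)
          by (intros; now rewrite hpt_ray).
        assert (h := RtoC_INR_neq_0 q).
        set (S1 := csum _ N). set (S2 := csum _ N). set (S3 := csum _ N). field. exact h.
    + intros y hy. rewrite !Cmod_mult, Cmod_opp, Cmod_pow.
      assert (htau : Cmod (RtoC y * t)%C <= Cmod t).
      { rewrite Cmod_mult, Cmod_RtoC_nonneg by lra. assert (h := Cmod_ge_0 t). nra. }
      apply Rmult_le_compat; try apply Cmod_ge_0.
      * apply Rmult_le_pos; [apply Cmod_ge_0|apply pow_le, Cmod_ge_0].
      * apply Rmult_le_compat_l; [apply Cmod_ge_0|]. apply pow_incr. split; [apply Cmod_ge_0|auto].
      * eapply Rle_trans; [apply Cmod_triangle|]. rewrite Cmod_opp.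
        apply Rplus_le_compat; [now apply Hev|now apply HB].
  - now apply lim0_scal.
Qed.

Open Scope C_scope.

Theorem theorem1 (p : nat) (a t : C) (hp : (1 <= p)%nat)
  (ha : (0 < Re a)%R) (ht : (Cmod t < Re a)%R) :
  @is_series C_AbsRing C_NormedModule
    (fun m : nat => let n := S m in
       hurwitz_zeta (RtoC (INR n) + 1) a / RtoC (INR (n + p)) * t ^ (n + p))
    (t ^ p / RtoC (INR p) * (digamma a + euler_gamma)
     + @sum_n C_AbelianMonoid
         (fun k : nat =>
            RtoC (Binomial.C (p - 1) k) * g k (a - t) * t ^ (p - 1 - k))
         (p - 1)
     - g (p - 1) a).
Proof.
  destruct p as [|q]; [lia|]. replace (S q - 1)%nat with q by lia. clear hp.
  rewrite <- csum_sum_n. apply is_series_clim.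
  destruct (hurwitz_expansion_error a t q ha ht) as [B HB].
  apply (clim_squeeze _ _ (fun L => (B * (Cmod t / Re a) ^ L)%R)).
  - intros L. eapply Rle_trans; [|apply (HB L)]. rewrite <- Cmod_opp. right. apply f_equal.
    rewrite (csum_ext (fun m => hurwitz_zeta (RtoC (INR (S m)) + 1) a / RtoC (INR (S m + S q)) * t ^ (S m + S q))
      (fun m => hurwitz_zeta (RtoC (INR (S m)) + 1) a * (t ^ (S m + S q) / RtoC (INR (S m + S q))))).
    + ring.
    + intros m _. unfold Cdiv. ring.
  - apply lim0_scal. apply is_lim_seq_geom. assert (h := Cmod_ge_0 t).
    rewrite Rabs_pos_eq by (apply Rdiv_le_0_compat; lra). apply Rlt_div_l; lra.
Qed.
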